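(* Let $\alpha>0$, let $U\in\mathcal{RV}'_{1/\alpha}$ satisfy the second-order condition with rate $A(t)$ and second-order parameter $\rho<0$, let $X_1,\dots,X_n$ be i.i.d. $\sim\mathrm{RV}(U)$, and let $k=k_n$ be an intermediate sequence. For $\theta\in[0,1)$ define $\hat\alpha^{(\theta),\mathrm{bc}}_{k,n}:=(1-\theta)/\tilde H_{k,n}$, where $\tilde H_{k,n}=H_{k,n}-\frac{A(n/k)}{1-\rho}$, and $\hat\alpha^{(\theta)}_{k,n}:=(1-\theta)/H_{k,n}$. 1. If $k^{-1/2}\ll\theta_k\ll1$ and $|A(n/k)|=O(\theta_k)$, then $\hat\alpha^{(\theta_k),\mathrm{bc}}_{k,n}$ is conservative with decay rate $\lambda_k=\frac k2\theta_k^2$: $$-\log\mathbb{P}\big(\hat\alpha^{(\theta_k),\mathrm{bc}}_{k,n}>\alpha\big)\sim\frac k2\theta_k^2 .$$ 2. Let $\theta_k\ge0$ with $\theta_k\to0$. If $\sqrt k\,|A(n/k)|\to\infty$ and $\liminf_{n\to\infty}\theta_k/|A(n/k)|>-\frac{\alpha}{1-\rho}\,\mathrm{sgn}(A(\infty))$, then $\hat\alpha^{(\theta_k)}_{k,n}$ is conservative with decay rate $$-\log\mathbb{P}\big(\hat\alpha^{(\theta_k)}_{k,n}>\alpha\big)\sim\frac k2\Big(\theta_k+\frac{\alpha}{1-\rho}A(n/k)\Big)^2 .$$ 3. In particular, if $\sqrt k\,A(n/k)\to+\infty$, then the Hill estimator $\hat\alpha_{k,n}=1/H_{k,n}$ has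 a decay rate of $$-\log\mathbb{P}(\hat\alpha_{k,n}>\alpha)\sim\frac{k\alpha^2}{2(1-\rho)^2}A(n/k)^2 .$$
   Context: A function $g$ is in $\mathcal{RV}_\gamma$ if $g(tx)/g(t)\to x^\gamma$ as $t\to\infty$ for every $x>0$. $\mathcal{RV}'_\gamma$ is the set of positive, non-decreasing, left-continuous functions in $\mathcal{RV}_\gamma$ (defined on $(1,\infty)$). $X\sim\mathrm{RV}(U)$ means $X\stackrel{d}{=}U(e^E)$ with $E\sim\mathrm{Exp}(1)$ (so $U$ is the tail quantile function of $X$). Second-order condition with rate $A$: $A\in\mathcal{RV}_\rho$ for some $\rho\le0$ (the second-order parameter), $A(t)\to0$, $A(t)\ne0$ for sufficiently large $t$, and for all $x>0$ $$\lim_{t\to\infty}\frac{U(tx)/U(t)-x^{1/\alpha}}{A(t)}=x^{1/\alpha}\int_1^xu^{\rho-1}\,du .$$ The sign of $A(t)$ is constant for all sufficiently large $t$; it is denoted $\mathrm{sgn}(A(\infty))\in\{-1,+1\}$. Order statistics in decreasing order: $X_{1,n}\ge\dots\ge X_{n,n}$; $H_{k,n}=\frac1k\sum_{i=1}^k\log(X_{i,n}/X_{k,n})$. Convention for reciprocal estimators: $c/T=+\infty$ on $\{T\le0\}$. Intermediate sequence: integers $k=k_n$ with $k_n\to\infty$, $k_n/n\to0$; all limits are along this sequence as $n\to\infty$, with $\theta_k$ and $A(n/k)$ evaluated at $k=k_n$. $a\gg b$ (or $b\ll a$) means $b/a\to0$; $a\sim b$ means $a/b\to1$. ''Conservative with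 decay rate $\lambda_k$'' is understood here among distributions satisfying the second-order condition with the given $A$, and means precisely the displayed asymptotics. *)

(* Defs.v *)
From HB Require Import structures.
From mathcomp Require Export all_boot all_order all_algebra.
From mathcomp Require Export all_classical all_reals all_analysis.

Set Implicit Arguments.
Unset Strict Implicit.
Unset Printing Implicit Defensive.
Export Order.TTheory GRing.Theory Num.Theory.
Export numFieldNormedType.Exports.

Local Open Scope classical_set_scope.
Local Open Scope ring_scope.

(* Functions on (1, oo) are represented by total functions R -> R; only their
   values on (1, oo), or near +oo, are ever constrained. *)

(* Wherever g vanishes the quotient is 0 by convention, so the case x = 1 forces
   g t != 0 for all large t. *)
Definition regularly_varying (R : realType) (gamma : R) (g : R -> R) : Prop :=
  forall x : R, 0 < x -> g (t * x) / g t @[t --> +oo] --> x `^ gamma.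

Definition RV' (R : realType) (gamma : R) (U : R -> R) : Prop :=
  [/\ forall x, 1 < x -> 0 < U x,
      forall x y, 1 < x -> x <= y -> U x <= U y,
      forall x, 1 < x -> U y @[y --> x^'-] --> U x
    & regularly_varying gamma U].

(* int_a^b f(u) du, with the usual sign change when b < a. *)
Definition oriented_integral (R : realType) (a b : R) (f : R -> R) : R :=
  if a <= b then \int[lebesgue_measure]_(u in `[a, b]) f u
  else - \int[lebesgue_measure]_(u in `[b, a]) f u.

Definition second_order (R : realType) (alpha rho : R) (U A : R -> R) : Prop :=
  [/\ rho <= 0,
      regularly_varying rho A,
      A t @[t --> +oo] --> (0 : R),
      \forall t \near +oo, A t != 0
    & forall x : R, 0 < x ->
        (U (t * x) / U t - x `^ alpha^-1) / A t @[t --> +oo]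
          --> x `^ alpha^-1 * oriented_integral 1 x (fun u => u `^ (rho - 1))].

(* sgn(A(oo)): the eventually constant value of the sign of A. *)
Definition sgn_infty (R : realType) (A : R -> R) : R :=
  lim (Num.sg (A t) @[t --> +oo]).

(* X has the law of U(e^E), E ~ Exp(1). Since E > 0 almost surely, U is only
   evaluated on (1, oo). *)
Definition has_law_RV (R : realType) d (T : measurableType d)
    (P : probability T R) (U : R -> R) (X : {RV P >-> R}) : Prop :=
  forall B : set R, measurable B ->
    distribution P X B =
    exponential_prob 1 [set e : R | 0 < e /\ B (U (expR e))].

Definition mutually_independent (R : realType) d (T : measurableType d)
    (P : probability T R) (X : nat -> {RV P >-> R}) : Prop :=
  forall (J : seq nat) (B : nat -> set R), uniq J ->
    (forall j, measurable (B j)) ->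
    P (\bigcap_(j in [set` J]) (X j @^-1` B j)) =
    (\prod_(j <- J) P (X j @^-1` B j))%E.

Definition iid_RV (R : realType) d (T : measurableType d)
    (P : probability T R) (U : R -> R) (X : nat -> {RV P >-> R}) : Prop :=
  mutually_independent X /\ forall j, has_law_RV U (X j).

(* X_{i,n}, 1 <= i <= n: the i-th largest among the first n terms
   x 0, ..., x n.-1 (0 outside this range of i). *)
Definition order_stat (R : realType) (x : nat -> R) (i n : nat) : R :=
  nth 0 (sort >=%R (mkseq x n)) i.-1.

Definition hill_H (R : realType) (x : nat -> R) (k n : nat) : R :=
  k%:R^-1 * \sum_(1 <= i < k.+1) ln (order_stat x i n / order_stat x k n).

Definition bc_H (R : realType) (A : R -> R) (rho : R) (x : nat -> R)
    (k n : nat) : R :=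
  hill_H x k n - A (n%:R / k%:R) / (1 - rho).

Definition reciprocal (R : realType) (c t : R) : \bar R :=
  if t <= 0 then +oo%E else (c / t)%:E.

Definition alpha_hat (R : realType) (theta : R) (x : nat -> R) (k n : nat) :
    \bar R :=
  reciprocal (1 - theta) (hill_H x k n).

Definition alpha_hat_bc (R : realType) (A : R -> R) (rho theta : R)
    (x : nat -> R) (k n : nat) : \bar R :=
  reciprocal (1 - theta) (bc_H A rho x k n).

Definition hill_estimator (R : realType) (x : nat -> R) (k n : nat) : \bar R :=
  reciprocal 1 (hill_H x k n).

Definition intermediate (R : realType) (k : nat -> nat) : Prop :=
  k n @[n --> \oo] --> \oo /\
  (k n)%:R / n%:R @[n --> \oo] --> (0 : R).

(* a << b. As b n = 0 would make the quotient 0, eventual nonvanishing of b is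
   stated separately. *)
Definition much_less (R : realType) (a b : nat -> R) : Prop :=
  (\forall n \near \oo, b n != 0) /\ a n / b n @[n --> \oo] --> (0 : R).

Definition asymp_equiv (R : realType) (a b : nat -> R) : Prop :=
  a n / b n @[n --> \oo] --> (1 : R).

(* - log P(est_n > alpha) ~ lambda_n. When the probability is 0, [ln] returns 0
   rather than -oo; the quotient is then 0, so this can only happen for finitely
   many n, as for the value +oo. *)
Definition conservative_with_decay_rate (R : realType) d (T : measurableType d)
    (P : probability T R) (alpha : R) (est : nat -> T -> \bar R)
    (lambda : nat -> R) : Prop :=
  asymp_equiv
    (fun n => - ln (fine (P [set w | (alpha%:E < est n w)%E]))) lambda.

(* Main.v *)
Require Import Defs.
From HB Require Import structures.
From mathcomp Require Import measurable_realfun exponential_distribution random_variable.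
From mathcomp Require Import ring lra.

(* Write [V s = ln (U (e^s))] and [b s = V s - s / alpha - c0].  Since [rho < 0],
   telescoping the second-order condition along [s, s + 1, s + 2, ...] yields a
   constant [c0] with [b (ln t) ~ A t / rho], so the possibly irregular rate [A]
   can be replaced by [b], which is left-continuous and regularly varying; Baire's
   theorem (instead of the measure-theoretic uniform convergence theorem) makes
   this variation locally uniform.  Above a deterministic threshold [U (e^w)], the
   log-excesses have Laplace transform
     [L (lambda) = 1 - l tau m + l^2 tau^2 + o (tau^2)],  [lambda = alpha l tau],
   with [m = 1 + alpha A(n/k) / (1 - rho)], and independence gives the joint
   transform of the number [N] and the sum [S] of the excesses as
   [(1 + e^(-w) (e^s L (lambda) - 1))^n].  The random threshold [X_{k,n}] is never
   conditioned upon: for the upper bound it is confined to finitely many cells of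
   width of order [tau] (on the log scale), in each of which the Hill statistic
   dominates [S / k] while [N] is close to [k]; for the lower bound the Hill
   statistic is at most [S / k] as soon as [N >= k], and an exponential change
   of measure, whose errors are again Chernoff bounds, gives the matching rate. *)
Set Implicit Arguments.
Unset Strict Implicit.
Unset Printing Implicit Defensive.

Local Open Scope classical_set_scope.
Local Open Scope ring_scope.

(** * Expectations of products of independent variables *)

Section product.
Local Open Scope ereal_scope.
Context {R : realType} {d : measure_display} {T : measurableType d}.
Variable P : probability T R.
Import HBNNSimple.

(** All three claims are one statement: once [1 - theta] is positive, the estimator exceeds [alpha]
    exactly when the Hill statistic lies below a deterministic level [c], and only the gap [tau],
    with [m - alpha * c] equivalent to [tau], matters. The rate comes from minimising
    [- l + l^2 / 2]: the linear term is the gap, the quadratic one the unit variance of a standard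
    exponential, and the minimum [- 1 / 2] is reached at [l = 1]. The exponent has to be known up to
    [o (k tau^2)], so thresholds at distance of order [tau] from [ln (n / k)] must share the same
    bias up to [o (tau)]; pointwise regular variation does not give this, whence the need for local
    uniformity. A second obstacle is that [U] may be constant on intervals, where exceeding
    [U (e^w)] is not the event [E > w]. Thresholds are therefore moved to right ends of flat
    stretches, which left continuity provides in any window of length proportional to [tau]. The
    number of cells does not grow with [n], so the union bound costs a constant factor, absorbed
    because [k tau^2] tends to infinity. *)

Lemma integral_mul_nnsfun d' (T' : measurableType d')
    (mu : {measure set T' -> \bar R}) (G Y : T' -> R) (f : {nnsfun R >-> R}) :
  measurable_fun setT G -> (forall w, 0 <= G w)%R -> measurable_fun setT Y ->
  \int[mu]_w (G w * f (Y w))%:E = \sum_(y \in range f)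
    y%:E * \int[mu]_w (G w * \1_(f @^-1` [set y]) (Y w))%:E.
Proof.
move=> mG G0 mY.
under eq_integral => w _.
  rewrite fimfunE mulr_fsumr.
  under eq_fsbigr do rewrite mulrCA.
  rewrite -fsumEFin//; over.
have mGI y : measurable_fun setT
    (fun w => (G w * \1_(f @^-1` [set y]) (Y w))%:E).
  apply/measurable_EFinP; apply: measurable_funM => //.
  exact: measurableT_comp.
rewrite /= ge0_integral_fsum//; last 2 first.
- by move=> y; under eq_fun do rewrite EFinM; exact: measurable_funeM.
- move=> y w _; rewrite lee_fin.
  have [y0|y0] := leP 0%R y; first by rewrite !mulr_ge0// indicE.
  by rewrite preimage_nnfun0// indicE in_set0 !mulr0.
apply: eq_fsbigr => y; rewrite inE => -[x _ <-].
under eq_integral do rewrite EFinM.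
rewrite ge0_integralZl ?lee_fin//.
by move=> w _; rewrite lee_fin mulr_ge0// indicE.
Qed.

(** Monotone convergence along simple functions. It serves twice: with [W] a product of earlier
    factors, to pass from independence of events to independence of functions, and with [W] the
    exponential density, to compute the law of an observation. *)
Lemma integral_density_pushforward d' (T' : measurableType d')
    (mu : {measure set T' -> \bar R}) (nu : {measure set R -> \bar R})
    (W Y : T' -> R) (F : R -> R) :
  measurable_fun setT W -> (forall w, 0 <= W w)%R -> measurable_fun setT Y ->
  (forall C : set R, measurable C ->
     \int[mu]_w (W w * \1_C (Y w))%:E = nu C) ->
  measurable_fun setT F -> (forall x, 0 <= F x)%R ->
  \int[mu]_w (W w * F (Y w))%:E = \int[nu]_y (F y)%:E.
Proof.
move=> mW W0 mY H mF F0.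
have mT : measurable (setT : set R) by [].
have mEF : measurable_fun setT (fun x => (F x)%:E) by exact/measurable_EFinP.
pose f_ := nnsfun_approx mT mEF.
have mfY n : measurable_fun setT (fun w => f_ n (Y w)).
  exact: measurableT_comp.
have cF x : (fun n => (f_ n x)%:E) @ \oo --> (F x)%:E.
  by apply: cvg_nnsfun_approx => // y _; rewrite lee_fin.
have ndf x m n : (m <= n)%N -> (f_ m x <= f_ n x)%R.
  by move=> mn; exact/lefP/nd_nnsfun_approx.
transitivity (limn (fun n => \int[mu]_w (W w * f_ n (Y w))%:E)).
  rewrite -monotone_convergence//.
  - apply: eq_integral => w _; apply/esym/cvg_lim => //.
    rewrite EFinM; under eq_fun do rewrite EFinM.
    exact: cvgeZl.
  - by move=> n; apply/measurable_EFinP; exact: measurable_funM.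
  - by move=> n w _; rewrite lee_fin mulr_ge0.
  - by move=> w _ m n mn; rewrite lee_fin ler_wpM2l// ndf.
transitivity (limn (fun n => \int[nu]_y (f_ n y)%:E)).
  congr (limn _); apply/funext => n.
  rewrite integral_mul_nnsfun//.
  under [in RHS]eq_integral do rewrite -[X in X%:E]mul1r.
  rewrite (@integral_mul_nnsfun _ _ nu (fun=> 1%R) id)//.
  apply: eq_fsbigr => y _; rewrite H//; congr (_ * _).
  rewrite -[in LHS](setIT (_ @^-1` _)) -integral_indic//.
  by apply: eq_integral => x _; rewrite mul1r.
rewrite -monotone_convergence//.
- by apply: eq_integral => w _; exact/cvg_lim.
- by move=> n; exact/measurable_EFinP.
- by move=> n w _; rewrite lee_fin.
- by move=> w _ m n mn; rewrite lee_fin ndf.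
Qed.

Lemma integral_mul_indic_extend (W : T -> R) (kappa : {nonneg R})
    (Y : {RV P >-> R}) (F : R -> R) :
  measurable_fun setT W -> (forall w, 0 <= W w)%R ->
  (forall C : set R, measurable C ->
     \int[P]_w (W w * \1_C (Y w))%:E = kappa%:num%:E * P (Y @^-1` C)) ->
  measurable_fun setT F -> (forall x, 0 <= F x)%R ->
  \int[P]_w (W w * F (Y w))%:E = kappa%:num%:E * \int[P]_w (F (Y w))%:E.
Proof.
move=> mW W0 H mF F0.
rewrite (@integral_density_pushforward _ _ P (mscale kappa (distribution P Y)))//.
rewrite ge0_integral_mscale//; last 2 first.
- exact/measurable_EFinP.
- by move=> x _; rewrite lee_fin.
by rewrite ge0_integral_distribution//; exact/measurable_EFinP.
Qed.

(** Independence is given for events, so the induction on [m] trades indicators for functions one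
    variable at a time. This forces the mixed form: variables below [m] already carry functions,
    those listed in [J] still carry indicators. *)
Lemma integral_prod_indep_indic (X : nat -> {RV P >-> R}) (F : nat -> R -> R)
    (e : nat -> R) (m : nat) :
  mutually_independent X ->
  (forall i, measurable_fun setT (F i)) -> (forall i x, 0 <= F i x)%R ->
  (forall i, \int[P]_w (F i (X i w))%:E = (e i)%:E) ->
  forall (J : seq nat) (B : nat -> set R),
    uniq J -> all (fun j => (m <= j)%N) J -> (forall j, measurable (B j)) ->
    \int[P]_w (\prod_(i < m) F i (X i w) * \prod_(j <- J) \1_(B j) (X j w))%:E =
    (\prod_(i < m) e i * \prod_(j <- J) fine (P (X j @^-1` B j)))%:E.
Proof.
move=> iX mF F0 Fe.
have mXB j (B : set R) : measurable B -> measurable (X j @^-1` B).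
  by move=> mB; rewrite -[_ @^-1` _]setTI; exact: measurable_funP.
elim: m => [|m IH] J B uJ allJ mB.
  transitivity (P (\bigcap_(j in [set` J]) (X j @^-1` B j))); last first.
    rewrite iX// big_ord0 mul1r; elim: (J) => [|j s ih]; first by rewrite !big_nil.
    by rewrite !big_cons ih EFinM fineK// fin_num_measure//; exact: mXB.
  have mI : measurable (\bigcap_(j in [set` J]) (X j @^-1` B j)).
    by apply: bigcap_measurableType => j _; exact: mXB.
  rewrite -[in RHS](setIT (bigcap _ _)) -integral_indic//; apply: eq_integral => w _.
  congr EFin; rewrite big_ord0 mul1r {uJ allJ mI}.
  elim: J => [|j s ih]; first by rewrite big_nil indicE mem_set//.
  rewrite big_cons ih !indicE -natrM mulnb; congr (_%:R%R); congr nat_of_bool.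
  apply/andP/idP; rewrite !inE.
    move=> [Bj Bs] i /=; rewrite inE => /orP[/eqP->//|]; exact: Bs.
  move=> H; split; first by apply: (H j); rewrite /= mem_head.
  by move=> i /= si; apply: (H i); rewrite /= inE si orbT.
have mJ : m \notin J by apply/negP => /(allP allJ); rewrite ltnn.
pose W w := (\prod_(i < m) F i (X i w) * \prod_(j <- J) \1_(B j) (X j w))%R.
have kappa0 : (0 <= \prod_(i < m) e i * \prod_(j <- J) fine (P (X j @^-1` B j)))%R.
  rewrite mulr_ge0// prodr_ge0// => i _; last by rewrite fine_ge0.
  by rewrite -lee_fin -Fe integral_ge0// => w _; rewrite lee_fin.
pose kappa := NngNum kappa0.
transitivity (\int[P]_w (W w * F m (X m w))%:E).
  by apply: eq_integral => w _; rewrite big_ord_recr/= mulrAC.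
rewrite (@integral_mul_indic_extend W kappa)//.
- by rewrite Fe -EFinM big_ord_recr/= mulrAC.
- apply: measurable_funM; apply: measurable_prod => i _.
    exact: measurableT_comp.
  by apply: measurableT_comp => //; exact: measurable_indic.
- by move=> w; rewrite mulr_ge0// prodr_ge0// => i _; rewrite indicE.
(* The test event [C] of the variable of index [m] is adjoined to [J], which does not contain [m];
   the induction hypothesis then gives the product formula on indicators. *)
- move=> C mC; pose B' j := if j == m then C else B j.
  have B'E j : j \in J -> B' j = B j.
    by rewrite /B'; case: eqP => // ->; rewrite (negPf mJ).
  have B'm : B' m = C by rewrite /B' eqxx.
  have := IH (m :: J) B'; rewrite /= mJ uJ leqnn /= => /(_ isT).
  have -> : all [eta leq m] J by apply: sub_all allJ => j; exact: ltnW.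
  move=> /(_ isT) H.
  transitivity (\int[P]_w (\prod_(i < m) F i (X i w) *
      \prod_(j <- m :: J) \1_(B' j) (X j w))%:E).
    apply: eq_integral => w _; rewrite big_cons B'm /W -mulrA; congr (_ * _)%:E.
    by rewrite mulrC; congr (_ * _)%R; apply: eq_big_seq => j jJ; rewrite B'E.
  rewrite H; last by move=> j; rewrite /B'; case: eqP.
  rewrite big_cons B'm -[P _]fineK ?fin_num_measure//; last exact: mXB.
  rewrite -EFinM mulrCA mulrC /kappa; congr (_ * _ * _)%:E.
  by apply: eq_big_seq => j jJ; rewrite B'E.
Qed.

Lemma integral_prod_indep (X : nat -> {RV P >-> R}) (F : R -> R) (e : R)
    (n : nat) :
  mutually_independent X -> measurable_fun setT F -> (forall x, 0 <= F x)%R ->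
  (forall i, \int[P]_w (F (X i w))%:E = e%:E) ->
  \int[P]_w (\prod_(i < n) F (X i w))%:E = (e ^+ n)%:E.
Proof.
move=> iX mF F0 Fe.
have := @integral_prod_indep_indic X (fun=> F) (fun=> e) n iX (fun=> mF)
  (fun=> F0) Fe [::] (fun=> setT) isT isT (fun=> measurableT).
rewrite big_nil mulr1 prodr_const card_ord => <-.
by apply: eq_integral => w _; rewrite big_nil mulr1.
Qed.

End product.

(** * Regular variation *)

Section rv.
Context {R : realType}.
Implicit Types (F a b V : R -> R).

Lemma cvgyP F (l : R) :
  (F s @[s --> +oo] --> l) <->
  (forall e, 0 < e -> exists M, forall s, M <= s -> `|F s - l| <= e).
Proof.
split=> [/cvgrPdist_le H e e0|H].
  have := H e e0 => -[M [_ HM]]; exists (M + 1) => s Ms.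
  by rewrite distrC; apply: HM; rewrite (lt_le_trans _ Ms)// ltrDl.
apply/cvgrPdist_le => e e0; have [M HM] := H e e0.
near=> s; rewrite distrC; apply: HM; near: s; by apply: nbhs_pinfty_ge; rewrite num_real.
Unshelve. all: end_near. Qed.

Lemma cvg_addry (y : R) : (s + y) @[s --> +oo] --> (+oo : set_system R).
Proof.
apply/cvgryPge => M; near=> s; rewrite -lerBlDr; near: s.
by apply: nbhs_pinfty_ge; rewrite num_real.
Unshelve. all: end_near. Qed.

Lemma cvg_expRy : expR s @[s --> +oo] --> (+oo : set_system R).
Proof.
apply/cvgryPge => M; near=> s.
apply: le_trans (expR_ge1Dx s); rewrite -lerBlDl; near: s.
by apply: nbhs_pinfty_ge; rewrite num_real.
Unshelve. all: end_near. Qed.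

(** As [a] contracts by [r] at each step, the increments of [h] are dominated by a geometric series.
    The bound is uniform in [j], so it survives the passage to the limit. *)
Lemma telescope_geometric (h a : R -> R) (l r e : R) (M : R) :
  0 < l -> 0 < r < 1 -> 0 <= e ->
  (forall s, M <= s -> `|h (s + l) - h s| <= e * `|a s|) ->
  (forall s, M <= s -> `|a (s + l)| <= r * `|a s|) ->
  forall s j, M <= s -> `|h (s + l *+ j) - h s| <= e * `|a s| / (1 - r)
     /\ `|a (s + l *+ j)| <= r ^+ j * `|a s|.
Proof.
move=> l0 /andP[r0 r1] e0 hh ha s j Ms.
(* The partial geometric sum, with its factor [1 - r ^+ j], is the form that closes under
   induction. *)
suff : `|h (s + l *+ j) - h s| <= e * `|a s| * (1 - r ^+ j) / (1 - r)
     /\ `|a (s + l *+ j)| <= r ^+ j * `|a s|.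
  move=> [H1 H2]; split => //; apply: (le_trans H1).
  rewrite ler_pM2r ?invr_gt0 ?subr_gt0// ler_piMr ?mulr_ge0//.
  by rewrite lerBlDr lerDl exprn_ge0 ?ltW.
elim: j => [|j [IH1 IH2]].
  by rewrite mulr0n addr0 subrr normr0 expr0 subrr mulr0 mul0r mul1r.
have Msj : M <= s + l *+ j by rewrite (le_trans Ms)// lerDl mulrn_wge0// ltW.
rewrite mulrSr addrA; split.
  have -> : h (s + l *+ j + l) - h s =
    (h (s + l *+ j + l) - h (s + l *+ j)) + (h (s + l *+ j) - h s) by ring.
  rewrite (le_trans (ler_normD _ _))//.
  have := lerD (le_trans (hh _ Msj) (ler_wpM2l e0 IH2)) IH1.
  move=> /le_trans; apply; rewrite le_eqVlt; apply/orP; left; apply/eqP.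
  by rewrite exprS; field; rewrite subr_eq0 gt_eqF.
by rewrite (le_trans (ha _ Msj))// exprS -mulrA ler_wpM2l// ltW.
Qed.

(** Along [s, s + l, ...] the increments of [F] behave like [(q - 1) / rho] times [a], with
    [q = expR (rho * l) < 1], hence are summable. The constant is the limit of [F] along one
    progression and, since [F (s + y) - F s] tends to 0 for each [y], along all of them. Summing the
    series from [s] on produces the factor [1 / rho]. *)
Lemma second_order_primitive F a (rho l : R) :
  rho < 0 -> 0 < l ->
  (forall y, F (s + y) - F s @[s --> +oo] --> (0 : R)) ->
  (forall y, a (s + y) / a s @[s --> +oo] --> expR (rho * y)) ->
  a s @[s --> +oo] --> (0 : R) ->
  (\forall s \near +oo, a s != 0) ->
  (F (s + l) - F s) / a s @[s --> +oo] --> (expR (rho * l) - 1) / rho ->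
  exists c, (F s - c) / a s @[s --> +oo] --> rho^-1.
Proof.
move=> rho0 l0 F0 aRV a0 aN0 Fl.
pose q := expR (rho * l); have q0 : 0 < q by exact: expR_gt0.
have q1 : q < 1 by rewrite expR_lt1 nmulr_rlt0.
(* A ratio strictly between [q] and 1: the quotient [a (s + l) / a s] tends to [q], so it is
   eventually at most [r] in absolute value. *)
pose r := (1 + q) / 2.
have r01 : 0 < r < 1 by rewrite /r; apply/andP; split; lra.
have [M0 [_ HM0]] := aN0.
have [M1 HM1] : exists M, forall s, M <= s -> `|a (s + l)| <= r * `|a s|.
  have q2 : 0 < (1 - q) / 2 by lra.
  have [M HM] := proj1 (cvgyP _ _) (aRV l) _ q2.
  exists (Num.max M (M0 + 1)) => s; rewrite ge_max => /andP[Ms M0s].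
  have as0 : a s != 0 by apply: HM0; lra.
  rewrite -ler_pdivrMr ?normr_gt0// -normf_div.
  have := HM _ Ms; rewrite -/q ler_norml => /andP[? ?].
  by rewrite ler_norml /r; apply/andP; split; lra.
have key (G : R -> R) (k : R) : (G (s + l) - G s) / a s @[s --> +oo] --> k ->
   forall e, 0 < e -> exists2 M, M1 <= M & forall s, M <= s ->
     `|G (s + l) - G s| <= (`|k| + e) * `|a s|.
  move=> /cvgyP H e e0; have [M HM] := H e e0.
  exists (Num.max (Num.max M (M0 + 1)) M1); first by rewrite le_max lexx orbT.
  move=> s; rewrite !ge_max => /andP[/andP[Ms M0s] M1s].
  have as0 : a s != 0 by apply: HM0; lra.
  rewrite -ler_pdivrMr ?normr_gt0// -normf_div.
  by rewrite -lerBlDl (le_trans (lerB_dist _ _))// HM.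
have [M2 M12 HM2] := key _ _ Fl 1 ltr01.
set C := `|_| + 1 in HM2.
have C0 : 0 <= C by rewrite addr_ge0.
pose u j := F (M2 + l *+ j).
have M2j j : M2 <= M2 + l *+ j by rewrite lerDl mulrn_wge0// ltW.
have M2y (s : R) : (s + l *+ j) @[j --> \oo] --> (+oo : set_system R).
  apply/cvgryPge => M; near=> j; rewrite -lerBlDl -mulr_natr -ler_pdivrMl//.
  by near: j; exact: nbhs_infty_ger.
have HM1' s : M2 <= s -> `|a (s + l)| <= r * `|a s|.
  by move=> ?; apply: HM1; exact: le_trans M12 _.
have cu : cvgn u.
  have -> : u = (fun n => u 0%N + series (telescope u) n).
    by apply/funext => n; rewrite eq_sum_telescope.
  apply: is_cvgD; first exact: is_cvg_cst.
  apply: normed_cvg.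
  apply: (@series_le_cvg _ _ (geometric (C * `|a M2|) r)).
  - by move=> n; rewrite /= normr_ge0.
  - move=> n; apply: geometric_ge0; first exact: mulr_ge0.
    by case/andP: r01 => /ltW.
  - move=> n; change (`|u n.+1 - u n| <= C * `|a M2| * r ^+ n).
    rewrite /u mulrSr addrA (le_trans (HM2 _ (M2j _)))//.
    rewrite -mulrA ler_wpM2l// mulrC.
    have [_] := telescope_geometric l0 r01 C0 HM2 HM1' n (lexx M2).
    by rewrite mulrC.
  - by apply: is_cvg_geometric_series; case/andP: r01 => ? ?; rewrite ger0_norm ?ltW.
exists (limn u).
have Fc s : F (s + l *+ j) @[j --> \oo] --> limn u.
  have -> : (fun j => F (s + l *+ j)) =
     (fun j => (F ((M2 + l *+ j) + (s - M2)) - F (M2 + l *+ j)) + u j).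
    by apply/funext => j; rewrite /u subrK; congr F; ring.
  rewrite -[X in _ --> X]add0r; apply: cvgD => //.
  exact: (cvg_comp _ _ (M2y M2) (F0 (s - M2))).
(* Subtracting [a s / rho] cancels the main term and leaves increments that are [o (a s)], so
   telescoping [h] gives an error [o (a s)]. As [a] tends to 0, [h] and [F] have the same limit
   along a progression. *)
pose h s := F s - a s / rho.
have hl : (h (s + l) - h s) / a s @[s --> +oo] --> (0 : R).
  have : (F (s + l) - F s) / a s - (a (s + l) / a s - 1) / rho @[s --> +oo] -->
      (q - 1) / rho - (q - 1) / rho.
    have h1 : a (s + l) / a s - 1 @[s --> +oo] --> q - 1 by apply: cvgB; [exact: aRV|exact: cvg_cst].
    have h2 : (a (s + l) / a s - 1) / rho @[s --> +oo] --> (q - 1) / rho.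
      by apply: cvgMr_tmp.
    exact: (cvgB Fl h2).
  rewrite subrr; apply: cvg_trans; apply: near_eq_cvg.
  near=> s; have as0 : a s != 0 by near: s.
  by rewrite /h; field; rewrite as0 lt_eqF.
apply/cvgyP => e e0.
have er : 0 < e * (1 - r) / 2 by rewrite divr_gt0// mulr_gt0// subr_gt0; case/andP: r01.
have [M3 M13 HM3] := key _ _ hl _ er.
exists (Num.max M3 (M0 + 1)) => s; rewrite ge_max => /andP[M3s M0s].
have as0 : a s != 0 by apply: HM0; lra.
rewrite normr0 add0r in HM3.
have HM1'' s' : M3 <= s' -> `|a (s' + l)| <= r * `|a s'|.
  by move=> ?; apply: HM1; exact: le_trans M13 _.
have lim : `|h (s + l *+ j) - h s| @[j --> \oo] --> `|limn u - h s|.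
  apply: cvg_norm; apply: cvgB; last exact: cvg_cst.
  rewrite -[X in _ --> X]subr0; apply: cvgB => //.
  rewrite -(mul0r rho^-1); apply: cvgMr_tmp.
  exact: (cvg_comp _ _ (M2y s) a0).
have : `|limn u - h s| <= e * `|a s|.
  apply: (closed_cvg (fun x => x <= e * `|a s|)) lim; first exact: closed_le.
  near=> j.
  have [H _] := telescope_geometric l0 r01 (ltW er) HM3 HM1'' j M3s.
  apply: (le_trans H).
  have -> : e * (1 - r) / 2 * `|a s| / (1 - r) = e * `|a s| / 2.
    by field; rewrite subr_eq0 gt_eqF//; case/andP: r01.
  by rewrite ler_piMr//; [rewrite mulr_ge0// ltW|lra].
rewrite -ler_pdivrMr ?normr_gt0// -normf_div.
suff -> : (limn u - h s) / a s = - ((F s - limn u) / a s - rho^-1) by rewrite normrN.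
by rewrite /h; field; rewrite lt_eqF.
Unshelve. all: end_near. Qed.

End rv.

(** * Locally uniform convergence in regular variation *)

Section uct.
Context {R : realType}.
Implicit Types (g b : R -> R).

(** Baire's theorem yields a rank [n] whose set of shifts [F n] is dense in a neighbourhood of some
    [p]. Left continuity carries the estimate from this dense set to all shifts near [p]; dividing
    the estimate at shift [p + u] from [s] by the one at shift [p] from [s + u] brings the window
    back to 0. The factor 4 is [(1 + eta) / (1 - eta) <= 1 + 4 * eta] for [eta <= 1 / 2]. *)
Lemma slowly_varying_uniform g (eta : R) :
  0 < eta <= 2^-1 ->
  (forall s, 0 < s -> g y @[y --> s^'-] --> g s) ->
  (forall y, g (s + y) / g s @[s --> +oo] --> (1 : R)) ->
  exists delta N, [/\ 0 < delta, 0 < N & forall s u, N <= s -> `|u| <= delta ->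
    g s != 0 /\ `|g (s + u) / g s - 1| <= 4 * eta].
Proof.
move=> /andP[eta0 eta12] gl gsv.
(* The shift 0 already forces [g s != 0]: where [g] vanishes the quotient is 0 by convention, at
   distance 1 from the limit. *)
have [N0 HN0] : exists N0, forall s, N0 <= s -> g s != 0.
  have h2 : 0 < (2^-1 : R) by [].
  have /cvgyP /(_ _ h2)[M HM] := gsv 0.
  exists M => s Ms; apply/eqP => gs0; have := HM s Ms.
  by rewrite gs0 invr0 mulr0 sub0r normrN1; lra.
pose F (n : nat) : set R :=
  [set v | forall s, n%:R <= s -> N0 <= s -> `|g (s + v) / g s - 1| <= eta].
have Fcov v : exists n, F n v.
  have /cvgyP := gsv v => /(_ _ eta0)[M HM].
  exists (Num.truncn `|M|).+1 => s ns _; apply: HM.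
  by rewrite (le_trans (ler_norm M))// (le_trans (ltW (truncnS_gt _)) ns).
have [n [G [G0 oG GF]]] : exists n, exists G : set R,
    [/\ G !=set0, open G & G `<=` closure (F n)].
  apply: contrapT => H.
  have := @Baire R R^o (fun n => ~` closure (F n)).
  have HB n : open (~` closure (F n) : set R^o) /\ dense (~` closure (F n) : set R^o).
    split; first by rewrite openC; exact: closed_closure.
    move=> G G0 oG; apply: contrapT => GF; apply: H; exists n, G; split => //.
    by move=> x Ox; apply: contrapT => nx; apply: GF; exists x.
  have T0 : (setT : set R^o) !=set0 by exists 0.
  move=> /(_ HB setT T0 openT) [x [_ Hx]].
  have [n Fn] := Fcov x; have /= := Hx n I; apply.
  exact: subset_closure.
have [p Gp] := G0.
have /nbhs_ballP[h /= h0 hO] : nbhs p G by exact: open_nbhs_nbhs.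
(* The entry [- p + h] keeps [s + (p + v)] positive whenever [v] is below [h] in absolute value, as
   left continuity of [g] requires. *)
pose N := Num.max (Num.max n%:R N0) (Num.max 0 (- p + h)).
have key s v : N <= s -> `|v| < h -> `|g (s + (p + v)) / g s - 1| <= eta.
  rewrite /N !ge_max => /andP[/andP[ns N0s] /andP[s0 phs]] vh.
  rewrite leNgt; apply/negP => bad.
  have spv : 0 < s + (p + v) by move: vh; rewrite ltr_norml => /andP[? ?]; lra.
  have cv : `|g y / g s - 1| @[y --> (s + (p + v))^'-] --> `|g (s + (p + v)) / g s - 1|.
    apply: cvg_norm; apply: cvgB; last exact: cvg_cst.
    by apply: cvgMr_tmp; exact: gl.
  have /cvgr_gt /(_ _ bad) := cv.
  rewrite -nbhs_nearE => -[xi /= xi0 Hxi].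
  (* A failure at [p + v] would persist on an interval to its left. The ball of centre [z] and
     radius [m / 2] lies in that interval and its centre in [G], where [F n] is dense, so the ball
     meets [F n]: a contradiction. *)
  pose m := Num.min xi (h + v).
  have m0 : 0 < m.
    by rewrite /m lt_min xi0/=; move: vh; rewrite ltr_norml => /andP[? ?]; lra.
  have [mxi mh] : m <= xi /\ m <= h + v by rewrite /m !ge_min !lexx orbT.
  pose z := p + v - m / 2.
  have Oz : G z.
    apply: hO; rewrite /ball/= /z.
    by move: vh; rewrite ltr_norml => /andP[? ?]; rewrite ltr_norml; apply/andP; split; lra.
  have [y [Fy zy]] : (F n `&` ball z (m / 2)) !=set0.
    by apply: (GF _ Oz); apply: nbhsx_ballx; lra.
  move: zy; rewrite /ball/= /z ltr_norml => /andP[? ?].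
  have := Fy s ns N0s; rewrite leNgt => /negP; apply; apply: Hxi; last by lra.
  by rewrite /ball/= ltr_norml; apply/andP; split; lra.
(* The extra [h] leaves [s + u] above [N], so that [key] applies from [s] and from [s + u]. *)
exists (h / 2), (N + h + 1); split; first lra.
  have : 0 <= N by rewrite /N !le_max lexx !orbT.
  by lra.
  move=> s u Ns uh.
have [uh1 uh2] : - h / 2 <= u /\ u <= h / 2.
  by move: uh; rewrite ler_norml => /andP[? ?]; split; lra.
have Ns' : N <= s by lra.
have Nsu : N <= s + u by lra.
have N0N : N0 <= N by rewrite /N !le_max lexx !orbT.
have gs : g s != 0 by apply: HN0; exact: le_trans Ns'.
have gsu : g (s + u) != 0 by apply: HN0; exact: le_trans Nsu.
split => //.
have uh' : `|u| < h by lra.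
have H1 := key _ _ Ns' uh'.
have H2 : `|g (s + (p + u)) / g (s + u) - 1| <= eta.
  have := key _ 0 Nsu; rewrite normr0 addr0 => /(_ h0).
  by congr (`|g _ / _ - _| <= _); ring.
set x := g (s + (p + u)) in H1 H2.
have : (1 - eta) <= x / g s <= 1 + eta.
  by move: H1; rewrite ler_norml => /andP[? ?]; apply/andP; split; lra.
have : (1 - eta) <= x / g (s + u) <= 1 + eta.
  by move: H2; rewrite ler_norml => /andP[? ?]; apply/andP; split; lra.
set q := x / g (s + u) => /andP[q1 q2].
have q0 : 0 < q by lra.
have -> : x / g s = q * (g (s + u) / g s) by rewrite /q; field; rewrite gs gsu.
set w := g (s + u) / g s => /andP[w1 w2].
rewrite ler_norml; apply/andP; split; nra.
Qed.

(** Multiplying by [expR (- (rho * s))] reduces to slow variation; undoing it costs a factor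
    continuous at [u = 0]. The error budget is [eps / 2 * (5 / 4) + eps / 4 < eps]. *)
Lemma regularly_varying_uniform b (rho eps : R) :
  0 < eps <= 1 ->
  (forall s, 0 < s -> b y @[y --> s^'-] --> b s) ->
  (forall y, b (s + y) / b s @[s --> +oo] --> expR (rho * y)) ->
  exists delta N, [/\ 0 < delta, 0 < N & forall s u, N <= s -> `|u| <= delta ->
    b s != 0 /\ `|b (s + u) / b s - 1| <= eps].
Proof.
move=> /andP[eps0 eps1] bl brv.
pose g s := b s * expR (- (rho * s)).
have gb s u : g (s + u) / g s = b (s + u) / b s * expR (- (rho * u)).
  rewrite /g mulrDr opprD expRD invfM -(expRN (- (rho * s))) opprK.
  rewrite [LHS](_ : _ = (b (s + u) / b s * expR (- (rho * u))) *
     (expR (- (rho * s)) * expR (rho * s))); last by ring.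
  by rewrite -expRD addNr expR0 mulr1.
have [delta [N [d0 N0 H]]] : exists delta N, [/\ 0 < delta, 0 < N &
    forall s u, N <= s -> `|u| <= delta ->
    g s != 0 /\ `|g (s + u) / g s - 1| <= 4 * (eps / 8)].
  apply: slowly_varying_uniform; first by apply/andP; split; lra.
  - move=> s s0; apply: cvgM; first exact: bl.
    apply: cvg_at_left_filter; apply: continuous_comp; last exact: continuous_expR.
    apply: (@continuousN _ R^o); apply: mulrl_continuous.
  - move=> y; under eq_fun do rewrite gb.
    rewrite -(_ : expR (rho * y) * expR (- (rho * y)) = 1); last first.
      by rewrite -expRD addrN expR0.
    by apply: cvgMr_tmp; exact: brv.
have [delta' d'0 H'] : exists2 delta', 0 < delta' &
    forall u, `|u| <= delta' -> `|expR (rho * u) - 1| <= eps / 4.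
  have c0 : expR (rho * u) @[u --> (0 : R)] --> (1 : R).
    rewrite -expR0 -[X in expR X](mulr0 rho).
    apply: continuous_comp; last exact: continuous_expR.
    exact: mulrl_continuous.
  have /cvgrPdist_le /(_ (eps / 4)) := c0.
  have e4 : 0 < eps / 4 by lra.
  move=> /(_ e4) /nbhs_ballP[d1 /= d10 Hd1].
  exists (d1 / 2) => [|u ud]; first lra.
  by rewrite distrC; apply: Hd1; rewrite /ball/= sub0r normrN; lra.
exists (Num.min delta delta'), N; split => //; first by rewrite lt_min d0.
move=> s u Ns; rewrite le_min => /andP[ud ud'].
have [gs Hg] := H _ _ Ns ud.
have bs : b s != 0 by apply: contra_neq gs => bs; rewrite /g bs mul0r.
split => //; have {ud'} Hy := H' _ ud'; rewrite gb in Hg.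
have -> : b (s + u) / b s = (b (s + u) / b s * expR (- (rho * u))) * expR (rho * u).
  by rewrite -mulrA -expRD addNr expR0 mulr1.
move: Hg Hy; set x := b (s + u) / b s * expR (- (rho * u)); set y := expR _.
move=> Hx Hy; have -> : x * y - 1 = (x - 1) * y + (y - 1) by ring.
rewrite (le_trans (ler_normD _ _))// normrM.
have y54 : `|y| <= 5 / 4.
  by move: Hy; rewrite !ler_norml => /andP[? ?]; apply/andP; split; lra.
have Hxy := ler_pM (normr_ge0 _) (normr_ge0 _) Hx y54.
by lra.
Qed.

(** A Potter-type bound, needed as a domination under the expectation. Since [rho < 0], a step of
    length [delta] eventually does not increase the absolute value of [b]; the remainder of [e]
    modulo [delta] lies in the uniform window, where the ratio is at most 2. *)
Lemma regularly_varying_bounded b (rho : R) :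
  rho < 0 ->
  (forall s, 0 < s -> b y @[y --> s^'-] --> b s) ->
  (forall y, b (s + y) / b s @[s --> +oo] --> expR (rho * y)) ->
  exists2 N, 0 < N & forall s e, N <= s -> 0 <= e -> b s != 0 /\ `|b (s + e)| <= 2 * `|b s|.
Proof.
move=> rho0 bl brv.
have h01 : 0 < (1 : R) <= 1 by rewrite ltr01 lexx.
have [delta [N [d0 N0 H]]] := regularly_varying_uniform h01 bl brv.
have q1 : expR (rho * delta) < 1 by rewrite expR_lt1 nmulr_rlt0.
have e1 : 0 < 1 - expR (rho * delta) by lra.
have /cvgyP /(_ _ e1)[M HM] := brv delta.
pose N' := Num.max N M.
have NN' : N <= N' by rewrite le_max lexx.
have step s : N' <= s -> `|b (s + delta)| <= `|b s|.
  rewrite ge_max => /andP[Ns Ms].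
  have ud : `|0 : R| <= delta by rewrite normr0 ltW.
  have [bs _] := H _ _ Ns ud.
  have := HM _ Ms; rewrite ler_norml => /andP[h1 h2].
  have ex0 := expR_gt0 (rho * delta).
  rewrite -[leRHS]mul1r -ler_pdivrMr ?normr_gt0// -normf_div ler_norml.
  by apply/andP; split; lra.
have stepn s j : N' <= s -> `|b (s + delta *+ j)| <= `|b s|.
  move=> Ns; elim: j => [|j IH]; first by rewrite mulr0n addr0.
  apply: le_trans IH; rewrite mulrSr addrA; apply: step.
  by rewrite (le_trans Ns)// lerDl mulrn_wge0// ltW.
exists N' => [|s e Ns e0]; first exact: lt_le_trans NN'.
pose j := Num.truncn (e / delta).
have je : j%:R <= e / delta < j.+1%:R.
  by apply: truncn_itv; rewrite divr_ge0// ltW.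
pose u := e - delta *+ j.
have [u0 ud] : 0 <= u /\ u <= delta.
  rewrite /u -mulr_natr; case/andP: je; rewrite ler_pdivlMr// ltr_pdivrMr// => h1 h2.
  move: h2; rewrite -natr1 mulrDl mul1r => h2. by split; lra.
have Ns' : N <= s by exact: le_trans Ns.
have ud' : `|u| <= delta by rewrite ger0_norm.
have [bs Hb] := H _ _ Ns' ud'.
split => //.
have -> : s + e = (s + u) + delta *+ j by rewrite /u; ring.
apply: le_trans (stepn _ j _) _; first by rewrite (le_trans Ns)// lerDl.
rewrite -ler_pdivrMr ?normr_gt0// -normf_div.
by move: Hb; rewrite !ler_norml => /andP[? ?]; apply/andP; split; lra.
Qed.

End uct.

(** * The exponential law *)

Section law.
Context {R : realType} {d : measure_display} {T : measurableType d}.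
Variable P : probability T R.
Notation mu := lebesgue_measure.
Implicit Types (U F : R -> R).

(* The value 0 on the negative half-line keeps the function nondecreasing, hence
   measurable, on the whole line. *)
Definition quantile_exp U (e : R) : R := if 0 < e then U (expR e) else 0.

Lemma nondecreasing_quantile_exp U :
  (forall x, 1 < x -> 0 < U x) ->
  (forall x y, 1 < x -> x <= y -> U x <= U y) ->
  nondecreasing_fun (quantile_exp U).
Proof.
move=> U0 Und x y xy; rewrite /quantile_exp.
case: (ltP 0 x) => x0; last by case: ifP => // y0; rewrite ltW// U0// expR_gt1.
by rewrite (lt_le_trans x0 xy) Und// ?expR_gt1// ler_expR.
Qed.

Lemma integral_law U (X : {RV P >-> R}) F :
  nondecreasing_fun (quantile_exp U) ->
  has_law_RV U X -> measurable_fun setT F -> (forall x, 0 <= F x) ->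
  (\int[P]_w (F (X w))%:E =
   \int[mu]_e (exponential_pdf 1 e * F (quantile_exp U e))%:E)%E.
Proof.
move=> Und lX mF F0; set Q := quantile_exp U.
have mQ : measurable_fun setT Q by exact: nondecreasing_measurable.
have m0 : measurable [set e : R | 0 < e].
  rewrite (_ : [set _ | _] = `]0, +oo[%classic); first exact: measurable_itv.
  by apply/seteqP; split=> x /=; rewrite in_itv/= andbT.
have mpdf : measurable_fun setT (@exponential_pdf R 1) by exact: measurable_exponential_pdf.
have pdf0 (x : R) : 0 <= exponential_pdf 1 x by exact: exponential_pdf_ge0.
transitivity (\int[distribution P X]_y (F y)%:E)%E.
  rewrite ge0_integral_distribution//; exact/measurable_EFinP.
rewrite -(@integral_density_pushforward _ _ _ mu (distribution P X)
  (exponential_pdf 1) Q F)// => C mC.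
transitivity (exponential_prob 1 [set e : R | 0 < e /\ C (U (expR e))]); last exact/esym/(lX C mC).
rewrite /exponential_prob.
rewrite [RHS]integral_mkcond; apply: ae_eq_integral => //.
- apply/measurable_EFinP; apply: measurable_funM => //.
  exact: measurableT_comp.
- apply/(measurable_restrictT _ _).1.
    rewrite (_ : [set _ | _] = [set e | 0 < e] `&` Q @^-1` C).
      apply: measurableI => //; rewrite -[_ @^-1` _]setTI; exact: mQ.
    by apply/seteqP; split=> x /= [x0]; rewrite /Q /quantile_exp x0.
  exact/measurable_funTS/measurable_EFinP.
(* The integrands can differ at [e = 0] only: the density vanishes before, and after it
   [quantile_exp U e] is [U (expR e)]. *)
exists [set 0]; split => //; first exact: lebesgue_measure_set1.
move=> e /= H; apply: contrapT => e0; apply: H => _.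
rewrite patchE; case: (ltgtP e 0) => [eneg|epos|//].
  rewrite lt0_exponential_pdf// mul0r.
  by case: ifP.
have -> : Q e = U (expR e) by rewrite /Q /quantile_exp epos.
case: ifPn => [/set_mem[_ CU]|/negP nCU].
  by rewrite indicE mem_set// mulr1.
by rewrite indicE memNset ?mulr0// => CU; apply: nCU; rewrite inE.
Qed.

End law.

(** * Expectations under the standard exponential law *)

Section exponential_expectation.
Context {R : realType}.
Notation mu := lebesgue_measure.
Implicit Types (h : R -> R) (c w : R).

(** The expectation of [h (E)] for a standard exponential [E], kept real-valued; this is why the
    lemmas carry bounds on [h] over the nonnegative half-line. Values at negative points are killed
    by the density. *)
Definition expE h : R := \int[mu]_e (exponential_pdf 1 e * h e).

Let pdf0 (x : R) : 0 <= exponential_pdf 1 x.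
Proof. exact: exponential_pdf_ge0. Qed.

Let mpdf : measurable_fun setT (@exponential_pdf R 1).
Proof. exact: measurable_exponential_pdf. Qed.

Lemma integrable_pdf_bounded h c :
  measurable_fun setT h -> (forall e, 0 <= e -> `|h e| <= c) ->
  mu.-integrable setT (fun e => (exponential_pdf 1 e * h e)%:E).
Proof.
move=> mh hc; apply: (@le_integrable _ _ _ mu setT _ _
   (fun e => (exponential_pdf 1 e * c)%:E)) => //.
- by apply/measurable_EFinP; exact: measurable_funM.
- move=> e _ /=; rewrite lee_fin !normrM.
  have [e0|e0] := ltP e 0; first by rewrite lt0_exponential_pdf// normr0 !mul0r.
  by rewrite ler_wpM2l// (le_trans (hc _ e0))// ler_norm.
- under eq_fun do rewrite mulrC EFinM.
  apply: integrableZl => //; exact: integrable_exponential_pdf.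
Qed.

Lemma expEE h c : measurable_fun setT h -> (forall e, 0 <= e -> `|h e| <= c) ->
  (\int[mu]_e (exponential_pdf 1 e * h e)%:E)%E = (expE h)%:E.
Proof.
move=> mh hc; rewrite /expE /Rintegral fineK//.
by apply: integrable_fin_num => //; exact: integrable_pdf_bounded hc.
Qed.

Lemma eq_expE h1 h2 : (forall e, 0 <= e -> h1 e = h2 e) -> expE h1 = expE h2.
Proof.
move=> H; apply: eq_Rintegral => e _; have [e0|e0] := ltP e 0.
  by rewrite lt0_exponential_pdf// !mul0r.
by rewrite H.
Qed.

Lemma expED h1 h2 c1 c2 :
  measurable_fun setT h1 -> (forall e, 0 <= e -> `|h1 e| <= c1) ->
  measurable_fun setT h2 -> (forall e, 0 <= e -> `|h2 e| <= c2) ->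
  expE (fun e => h1 e + h2 e) = expE h1 + expE h2.
Proof.
move=> m1 H1 m2 H2; rewrite /expE -RintegralD//.
- by apply: eq_Rintegral => e _; rewrite mulrDr.
- exact: integrable_pdf_bounded H1.
- exact: integrable_pdf_bounded H2.
Qed.

Lemma expEZ h k c : measurable_fun setT h -> (forall e, 0 <= e -> `|h e| <= c) ->
  expE (fun e => k * h e) = k * expE h.
Proof.
move=> mh H; rewrite /expE -RintegralZl//; last exact: integrable_pdf_bounded H.
by apply: eq_Rintegral => e _; rewrite mulrCA.
Qed.

Lemma measurable_expRN c : measurable_fun setT (fun e : R => expR (- (c * e))).
Proof.
by apply: measurableT_comp => //; apply: measurable_funN; exact: measurable_funM.
Qed.

Lemma expE_expR c : 0 <= c -> expE (fun e => expR (- (c * e))) = (1 + c)^-1.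
Proof.
move=> c0; have c10 : 0 < 1 + c by lra.
have I1 : \int[mu]_e exponential_pdf (1 + c) e = 1.
  by rewrite /Rintegral integral_exponential_pdf.
apply: (mulfI (lt0r_neq0 c10)); rewrite mulfV ?gt_eqF// -[RHS]I1 /expE -RintegralZl//.
- apply: eq_Rintegral => e _; have [e0|e0] := ltP e 0.
    by rewrite !lt0_exponential_pdf// mul0r mulr0.
  by rewrite !exponential_pdfE// mul1r -expRD; congr (_ * expR _); ring.
- apply: (@integrable_pdf_bounded _ 1).
    exact: measurable_expRN.
  by move=> e e0; rewrite ger0_norm ?expR_ge0// -expR0 ler_expR oppr_le0 mulr_ge0.
Qed.

Lemma expE_cst k : expE (fun=> k) = k.
Proof.
transitivity (k * expE (fun e => expR (- (0 * e)))); last first.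
  by rewrite expE_expR// addr0 invr1 mulr1.
rewrite -(@expEZ _ k 1 (measurable_expRN 0)).
  by apply: eq_expE => e _; rewrite mul0r oppr0 expR0 mulr1.
by move=> e _; rewrite mul0r oppr0 expR0 normr1.
Qed.

Lemma expE_le h1 h2 c1 c2 :
  measurable_fun setT h1 -> (forall e, 0 <= e -> `|h1 e| <= c1) ->
  measurable_fun setT h2 -> (forall e, 0 <= e -> `|h2 e| <= c2) ->
  (forall e, 0 <= e -> h1 e <= h2 e) -> expE h1 <= expE h2.
Proof.
move=> m1 H1 m2 H2 H; apply: le_Rintegral => //.
- exact: integrable_pdf_bounded H1.
- exact: integrable_pdf_bounded H2.
move=> e _; have [e0|e0] := ltP e 0.
  by rewrite lt0_exponential_pdf// !mul0r.
by rewrite ler_wpM2l// H.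
Qed.

Lemma norm_expE_le h c :
  measurable_fun setT h -> (forall e, 0 <= e -> `|h e| <= c) -> `|expE h| <= c.
Proof.
move=> mh H; rewrite ler_norml; apply/andP; split.
  rewrite -[leLHS]expE_cst.
  apply: (@expE_le (fun=> - c) h `|- c| c) => // e /H; rewrite ler_norml => /andP[]//.
rewrite -[leRHS]expE_cst.
by apply: (@expE_le h (fun=> c) c `|c|) => // e /H; rewrite ler_norml => /andP[].
Qed.

Lemma cvg_expE (h_ : nat -> R -> R) h c :
  (forall n, measurable_fun setT (h_ n)) -> measurable_fun setT h ->
  (forall n e, 0 <= e -> `|h_ n e| <= c) ->
  (forall e, 0 <= e -> h_ n e @[n --> \oo] --> h e) ->
  expE (h_ n) @[n --> \oo] --> expE h.
Proof.
move=> mh_ mh hc hh.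
have hc' e : 0 <= e -> `|h e| <= c.
  move=> e0; apply: (closed_cvg (fun x => x <= c)) (cvg_norm (hh e e0)).
    exact: closed_le.
  by apply: nearW => n; exact: hc.
have mh' (g : R -> R) : measurable_fun setT g ->
    measurable_fun setT (fun e => (exponential_pdf 1 e * g e)%:E).
  by move=> mg; apply/measurable_EFinP; exact: measurable_funM.
have [] := @dominated_convergence _ _ _ mu setT measurableT
  (fun n e => (exponential_pdf 1 e * h_ n e)%:E)
  (fun e => (exponential_pdf 1 e * h e)%:E)
  (fun e => (exponential_pdf 1 e * c)%:E).
- by move=> n; exact: mh'.
- exact: mh'.
- apply: aeW => e _; apply/cvg_EFin; first exact: nearW.
  rewrite /comp/=; have [e0|e0] := ltP e 0.
    rewrite lt0_exponential_pdf// mul0r.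
    by under eq_fun do rewrite mul0r; exact: cvg_cst.
  by apply: cvgMl_tmp; exact: hh.
- apply: (@integrable_pdf_bounded _ `|c|) => //.
- apply: aeW => e n _; rewrite /= lee_fin normrM.
  have [e0|e0] := ltP e 0; first by rewrite lt0_exponential_pdf// normr0 !mul0r.
  by rewrite ger0_norm// ler_wpM2l// hc.
move=> _ _; under eq_fun do rewrite (expEE (mh_ _) (hc _)).
by rewrite (expEE mh hc') => /fine_cvgP[_].
Qed.

(** Translation invariance, by uniqueness of Lebesgue measure: the image measure gives every
    half-open interval its length. *)
Lemma integral_shift w (h : R -> R) :
  measurable_fun setT h -> (forall e, 0 <= h e) ->
  (\int[mu]_e (h e)%:E = \int[mu]_e (h (w + e)%R)%:E)%E.
Proof.
move=> mh h0; have mw : measurable_fun setT (fun e : R => w + e).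
  exact: measurable_funD.
have -> : (\int[mu]_e (h (w + e)%R)%:E =
    \int[pushforward mu ((fun e : R => w + e)%R : _ -> measurableTypeR R)]_e (h e)%:E)%E.
  rewrite ge0_integral_pushforward//; first exact/measurable_EFinP.
  by move=> e _; rewrite lee_fin.
apply: eq_measure_integral => //= A mA _.
apply: lebesgue_measure_unique => //= _ [[a b]] _ <-.
rewrite /pushforward (_ : _ @^-1` _ = `]a - w, b - w]%classic).
  by rewrite !lebesgue_measure_itv/= !lte_fin ltrD2r; case: ifP => // _; congr EFin; ring.
by apply/seteqP; split=> x /=; rewrite !in_itv/= => /andP[? ?]; apply/andP; split; lra.
Qed.

(** The point 0 is left out because, after a shift by a threshold, it is the threshold itself, which
    is not a strict exceedance and obeys a different formula. *)
Lemma ae_eq_expE h1 h2 : measurable_fun setT h1 -> measurable_fun setT h2 ->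
  (forall e, 0 < e -> h1 e = h2 e) -> expE h1 = expE h2.
Proof.
move=> m1 m2 H; rewrite /expE /Rintegral; congr fine; apply: ae_eq_integral => //.
- by apply/measurable_EFinP; exact: measurable_funM.
- by apply/measurable_EFinP; exact: measurable_funM.
exists [set 0]; split => //; first exact: lebesgue_measure_set1.
move=> e /= K; apply: contrapT => e0; apply: K => _; congr EFin.
case: (ltgtP e 0) => [eneg|epos|//]; first by rewrite lt0_exponential_pdf// !mul0r.
by rewrite H.
Qed.

(** Memorylessness: with probability [1 - expR (- w)] the variable stays below [w], and otherwise
    its overshoot is again standard exponential. *)
Lemma expE_split h w k c : 0 <= w -> measurable_fun setT h ->
  (forall e, 0 <= h e <= c) -> (forall e, 0 < e < w -> h e = k) ->
  expE h = (1 - expR (- w)) * k + expR (- w) * expE (fun e => h (w + e)).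
Proof.
move=> w0 mh h0c hk.
pose I (e : R) : R := \1_`[w, +oo[%classic e.
have IE e : I e = (w <= e)%R%:R by rewrite /I indicE mem_setE in_itv/= andbT.
have mI : measurable_fun setT I by apply: measurable_indic; exact: measurable_itv.
have tail (g : R -> R) c' : measurable_fun setT g -> (forall e, 0 <= g e <= c') ->
    expE (fun e => I e * g e) = expR (- w) * expE (fun e => g (w + e)).
  move=> mg g0c.
  have mgw : measurable_fun setT (fun e => g (w + e)).
    by apply: measurableT_comp => //; exact: measurable_funD.
  rewrite -(@expEZ _ _ c')//; last first.
    by move=> e _; case/andP: (g0c (w + e)) => ? ?; rewrite ger0_norm.
  rewrite /expE /Rintegral; congr fine.
  rewrite (@integral_shift w (fun e => exponential_pdf 1 e * (I e * g e))); last 2 first.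
  - by apply: measurable_funM => //; exact: measurable_funM.
  - by move=> e; case/andP: (g0c e) => ? ?; rewrite !mulr_ge0// IE.
  apply: eq_integral => e _; congr EFin; rewrite IE.
  have [e0|e0] := ltP e 0.
    by rewrite (lt0_exponential_pdf 1 e0) lerDl leNgt e0/= !mul0r mulr0.
  rewrite lerDl e0 mul1r !exponential_pdfE// ?addr_ge0// !mul1r mulrA -!expRD.
  by congr (expR _ * _); ring.
have c0 : 0 <= c by case/andP: (h0c 0); exact: le_trans.
have hle e : `|h e| <= c.
  by case/andP: (h0c e) => ? ?; rewrite ger0_norm.
have I01 e : 0 <= I e <= 1 by rewrite IE; case: (w <= e); rewrite ?lexx ?ler01.
have E1 : expE h = expE (fun e => (1 - I e) * k) + expE (fun e => I e * h e).
  rewrite -(@expED _ _ `|k| c).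
  - apply: ae_eq_expE => //.
      by apply: measurable_funD; apply: measurable_funM => //; exact: measurable_funB.
    move=> e e0; rewrite IE; have [we|ew] := leP w e.
      by rewrite subrr mul0r mul1r add0r.
    by rewrite subr0 mul0r mul1r addr0 hk// e0.
  - by apply: measurable_funM => //; exact: measurable_funB.
  - move=> e _; rewrite normrM ler_piMl//; case/andP: (I01 e) => ? ?.
    by rewrite ger0_norm; lra.
  - exact: measurable_funM.
  - by move=> e _; case/andP: (I01 e) => ? ?; rewrite normrM [`|I e|]ger0_norm// (le_trans _ (hle e))// ler_piMl.
have E2 : expE (fun e => 1 - I e) = 1 - expR (- w).
  have := tail (fun=> 1) 1 (measurable_cst _) (fun=> _); rewrite expE_cst mulr1 => <-; last first.
    by rewrite ler01 lexx.
  rewrite -[X in X - _](expE_cst 1) -mulN1r -(@expEZ _ _ 1)//; last 2 first.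
  - exact: measurable_funM.
  - by move=> e _; case/andP: (I01 e) => ? ?; rewrite mulr1 ger0_norm.
  rewrite -(@expED _ _ 1 1)//.
  - by apply: eq_expE => e _; rewrite mulr1 mulN1r.
  - by move=> e _; rewrite normr1.
  - by apply: measurable_funM => //; exact: measurable_funM.
  - by move=> e _; case/andP: (I01 e) => ? ?; rewrite mulr1 normrM normrN1 mul1r ger0_norm.
rewrite E1 (tail _ c)//; congr (_ + _); rewrite -E2 mulrC -(@expEZ _ _ 1).
- by apply: eq_expE => e _; rewrite mulrC.
- exact: measurable_funB.
- by move=> e _; case/andP: (I01 e) => ? ?; rewrite ger0_norm; lra.
Qed.

End exponential_expectation.

(** * Asymptotics of the Laplace transform *)

Section laplace.
Context {R : realType}.
Implicit Types (V : R -> R) (w lam : R).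

(** For [V] the log-quantile and [w] an increase point, memorylessness makes this the Laplace
    transform of the log-excess of an observation over [U (expR w)], given that it exceeds this
    level. *)
Definition laplace V w lam : R :=
  expE (fun e => expR (- (lam * (V (w + e) - V w)))).

(** From [expR x * (1 - x) <= 1] follows [(expR x - 1 - x) * (1 - x) <= x ^+ 2], and
    [1 - x >= 1 / 2]. *)
Lemma expR_taylor1 (x : R) : `|x| <= 2^-1 -> `|expR x - 1 - x| <= 2 * x ^+ 2.
Proof.
rewrite ler_norml => /andP[x1 x2].
have h1 := expR_ge1Dx x; have h2 := expR_ge1Dx (- x).
have e0 := expR_gt0 x.
have h3 : expR x * (1 - x) <= 1.
  rewrite -[leRHS](_ : expR x * expR (- x) = 1) ?ler_pM2l//.
  by rewrite -expRD addrN expR0.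
rewrite ger0_norm; last lra.
have h4 : (expR x - 1 - x) * (1 - x) <= x ^+ 2 by rewrite expr2; lra.
have h5 : 0 <= expR x - 1 - x by lra.
have h6 : (expR x - 1 - x) * 2^-1 <= (expR x - 1 - x) * (1 - x) by rewrite ler_wpM2l//; lra.
by lra.
Qed.

(** With [lam = alpha * tau * l], the exponent [lam * (V (w + e) - V w)] is [tau * l * e] plus
    [lam * (b (w + e) - b w)]. The first part integrates exactly to [1 / (1 + tau * l)]; the second
    is of order [tau ^+ 2] and is linearised, its mean being found by dominated convergence. *)
Lemma laplace_expansion V (alpha rho c0 : R) (w tau : nat -> R) (l C N : R) :
  let b s := V s - s / alpha - c0 in
  0 < alpha -> rho < 0 -> measurable_fun setT V ->
  (forall y, b (s + y) / b s @[s --> +oo] --> expR (rho * y)) ->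
  (forall s e, N <= s -> 0 <= e -> b s != 0 /\ `|b (s + e)| <= 2 * `|b s|) ->
  (forall n e, 0 <= e -> V (w n) <= V (w n + e)) ->
  0 <= l -> 0 <= C ->
  w n @[n --> \oo] --> +oo -> tau n @[n --> \oo] --> (0 : R) ->
  (forall n, N <= w n) -> (forall n, 0 < tau n) ->
  (forall n, `|b (w n)| <= C * tau n) ->
  (forall n, 3 * alpha * l * C * tau n ^+ 2 <= 2^-1) ->
  (laplace V (w n) (alpha * tau n * l) -
     (1 - l * tau n + l ^+ 2 * tau n ^+ 2
        - l * tau n * alpha * b (w n) * (rho / (1 - rho)))) / tau n ^+ 2
   @[n --> \oo] --> (0 : R).
Proof.
move=> b alpha0 rho0 mV brv bbd Vnd l0 C0 woo tau0 wN taup bC tausm.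
have mb : measurable_fun setT b.
  apply: measurable_funB => //; apply: measurable_funB => //.
  exact: measurable_funM.
have mbw n : measurable_fun setT (fun e => b (w n + e)).
  by apply: measurableT_comp => //; exact: measurable_funD.
have mVw n : measurable_fun setT (fun e => V (w n + e)).
  by apply: measurableT_comp => //; exact: measurable_funD.
pose x n e := tau n * l * e.
have x0 n e : 0 <= e -> 0 <= x n e by move=> e0; rewrite !mulr_ge0// ltW.
have ex01 n e : 0 <= e -> 0 <= expR (- x n e) <= 1.
  by move=> e0; rewrite expR_ge0 -expR0 ler_expR oppr_le0 x0.
(* A weighted relative increment of [b], bounded by 3 thanks to the Potter bound and converging
   pointwise to [expR (rho * e) - 1], whose mean is [1 / (1 - rho) - 1 = rho / (1 - rho)]. *)
pose g n e := expR (- x n e) * (b (w n + e) / b (w n) - 1).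
have mg n : measurable_fun setT (g n).
  apply: measurable_funM; first exact: measurable_expRN.
  by apply: measurable_funB => //; exact: measurable_funM.
have g3 n e : 0 <= e -> `|g n e| <= 3.
  move=> e0; rewrite normrM -[leRHS]mul1r ler_pM//.
    by case/andP: (ex01 n e e0) => ? ?; rewrite ger0_norm.
  have [bw0 bwe] := bbd _ _ (wN n) e0.
  rewrite (le_trans (ler_normB _ _))// normr1 normf_div.
  have : `|b (w n + e)| / `|b (w n)| <= 2 by rewrite ler_pdivrMr ?normr_gt0.
  by lra.
have Gcv : expE (g n) @[n --> \oo] --> rho / (1 - rho).
  have -> : rho / (1 - rho) = expE (fun e => expR (- (- rho * e)) + - 1).
    rewrite (@expED _ _ _ 1 1).
    - rewrite expE_cst expE_expR; first by field; lra.
      lra.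
    - exact: measurable_expRN.
    - move=> e e0; rewrite ger0_norm ?expR_ge0// -expR0 ler_expR.
      by rewrite mulNr opprK nmulr_rle0.
    - by [].
    - by move=> e _; rewrite normrN1.
  apply: (@cvg_expE _ _ _ 3) => //.
  - by apply: measurable_funD => //; exact: measurable_expRN.
  - move=> e e0; rewrite /g -[X in _ --> X]mul1r; apply: cvgM.
      rewrite -expR0; apply: continuous_cvg; first exact: continuous_expR.
      rewrite -oppr0 -(mul0r e) -(mul0r l); apply: cvgN; apply: cvgMr_tmp.
      exact: cvgMr_tmp.
    rewrite mulNr opprK; apply: cvgB; last exact: cvg_cst.
    exact: (cvg_comp _ _ woo (brv e)).
(* The increment of [b] is at most [3 * C * tau], so the linearised quantity is at most
   [3 * alpha * l * C * tau ^+ 2]; [expR_taylor1] doubles its square, whence 18. *)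
have key n : `|laplace V (w n) (alpha * tau n * l) - (1 + tau n * l)^-1
    + alpha * tau n * l * b (w n) * expE (g n)|
    <= 18 * (alpha * l * C) ^+ 2 * tau n ^+ 4.
  set lam := alpha * tau n * l.
  have lam0 : 0 <= lam by rewrite !mulr_ge0// ltW.
  have [bw0 _] := bbd _ _ (wN n) (lexx 0).
  pose main e := expR (- x n e) + - (lam * b (w n)) * g n e.
  have mmain : measurable_fun setT main.
    by apply: measurable_funD; [exact: measurable_expRN|exact: measurable_funM].
  have Emain : expE main = (1 + tau n * l)^-1 - lam * b (w n) * expE (g n).
    rewrite (@expED _ _ _ 1 (`|lam * b (w n)| * 3)).
    - rewrite expE_expR; last by rewrite mulr_ge0// ltW.
      by rewrite (expEZ _ (mg n) (g3 n)) mulNr.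
    - exact: measurable_expRN.
    - by move=> e e0; case/andP: (ex01 n e e0) => ? ?; rewrite ger0_norm.
    - exact: measurable_funM.
    - by move=> e e0; rewrite normrM normrN ler_wpM2l// g3.
  have mL : measurable_fun setT (fun e => expR (- (lam * (V (w n + e) - V (w n))))).
    apply: measurableT_comp => //; apply: measurable_funN.
    by apply: measurable_funM => //; exact: measurable_funB.
  have main4 e : 0 <= e -> `|main e| <= 1 + `|lam * b (w n)| * 3.
    move=> e0; rewrite (le_trans (ler_normD _ _))// lerD//.
      by case/andP: (ex01 n e e0) => ? ?; rewrite ger0_norm.
    by rewrite normrM normrN ler_wpM2l// g3.
  have -> : laplace V (w n) lam - (1 + tau n * l)^-1 + lam * b (w n) * expE (g n) =
      expE (fun e => expR (- (lam * (V (w n + e) - V (w n)))) + -1 * main e).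
    rewrite (@expED _ _ _ 1 (1 + `|lam * b (w n)| * 3))//.
    - by rewrite (expEZ _ mmain main4) Emain /laplace; ring.
    - move=> e e0; rewrite ger0_norm ?expR_ge0// -expR0 ler_expR oppr_le0.
      by rewrite mulr_ge0// subr_ge0 Vnd.
    - exact: measurable_funM.
    - by move=> e e0; rewrite mulN1r normrN main4.
  apply: norm_expE_le.
    by apply: measurable_funD => //; exact: measurable_funM.
  move=> e e0; set beta := b (w n + e) - b (w n).
  have -> : lam * (V (w n + e) - V (w n)) = x n e + lam * beta.
    by rewrite /beta /b /x /lam; field; rewrite gt_eqF.
  have -> : main e = expR (- x n e) * (1 - lam * beta).
    by rewrite /main /g /beta; field.
  rewrite opprD expRD mulN1r -mulrBr.
  have -> : expR (- (lam * beta)) - (1 - lam * beta) =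
      expR (- (lam * beta)) - 1 - - (lam * beta) by ring.
  have beta3 : `|beta| <= 3 * (C * tau n).
    have [_ bwe] := bbd _ _ (wN n) e0.
    rewrite (le_trans (ler_normB _ _))//; have := bC n; lra.
  have lb : `|lam * beta| <= 3 * alpha * l * C * tau n ^+ 2.
    rewrite normrM (ger0_norm lam0) (le_trans (ler_wpM2l lam0 beta3))// le_eqVlt.
    by apply/orP; left; apply/eqP; rewrite /lam; ring.
  have lb2 : `|- (lam * beta)| <= 2^-1 by rewrite normrN (le_trans lb).
  rewrite normrM.
  have ex1 : `|expR (- x n e)| <= 1.
    by case/andP: (ex01 n e e0) => ? ?; rewrite ger0_norm.
  apply: le_trans (ler_pM (normr_ge0 _) (normr_ge0 _) ex1 (expR_taylor1 lb2)) _.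
  rewrite mul1r sqrrN -real_normK ?num_real//.
  have := ler_pM (normr_ge0 _) (normr_ge0 _) lb lb.
  rewrite -expr2 => /(ler_wpM2l (ler0n R 2))/le_trans; apply.
  by rewrite le_eqVlt; apply/orP; left; apply/eqP; ring.
pose B n := 18 * (alpha * l * C) ^+ 2 * tau n ^+ 2 + l ^+ 3 * tau n +
  l * alpha * C * `|expE (g n) - rho / (1 - rho)|.
have Bcv : B n @[n --> \oo] --> (0 : R).
  rewrite [X in _ --> X](_ : 0 = 18 * (alpha * l * C) ^+ 2 * 0 ^+ 2 + l ^+ 3 * 0 +
    l * alpha * C * `|rho / (1 - rho) - rho / (1 - rho)|); last first.
    by rewrite subrr normr0 expr2; ring.
  apply: cvgD; first apply: cvgD.
  - by apply: cvgMl_tmp; apply: cvgM.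
  - exact: cvgMl_tmp.
  - apply: cvgMl_tmp; apply: cvg_norm; apply: cvgB => //; exact: cvg_cst.
apply/norm_cvg0P.
apply: (@squeeze_cvgr _ _ _ _ (fun=> 0) B) => //; last exact: cvg_cst.
apply: nearW => n; rewrite normr_ge0/=.
have t0 := taup n; have t20 : 0 < tau n ^+ 2 by rewrite exprn_gt0.
rewrite normf_div [X in _ / X]gtr0_norm// ler_pdivrMr//.
(* The exact remainder [- x ^+ 3 / (1 + x)] of [1 / (1 + x)] after [1 - x + x ^+ 2], at
   [x = l * tau], and the error of replacing [expE (g n)] by its limit. *)
pose D := - (l ^+ 3 * tau n ^+ 3 / (1 + tau n * l)) -
   alpha * tau n * l * b (w n) * (expE (g n) - rho / (1 - rho)).
have tl0 : 0 < 1 + tau n * l by rewrite ltr_wpDr// mulr_ge0// ltW.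
have -> : laplace V (w n) (alpha * tau n * l) -
     (1 - l * tau n + l ^+ 2 * tau n ^+ 2
        - l * tau n * alpha * b (w n) * (rho / (1 - rho))) =
   (laplace V (w n) (alpha * tau n * l) - (1 + tau n * l)^-1
    + alpha * tau n * l * b (w n) * expE (g n)) + D.
  have r1 : 1 - rho != 0 by rewrite gt_eqF//; lra.
  by rewrite /D; field; rewrite r1 gt_eqF.
rewrite (le_trans (ler_normD _ _))// /B mulrDl [X in _ <= X + _]mulrDl -[leRHS]addrA lerD//.
  by rewrite (le_trans (key n))// -[leRHS]mulrA -exprD.
rewrite (le_trans (ler_normB _ _))// lerD//.
  have lt0 : 0 <= l ^+ 3 * tau n ^+ 3 by rewrite mulr_ge0// exprn_ge0// ltW.
  rewrite normrN ger0_norm; last by rewrite divr_ge0// ltW.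
  rewrite -[leRHS]mulrA -exprS ler_pdivrMr// ler_peMr// lerDl mulr_ge0//.
  exact: ltW.
rewrite normrM [leRHS]mulrAC ler_wpM2r// !normrM (ger0_norm (ltW alpha0)) (ger0_norm (ltW t0)) (ger0_norm l0).
have al0 : 0 <= alpha * tau n * l by rewrite !mulr_ge0// ltW.
rewrite (le_trans (ler_wpM2l al0 (bC n)))// le_eqVlt.
by apply/orP; left; apply/eqP; ring.
Qed.

End laplace.

(** * Second-order Taylor bounds for the exponential and the logarithm *)

Section taylor.
Context {R : realType}.
Implicit Types x q : R.

Lemma expR_taylor2 x : `|x| <= 2^-1 ->
  `|expR x - 1 - x - x ^+ 2 / 2| <= 2 * `|x| ^+ 3.
Proof.
move=> x2; pose f (y : R) := expR y - 1 - y - y ^+ 2 / 2.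
have df (y : R) : is_derive y (1 : R) f (expR y - 1 - y).
  rewrite /f; apply: is_derive_eq.
  by rewrite /GRing.scale/= subr0 !mulr1; field.
have cf (a b : R) : {within `[a, b], continuous f}.
  apply: derivable_within_continuous => z _; exact: ex_derive.
have f0 : f 0 = 0 by rewrite /f expR0 expr2 mul0r mul0r !subr0 subrr.
have bound c : `|c| <= `|x| -> `|expR c - 1 - c| <= 2 * `|x| ^+ 2.
  move=> cx; rewrite (le_trans (expR_taylor1 (le_trans cx x2)))// ler_pM2l//.
  by rewrite -[c ^+ 2]real_normK ?num_real// lerXn2r ?nnegrE.
have [x0|x0] := leP 0 x.
- have [c + fc] := MVT_segment x0 (fun y _ => df y) (@cf _ _).
  rewrite in_itv/= => /andP[c0 cx].
  rewrite -/(f x) -[f x]subr0 -f0 fc subr0 normrM exprSr mulrA ler_wpM2r//.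
  by apply: bound; rewrite !ger0_norm.
- have [c + fc] := MVT_segment (ltW x0) (fun y _ => df y) (@cf _ _).
  rewrite in_itv/= => /andP[cx c0].
  rewrite -/(f x) -[f x]subr0 -f0 distrC fc sub0r normrM normrN exprSr mulrA ler_wpM2r//.
  by apply: bound; rewrite !ler0_norm ?lerN2// ltW.
Qed.

(** With [y = ln (1 + q)], at most [2 * q] in absolute value, the bounds on [expR y = 1 + q] are
    inverted algebraically. The constant is [12 + 16]: the first-order remainder times
    [(q + y) / 2], and the cubic remainder in [y]. *)
Lemma ln_taylor2 q : `|q| <= 4^-1 ->
  `|ln (1 + q) - q + q ^+ 2 / 2| <= 28 * `|q| ^+ 3.
Proof.
move=> q4; have [q1 q2] : - 4^-1 <= q /\ q <= 4^-1 by move: q4; rewrite ler_norml => /andP.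
have q10 : 0 < 1 + q by lra.
set y := ln (1 + q).
have ey : expR y = 1 + q by rewrite lnK.
have yq : y <= q by apply: le_ln1Dx; lra.
have qy : q / (1 + q) <= y.
  have := expR_ge1Dx (- y); rewrite expRN ey => H.
  have -> : q / (1 + q) = 1 - (1 + q)^-1 by field; rewrite gt_eqF.
  lra.
have yle : `|y| <= 2 * `|q|.
  have [q0|q0] := leP 0 q.
    rewrite (ger0_norm q0) ger0_norm; first lra.
    by rewrite (le_trans _ qy)// divr_ge0// ltW.
  rewrite (ltr0_norm q0) ler0_norm; last lra.
  suff : 2 * q <= q / (1 + q) by lra.
  rewrite ler_pdivlMr//; nra.
have y2 : `|y| <= 2^-1 by lra.
have H1 := expR_taylor1 y2; have H2 := expR_taylor2 y2.
rewrite ey in H1 H2.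
have -> : y - q + q ^+ 2 / 2 =
   (1 + q - 1 - y) * ((q + y) / 2) - (1 + q - 1 - y - y ^+ 2 / 2) by field.
rewrite (le_trans (ler_normB _ _))//.
have yq3 : `|y| ^+ 3 <= 8 * `|q| ^+ 3.
  have -> : 8 * `|q| ^+ 3 = (2 * `|q|) ^+ 3 by ring.
  by rewrite lerXn2r ?nnegrE ?mulr_ge0.
have yq2 : y ^+ 2 <= 4 * `|q| ^+ 2.
  have -> : 4 * `|q| ^+ 2 = (2 * `|q|) ^+ 2 by ring.
  by rewrite -[y ^+ 2]real_normK ?num_real// lerXn2r ?nnegrE ?mulr_ge0.
rewrite normrM.
have H3 : `|(q + y) / 2| <= 3 / 2 * `|q|.
  by rewrite normf_div (ger0_norm (ler0n _ 2)); have := ler_normD q y; lra.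
have H4 := ler_pM (normr_ge0 _) (normr_ge0 _) H1 H3.
have H5 : 0 <= `|q| ^+ 3 by rewrite exprn_ge0.
have H6 : 2 * y ^+ 2 * (3 / 2 * `|q|) <= 12 * `|q| ^+ 3.
  by have := ler_wpM2r (normr_ge0 q) yq2; rewrite [`|q| ^+ 3]exprSr => H; lra.
by lra.
Qed.

End taylor.

(** * Order statistics *)

Section order_statistics.
Context {R : realType}.
Implicit Types (x : nat -> R) (v : R) (k n : nat).

Definition exceedances v x n : R := \sum_(i < n) (v < x i)%R%:R.

Definition excess v x n : R :=
  \sum_(i < n) (if v < x i then ln (x i) - ln v else 0).

Lemma sum_order_stat (g : R -> R) x n :
  \sum_(i < n) g (x i) = \sum_(1 <= i < n.+1) g (order_stat x i n).
Proof.
transitivity (\sum_(y <- mkseq x n) g y).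
  by rewrite big_map -(big_mkord predT (fun i => g (x i))) /index_iota subn0.
rewrite -(perm_big _ (permEl (perm_sort >=%R _)))/=.
by rewrite (big_nth 0) size_sort size_mkseq big_add1.
Qed.

Lemma order_stat_le x i j n : (0 < i)%N -> (i <= j)%N -> (j <= n)%N ->
  order_stat x j n <= order_stat x i n.
Proof.
move=> i0 ij jn; rewrite /order_stat.
have s : sorted >=%R (sort >=%R (mkseq x n)) by apply: sort_sorted => a b; exact: ge_total.
have j0 : (0 < j)%N by exact: leq_trans ij.
have tr : transitive (>=%R : rel R) by move=> a b c ab bc; exact: le_trans bc ab.
have rf : reflexive (>=%R : rel R) by move=> a; exact: lexx.
apply: (sorted_leq_nth tr rf 0 s) => //.
- by rewrite inE size_sort size_mkseq prednK// (leq_trans ij).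
- by rewrite inE size_sort size_mkseq prednK.
- by rewrite -ltnS !prednK.
Qed.

(** Events on the random threshold become events on counts, which are sums of independent terms;
    order statistics enter the probability estimates through this equivalence. *)
Lemma lt_order_stat x v k n : (0 < k)%N -> (k <= n)%N ->
  (v < order_stat x k n) = (k%:R <= exceedances v x n).
Proof.
move=> k0 kn; rewrite /exceedances (sum_order_stat (fun y => (v < y)%R%:R)).
have kn1 : (k <= n.+1)%N by exact: leqW.
have [H|H] := ltP v (order_stat x k n); apply/esym.
  rewrite (@big_cat_nat _ _ _ k.+1)//=.
  rewrite big_nat (eq_bigr (fun=> 1)); last first.
    move=> i /andP[i0 ik]; rewrite (lt_le_trans H)// order_stat_le//.
  rewrite -big_nat sumr_const_nat subSS subn0 lerDl sumr_ge0// => i _.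
(* The cut is now at [k] instead of [k.+1]: from the [k]-th value on nothing exceeds [v], so at most
   [k.-1] terms count. *)
apply/negbTE; rewrite -ltNge (@big_cat_nat _ _ _ k)//=.
rewrite [X in _ + X]big_nat [X in _ + X]big1 ?addr0; last first.
  move=> i /andP[ki ni]; rewrite ltNge (le_trans _ H)// order_stat_le//.
have : \sum_(1 <= i < k) (v < order_stat x i n)%R%:R <= (k.-1)%:R :> R.
  rewrite -[k.-1]subn1 -[leRHS]mulr1 mulr_natl -sumr_const_nat.
  by apply: ler_sum => i _; rewrite lern1 leq_b1.
by move=> /le_lt_trans; apply; rewrite ltr_nat ltn_predL.
Qed.

(** Lowering the reference from the [k]-th largest value to [v] increases each of the first [k]
    terms, and further exceedances add nonnegative terms. *)
Lemma hill_le_excess x v k n : (0 < k)%N -> (k <= n)%N -> 0 < v ->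
  v < order_stat x k n -> k%:R * hill_H x k n <= excess v x n.
Proof.
move=> k0 kn v0 vk; rewrite /hill_H mulVKf ?pnatr_eq0 -?lt0n//.
rewrite /excess (sum_order_stat (fun y => if v < y then ln y - ln v else 0)).
rewrite [leRHS](@big_cat_nat _ _ _ k.+1)//= -[leLHS]addr0 lerD//.
  rewrite big_nat [leRHS]big_nat ler_sum// => i /andP[i0 ik].
  have ki : order_stat x k n <= order_stat x i n by exact: order_stat_le.
  have vi := lt_le_trans vk ki; rewrite vi.
  have [xk0 xi0] := (lt_trans v0 vk, lt_trans v0 vi).
  by rewrite ln_div// lerD2l lerN2 ler_ln// ltW.
by rewrite sumr_ge0// => i _; case: ifP => // vi; rewrite subr_ge0 ler_ln ?posrE ?(ltW vi)// (lt_trans v0).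
Qed.

(** Raising the reference from the [k]-th largest value to [v] decreases the first [k] terms, those
    not above [v] being replaced by 0, and no later value exceeds [v]. *)
Lemma excess_le_hill x v k n : (0 < k)%N -> (k <= n)%N ->
  0 < order_stat x k n <= v -> excess v x n <= k%:R * hill_H x k n.
Proof.
move=> k0 kn /andP[xk0 kv]; rewrite /hill_H mulVKf ?pnatr_eq0 -?lt0n//.
rewrite /excess (sum_order_stat (fun y => if v < y then ln y - ln v else 0)).
rewrite [leLHS](@big_cat_nat _ _ _ k.+1)//= -[leRHS]addr0 lerD//.
  rewrite big_nat [leRHS]big_nat ler_sum// => i /andP[i0 ik].
  have ki : order_stat x k n <= order_stat x i n by exact: order_stat_le.
  have xi0 := lt_le_trans xk0 ki.
  rewrite ln_div//; case: ifP => _; last by rewrite subr_ge0 ler_ln.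
  by rewrite lerD2l lerN2 ler_ln// posrE (lt_le_trans xk0).
rewrite big_nat big1// => i /andP[ki ni]; case: ifP => //.
by rewrite ltNge (le_trans _ kv)// order_stat_le// ltnW.
Qed.

Context {d : measure_display} {T : measurableType d} (P : probability T R).
Implicit Type X : nat -> {RV P >-> R}.

Lemma measurable_exceedances X v n :
  measurable_fun setT (fun w => exceedances v (fun j => X j w) n).
Proof.
apply: measurable_sum => i.
pose I (y : R) : R := \1_`]v, +oo[%classic y.
have -> : (fun w => (v < X i w)%R%:R) = (fun w => I (X i w)).
  by apply/funext => w; rewrite /I indicE mem_setE in_itv/= andbT.
apply: measurableT_comp => //; apply: measurable_indic; exact: measurable_itv.
Qed.

Lemma measurable_order_stat X k n : (0 < k)%N -> (k <= n)%N ->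
  measurable_fun setT (fun w => order_stat (fun j => X j w) k n).
Proof.
move=> k0 kn; apply: (measurability (@RGenOInfty.G R)) => [|/= _ [_] [v] -> <-].
  exact: RGenOInfty.measurableE.
rewrite setTI (_ : _ @^-1` _ = (fun w => exceedances v (fun j => X j w) n) @^-1` `[k%:R, +oo[).
  by rewrite -[_ @^-1` _]setTI; apply: measurable_exceedances => //; exact: measurable_itv.
by apply/seteqP; split=> w /=; rewrite !in_itv/= !andbT lt_order_stat.
Qed.

Lemma measurable_inv : measurable_fun setT (GRing.inv : R -> R).
Proof.
have -> : (GRing.inv : R -> R) = (fun y => if 0 < y then expR (- ln y)
    else if y < 0 then - expR (- ln (- y)) else 0).
  apply/funext => y; case: (ltgtP 0 y) => [y0|y0|<-]; last by rewrite invr0.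
  - by rewrite expRN lnK.
  - by rewrite expRN lnK ?posrE ?oppr_gt0// invrN opprK.
have mln := @measurable_ln R.
apply: measurable_fun_if => //; first exact: measurable_fun_ltr.
- by apply: measurable_funTS; apply: measurableT_comp => //; exact: measurable_funN.
apply: measurable_funTS; apply: measurable_fun_if => //; first exact: measurable_fun_ltr.
apply: measurable_funTS; apply: measurable_funN; apply: measurableT_comp => //.
apply: measurable_funN; apply: measurableT_comp => //; exact: measurable_funN.
Qed.

Lemma measurable_hill_H X k n : (k <= n)%N ->
  measurable_fun setT (fun w => hill_H (fun j => X j w) k n).
Proof.
move=> kn; rewrite /hill_H; apply: measurable_funM => //.
rewrite (_ : (fun w => _) = (fun w => \sum_(i < k)
   ln (order_stat (fun j => X j w) i.+1 n / order_stat (fun j => X j w) k n))); last first.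
  apply/funext => w; rewrite big_add1/= -(big_mkord predT (fun i =>
    ln (order_stat (fun j => X j w) i.+1 n / order_stat (fun j => X j w) k n))).
  by rewrite big_mkord.
apply: measurable_sum => i.
have k0 : (0 < k)%N by rewrite (leq_ltn_trans _ (ltn_ord i)).
apply: measurableT_comp; first exact: measurable_ln.
apply: measurable_funM.
  by apply: measurable_order_stat => //; rewrite (leq_trans _ kn).
apply: measurableT_comp; first exact: measurable_inv.
by apply: measurable_order_stat => //; exact: leq_ltn_trans (ltn_ord i).
Qed.

End order_statistics.

(** * Chernoff bounds for exceedances *)

Section chernoff.
Context {R : realType} {d : measure_display} {T : measurableType d}.
Variables (P : probability T R) (U : R -> R) (X : nat -> {RV P >-> R}).
Hypothesis U_gt0 : forall x, 1 < x -> 0 < U x.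
Hypothesis U_nd : forall x y, 1 < x -> x <= y -> U x <= U y.
Hypothesis X_iid : iid_RV U X.

Let Q := quantile_exp U.
Definition log_quantile (e : R) : R := ln (quantile_exp U e).
Let V := log_quantile.

(* At such points [U (e^E) > U (e^w)] exactly when [E > w], although [U] may have
   flat parts. *)
Definition increase_point (w : R) : Prop :=
  0 < w /\ forall e, w < e -> U (expR w) < U (expR e).

Let N (w : R) n (t : T) : R := exceedances (U (expR w)) (fun j => X j t) n.
Let S (w : R) n (t : T) : R := excess (U (expR w)) (fun j => X j t) n.

Let Q_nd : nondecreasing_fun Q.
Proof. exact: nondecreasing_quantile_exp. Qed.

Let mQ : measurable_fun setT Q.
Proof. exact: nondecreasing_measurable. Qed.

Lemma measurable_log_quantile : measurable_fun setT V.
Proof. by apply: measurableT_comp mQ; exact: measurable_ln. Qed.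

Lemma log_quantileE (e : R) : 0 < e -> V e = ln (U (expR e)).
Proof. by move=> e0; rewrite /V /log_quantile /quantile_exp e0. Qed.

Lemma log_quantile_le (e1 e2 : R) : 0 < e1 -> e1 <= e2 -> V e1 <= V e2.
Proof.
move=> e10 e12; have e20 := lt_le_trans e10 e12.
by rewrite !log_quantileE// ler_ln ?posrE ?U_gt0 ?expR_gt1// U_nd ?expR_gt1// ler_expR.
Qed.

Let QE (e : R) : 0 < e -> Q e = U (expR e).
Proof. by move=> e0; rewrite /Q /quantile_exp e0. Qed.

Let measurable_gt (v : R) : measurable_fun setT (fun x : R => v < x).
Proof. exact: measurable_fun_ltr. Qed.

Lemma integral_prod_law (F : R -> R) (c : R) n :
  measurable_fun setT F -> (forall x, 0 <= F x <= c) ->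
  (\int[P]_t (\prod_(i < n) F (X i t))%:E = ((expE (F \o Q)) ^+ n)%:E)%E.
Proof.
move=> mF F0c; have [iX lX] := X_iid.
have F0 x : 0 <= F x by case/andP: (F0c x).
apply: (@integral_prod_indep _ _ _ P X F) => // i.
rewrite (integral_law Q_nd (lX i))// (@expEE _ (F \o Q) c)//.
  exact: measurableT_comp.
by move=> e _; rewrite /= ger0_norm//; case/andP: (F0c (Q e)).
Qed.

Section at_increase_point.
Variable w : R.
Hypothesis w_inc : increase_point w.
Let v := U (expR w).
Let w0 : 0 < w. Proof. by case: w_inc. Qed.
Let v0 : 0 < v. Proof. by rewrite U_gt0// expR_gt1. Qed.

Let Qgt e : 0 < e -> v < Q (w + e).
Proof.
by move=> e0; rewrite QE ?addr_gt0//; case: w_inc => _; apply; rewrite ltrDl.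
Qed.

Let Qle e : e <= w -> Q e <= v.
Proof. by move=> ew; rewrite -[v]QE//; exact: Q_nd. Qed.

(** The integrand is a product over the observations whose factor is 1 below the threshold;
    memorylessness at [w] gives the mixture. That [w] is an increase point makes every overshoot
    [e > 0] a strict exceedance. *)
Lemma mgf_exceedances_excess n (s lam : R) : 0 <= lam ->
  (\int[P]_t (expR (s * N w n t - lam * S w n t))%:E =
   ((1 + expR (- w) * (expR s * laplace V w lam - 1)) ^+ n)%:E)%E.
Proof.
move=> lam0.
pose F (x : R) := if v < x then expR (s - lam * (ln x - ln v)) else 1.
have mF : measurable_fun setT F.
  apply: measurable_fun_if => //; apply: measurable_funTS.
  apply: measurableT_comp => //; apply: measurable_funB => //.
  by apply: measurable_funM => //; apply: measurable_funB.
have F0c x : 0 <= F x <= 1 + expR s.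
  rewrite /F; case: ifPn => vx; last by rewrite ler01 lerDl expR_ge0.
  rewrite expR_ge0/= (@le_trans _ _ (expR s)) ?lerDr// ler_expR gerBl mulr_ge0//.
  by rewrite subr_ge0 ler_ln ?posrE// ?ltW// (lt_trans v0).
transitivity (\int[P]_t (\prod_(i < n) F (X i t))%:E)%E.
  apply: eq_integral => t _; congr EFin.
  rewrite /N /S /exceedances /excess !mulr_sumr -sumrB expR_sum.
  apply: eq_bigr => i _; rewrite /F -/v; case: ifP => _; first by rewrite mulr1.
  by rewrite !mulr0 subrr expR0.
rewrite (integral_prod_law _ mF F0c); congr (_ ^+ _)%:E.
have mFQ : measurable_fun setT (F \o Q) by exact: measurableT_comp.
rewrite (@expE_split _ _ w 1 (1 + expR s))//.
- have mV := measurable_log_quantile.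
  have mL : measurable_fun setT (fun e => expR (- (lam * (V (w + e) - V w)))).
    apply: measurableT_comp => //; apply: measurable_funN.
    apply: measurable_funM => //; apply: measurable_funB => //.
    by apply: measurableT_comp => //; exact: measurable_funD.
  have L1 e : 0 <= e -> `|expR (- (lam * (V (w + e) - V w)))| <= 1.
    move=> e0; rewrite ger0_norm ?expR_ge0// -expR0 ler_expR oppr_le0 mulr_ge0//.
    by rewrite subr_ge0 log_quantile_le// lerDl.
  rewrite (@ae_eq_expE _ _ (fun e => expR s * expR (- (lam * (V (w + e) - V w))))).
  + by rewrite (expEZ _ mL L1) /laplace; ring.
  + by apply: measurableT_comp => //; exact: measurable_funD.
  + exact: measurable_funM.
  + move=> e e0; rewrite /= /F Qgt// -expRD; congr expR.
    by rewrite /V /log_quantile -/Q [in ln (Q w)]QE.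
- exact: ltW.
- by move=> e; exact: F0c.
- by move=> e /andP[e0 ew]; rewrite /= /F ltNge Qle// ltW.
Qed.

End at_increase_point.

(** The difference counts the observations between the two thresholds; memorylessness is applied at
    [w1], then over the length [w2 - w1]. *)
Lemma mgf_increment (w1 w2 s : R) n :
  increase_point w1 -> increase_point w2 -> w1 < w2 ->
  (\int[P]_t (expR (s * (N w1 n t - N w2 n t)))%:E =
   ((1 + (expR (- w1) - expR (- w2)) * (expR s - 1)) ^+ n)%:E)%E.
Proof.
move=> [w10 w1i] [w20 w2i] w12.
pose v1 := U (expR w1); pose v2 := U (expR w2).
have v12 : v1 < v2 by exact: w1i.
pose F (x : R) := if v1 < x then (if v2 < x then 1 else expR s) else 1.
have mF : measurable_fun setT F.
  apply: measurable_fun_if => //; apply: measurable_funTS.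
  exact: measurable_fun_if.
have F0c x : 0 <= F x <= 1 + expR s.
  by rewrite /F; do 2?case: ifP => _; rewrite ?ler01 ?expR_ge0 ?lerDl ?lerDr ?expR_ge0 ?ler01.
transitivity (\int[P]_t (\prod_(i < n) F (X i t))%:E)%E.
  apply: eq_integral => t _; congr EFin.
  rewrite /N /exceedances -sumrB mulr_sumr expR_sum.
  apply: eq_bigr => i _; rewrite /F -/v1 -/v2.
  case: (ltP v1 (X i t)) => h1; case: (ltP v2 (X i t)) => h2.
  - by rewrite subrr mulr0 expR0.
  - by rewrite subr0 mulr1.
  - by move: (lt_le_trans v12 (le_trans (ltW h2) h1)); rewrite ltxx.
  - by rewrite subrr mulr0 expR0.
rewrite (integral_prod_law _ mF F0c); congr (_ ^+ _)%:E.
have mFQ : measurable_fun setT (F \o Q) by exact: measurableT_comp.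
have mFQ1 : measurable_fun setT (fun e => (F \o Q) (w1 + e)).
  by apply: measurableT_comp => //; exact: measurable_funD.
have Qv1 e : e <= w1 -> Q e <= v1 by move=> ew; rewrite -[v1]QE//; exact: Q_nd.
have Qv2 e : e <= w2 -> Q e <= v2 by move=> ew; rewrite -[v2]QE//; exact: Q_nd.
have Qv1' e : w1 < e -> v1 < Q e.
  by move=> we; rewrite QE ?(lt_trans w10)//; exact: w1i.
have Qv2' e : w2 < e -> v2 < Q e.
  by move=> we; rewrite QE ?(lt_trans w20)//; exact: w2i.
rewrite (@expE_split _ _ w1 1 (1 + expR s))//; last 3 first.
- exact: ltW.
- by move=> e; exact: F0c.
- by move=> e /andP[e0 ew]; rewrite /= /F ltNge Qv1// ltW.
rewrite (@expE_split _ (fun e => (F \o Q) (w1 + e)) (w2 - w1) (expR s) (1 + expR s))//; last 3 first.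
- by rewrite subr_ge0 ltW.
- by move=> e; exact: F0c.
- move=> e /andP[e0 ew]; rewrite /= /F Qv1' ?ltrDl// ltNge Qv2//.
  by rewrite -lerBrDl ltW.
rewrite (@ae_eq_expE _ _ (fun=> 1))//; last 2 first.
- apply: (@measurableT_comp _ _ _ _ _ _ (fun e => (F \o Q) (w1 + e)) _ (fun e => w2 - w1 + e)) => //.
  exact: measurable_funD.
- move=> e e0; rewrite /= /F (_ : w1 + (w2 - w1 + e) = w2 + e); last by ring.
  by rewrite Qv1' ?Qv2' ?ltrDl// (lt_trans w12)// ltrDl.
rewrite expE_cst mulr1.
have -> : expR (- w2) = expR (- w1) * expR (- (w2 - w1)).
  by rewrite -expRD; congr expR; ring.
ring.
Qed.

Lemma measurable_excess (v : R) n :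
  measurable_fun setT (fun t => excess v (fun j => X j t) n).
Proof.
apply: measurable_sum => i.
apply: (@measurableT_comp _ _ _ _ _ _ (fun x : R => if v < x then ln x - ln v else 0)) => //.
apply: measurable_fun_if => //; apply: measurable_funTS.
by apply: measurable_funB.
Qed.

Lemma exp_markov (Z : T -> R) (b z : R) : measurable_fun setT Z ->
  (\int[P]_t (expR (Z t))%:E <= b%:E)%E ->
  fine (P [set t | z <= Z t]) <= b * expR (- z).
Proof.
move=> mZ Zb; set A := [set t | z <= Z t]; have mA : measurable A.
  rewrite (_ : A = Z @^-1` `[z, +oo[).
    by rewrite -[_ @^-1` _]setTI; apply: mZ => //; exact: measurable_itv.
  by apply/seteqP; split=> t /=; rewrite in_itv/= andbT.
have : ((expR z)%:E * P A <= b%:E)%E.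
  apply: le_trans Zb; rewrite -[X in (_ * P X)%E]setIT -integral_indic//.
  rewrite -ge0_integralZl//; last first.
  - by apply/measurable_EFinP; exact: measurable_indic.
  apply: ge0_le_integral => //.
  - by apply: measurable_funeM; apply/measurable_EFinP; exact: measurable_indic.
  - by apply/measurable_EFinP; apply: measurableT_comp.
  move=> t _; rewrite -EFinM lee_fin indicE; have [/set_mem/= zt|_] := boolP (t \in _).
    by rewrite mulr1 ler_expR.
  by rewrite mulr0 expR_ge0.
rewrite -[P _]fineK ?fin_num_measure// -EFinM lee_fin.
by rewrite expRN ler_pdivlMr ?expR_gt0// mulrC.
Qed.

Let pr (A : set T) : R := fine (P A).

Lemma fine_prob_le (A B : set T) : measurable A -> measurable B ->
  A `<=` B -> pr A <= pr B.
Proof.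
move=> mA mB AB; apply: fine_le; rewrite ?fin_num_measure//.
by apply: le_measure; rewrite ?inE.
Qed.

Lemma measurable_exceedances_ge (w m : R) n : measurable [set t | m <= N w n t].
Proof.
rewrite (_ : [set _ | _] = N w n @^-1` `[m, +oo[).
  by rewrite -[_ @^-1` _]setTI; apply: measurable_exceedances.
by apply/seteqP; split=> t /=; rewrite in_itv/= andbT.
Qed.

Lemma measurable_exceedances_lt (w m : R) n : measurable [set t | N w n t < m].
Proof.
rewrite (_ : [set _ | _] = ~` [set t | m <= N w n t]).
  by apply: measurableC; exact: measurable_exceedances_ge.
by apply/seteqP; split=> t /=; rewrite ltNge => /negP.
Qed.

Lemma measurable_excess_lt (w b : R) n : measurable [set t | S w n t < b].
Proof.
rewrite (_ : [set _ | _] = S w n @^-1` `]-oo, b[).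
  by rewrite -[_ @^-1` _]setTI; apply: measurable_excess.
by apply/seteqP; split=> t /=; rewrite in_itv/=.
Qed.

Lemma laplace_le1 (w lam : R) : 0 < w -> 0 <= lam -> laplace V w lam <= 1.
Proof.
move=> w0 lam0; apply: le_trans (ler_norm _) _; apply: norm_expE_le.
  have mV := measurable_log_quantile.
  apply: measurableT_comp => //; apply: measurable_funN.
  apply: measurable_funM => //; apply: measurable_funB => //.
  by apply: measurableT_comp => //; exact: measurable_funD.
move=> e e0; rewrite ger0_norm ?expR_ge0// -expR0 ler_expR oppr_le0 mulr_ge0//.
by rewrite subr_ge0 log_quantile_le// lerDl.
Qed.

Lemma laplace_ge0 (w lam : R) : 0 <= laplace V w lam.
Proof.
apply: Rintegral_ge0 => e _; rewrite mulr_ge0 ?expR_ge0//.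
exact: exponential_pdf_ge0.
Qed.

Lemma laplace0 (w : R) : laplace V w 0 = 1.
Proof.
rewrite /laplace (eq_expE (h2 := fun=> 1)) ?expE_cst// => e _.
by rewrite mul0r oppr0 expR0.
Qed.

Lemma bernoulli_le_exp (p x : R) n : 0 <= p <= 1 -> -1 <= x ->
  (1 + p * x) ^+ n <= expR (n%:R * p * x).
Proof.
move=> /andP[p0 p1] x1; rewrite -mulrA expRM_natl lerXn2r ?nnegrE ?expR_ge0 ?expR_ge1Dx//.
have : p * -1 <= p * x by rewrite ler_wpM2l.
lra.
Qed.

(** Passing from the binomial to the Poisson form makes exponents explicit. It serves upper bounds,
    while the normalisation of the tilted law rests on the exact transform. *)
Lemma mgf_le (w s lam : R) n : increase_point w -> 0 <= lam ->
  (\int[P]_t (expR (s * N w n t - lam * S w n t))%:E <=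
   (expR (n%:R * expR (- w) * (expR s * laplace V w lam - 1)))%:E)%E.
Proof.
move=> wi lam0; rewrite mgf_exceedances_excess// lee_fin bernoulli_le_exp//.
  rewrite expR_ge0/= -expR0 ler_expR oppr_le0; case: wi => /ltW//.
by rewrite -[leLHS]add0r lerD2r mulr_ge0 ?expR_ge0 ?laplace_ge0.
Qed.

Let mZ (w s lam : R) n : measurable_fun setT (fun t => s * N w n t - lam * S w n t).
Proof.
apply: measurable_funB; apply: measurable_funM => //.
  exact: measurable_exceedances.
exact: measurable_excess.
Qed.

(** The choice [s = - ln (laplace V w lam)] turns the factor raised to the power [n] into 1, so the
    bound involves only [m] and [b]. This [s] is nonnegative, so a lower bound on the count can be
    used in the exponent. *)
Lemma prob_exceed_and_small_excess (w lam m b : R) n :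
  increase_point w -> 0 <= lam -> 0 < laplace V w lam ->
  pr ([set t | m <= N w n t] `&` [set t | S w n t < b])
    <= expR (lam * b + m * ln (laplace V w lam)).
Proof.
move=> wi lam0 L0; pose s := - ln (laplace V w lam).
have s0 : 0 <= s by rewrite oppr_ge0 ln_le0// laplace_le1//; case: wi.
have := exp_markov (s * m - lam * b) (mZ w s lam n) (mgf_le s n wi lam0).
have -> : expR s * laplace V w lam = 1 by rewrite /s expRN lnK// mulVf// gt_eqF.
rewrite subrr mulr0 expR0 mul1r => H.
have -> : lam * b + m * ln (laplace V w lam) = - (s * m - lam * b) by rewrite /s; ring.
apply: le_trans H; apply: fine_prob_le.
- by apply: measurableI; [exact: measurable_exceedances_ge|exact: measurable_excess_lt].
- rewrite (_ : [set _ | _] = (fun t => s * N w n t - lam * S w n t) @^-1` `[s * m - lam * b, +oo[).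
    by rewrite -[_ @^-1` _]setTI; apply: mZ => //; exact: measurable_itv.
  by apply/seteqP; split=> t /=; rewrite in_itv/= andbT.
- by move=> t [/= h1 h2]; rewrite lerB// ler_wpM2l// ltW.
Qed.

Lemma prob_exceed_ge (w s m : R) n : increase_point w -> 0 <= s ->
  pr [set t | m <= N w n t] <= expR (n%:R * expR (- w) * (expR s - 1) - s * m).
Proof.
move=> wi s0.
have := exp_markov (s * m) (mZ w s 0 n) (mgf_le s n wi (lexx 0)).
rewrite laplace0 mulr1 -expRD; apply: le_trans; apply: fine_prob_le.
- exact: measurable_exceedances_ge.
- rewrite (_ : [set _ | _] = (fun t => s * N w n t - 0 * S w n t) @^-1` `[s * m, +oo[).
    by rewrite -[_ @^-1` _]setTI; apply: mZ => //; exact: measurable_itv.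
  by apply/seteqP; split=> t /=; rewrite in_itv/= andbT.
- by move=> t /= h1; rewrite mul0r subr0 ler_wpM2l.
Qed.

Lemma prob_exceed_lt (w s m : R) n : increase_point w -> 0 <= s ->
  pr [set t | N w n t < m] <= expR (n%:R * expR (- w) * (expR (- s) - 1) + s * m).
Proof.
move=> wi s0.
have := exp_markov (- s * m) (mZ w (- s) 0 n) (mgf_le (- s) n wi (lexx 0)).
rewrite laplace0 mulr1 -expRD mulNr opprK; apply: le_trans; apply: fine_prob_le.
- exact: measurable_exceedances_lt.
- rewrite (_ : [set _ | _] = (fun t => - s * N w n t - 0 * S w n t) @^-1` `[- (s * m), +oo[).
    by rewrite -[_ @^-1` _]setTI; apply: mZ => //; exact: measurable_itv.
  by apply/seteqP; split=> t /=; rewrite in_itv/= andbT.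
- by move=> t /= h1; rewrite mul0r subr0 mulNr lerN2 ler_wpM2l// ltW.
Qed.

Lemma prob_increment_ge (w1 w2 m : R) n :
  increase_point w1 -> increase_point w2 -> w1 < w2 ->
  pr [set t | m <= N w1 n t - N w2 n t]
    <= expR (n%:R * (expR (- w1) - expR (- w2)) * (expR 1 - 1) - m).
Proof.
move=> wi1 wi2 w12.
have mD : measurable_fun setT (fun t => 1 * (N w1 n t - N w2 n t)).
  by apply: measurable_funM => //; apply: measurable_funB; exact: measurable_exceedances.
have e10 := expR_gt0 (- w1); have e20 := expR_gt0 (- w2).
have e12 : expR (- w2) < expR (- w1) by rewrite ltr_expR ltrN2.
have e11 : expR (- w1) <= 1 by rewrite -expR0 ler_expR oppr_le0; case: wi1 => /ltW.
have H : (\int[P]_t (expR (1 * (N w1 n t - N w2 n t)))%:E <=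
    (expR (n%:R * (expR (- w1) - expR (- w2)) * (expR 1 - 1)))%:E)%E.
  rewrite mgf_increment// lee_fin bernoulli_le_exp//.
    by apply/andP; split; lra.
  by have := expR_gt0 (1 : R); lra.
have := exp_markov m mD H.
rewrite -expRD; apply: le_trans; rewrite (_ : [set _ | _] = [set t | m <= 1 * (N w1 n t - N w2 n t)])//.
by apply/seteqP; split=> t /=; rewrite mul1r.
Qed.

(* Exponential change of measure with density e^{s N - lam S}, where
   e^s L(lam) = 1; the four error terms are Chernoff bounds under the tilted law. *)
Lemma tilting_lower_bound (w lam kap a b m1 m2 : R) n :
  increase_point w -> 0 <= kap <= lam -> 0 < laplace V w lam ->
  let L := laplace V w in
  let np := n%:R * expR (- w) in
  1 <= expR (- ln (L lam) * m2 - lam * a)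
         * pr ([set t | m1 <= N w n t] `&` [set t | S w n t < b])
       + (expR (np * (L (lam - kap) / L lam - 1) - kap * b)
       + (expR (np * (L (lam + kap) / L lam - 1) + kap * a)
       + (expR (np * (expR (- kap) - 1) + kap * m1)
       + expR (np * (expR kap - 1) - kap * m2)))).
Proof.
move=> wi kk L0; cbv zeta; set L := laplace V w; set np := n%:R * expR (- w).
have [kap0 kaplam] := andP kk.
have lam0 : 0 <= lam by exact: le_trans kaplam.
pose s := - ln (L lam).
have s0 : 0 <= s by rewrite oppr_ge0 ln_le0// laplace_le1//; case: wi.
have es : expR s = (L lam)^-1 by rewrite expRN lnK.
pose Z (s lam : R) t := s * N w n t - lam * S w n t.
pose B := [set t | m1 <= N w n t] `&` [set t | S w n t < b].
have mB : measurable B.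
  by apply: measurableI; [exact: measurable_exceedances_ge|exact: measurable_excess_lt].
pose f0 t := expR (s * m2 - lam * a) * \1_B t.
pose f1 t := expR (- (kap * b)) * expR (Z s (lam - kap) t).
pose f2 t := expR (kap * a) * expR (Z s (lam + kap) t).
pose f3 t := expR (kap * m1) * expR (Z (s - kap) lam t).
pose f4 t := expR (- (kap * m2)) * expR (Z (s + kap) lam t).
(* When [S] lies in [[a, b)] and [N] in [[m1, m2]], the density is at most the constant in [f0].
   Otherwise one of the four constraints fails, and shifting the corresponding parameter by [kap]
   dominates the density. *)
have ptw t : expR (Z s lam t) <= f0 t + (f1 t + (f2 t + (f3 t + f4 t))).
  have [g0 g1 g2 g3 g4] : [/\ 0 <= f0 t, 0 <= f1 t, 0 <= f2 t, 0 <= f3 t & 0 <= f4 t].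
    by split; rewrite mulr_ge0 ?expR_ge0// indicE.
  have [h1|h1] := ltP (S w n t) b; last first.
    have : expR (Z s lam t) <= f1 t.
      rewrite /f1 -expRD ler_expR /Z mulrBl.
      have := ler_wpM2l kap0 h1; lra.
    lra.
  have [h2|h2] := ltP (S w n t) a.
    have : expR (Z s lam t) <= f2 t.
      rewrite /f2 -expRD ler_expR /Z mulrDl.
      have := ler_wpM2l kap0 (ltW h2); lra.
    lra.
  have [h3|h3] := ltP (N w n t) m1.
    have : expR (Z s lam t) <= f3 t.
      rewrite /f3 -expRD ler_expR /Z mulrBl.
      have := ler_wpM2l kap0 (ltW h3); lra.
    lra.
  have [h4|h4] := ltP m2 (N w n t).
    have : expR (Z s lam t) <= f4 t.
      rewrite /f4 -expRD ler_expR /Z mulrDl.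
      have := ler_wpM2l kap0 (ltW h4); lra.
    lra.
  have : expR (Z s lam t) <= f0 t.
    rewrite /f0 indicE mem_set// mulr1 ler_expR /Z lerB// ler_wpM2l//.
  lra.
have mEZ (s' lam' : R) : measurable_fun setT (fun t => expR (Z s' lam' t)).
  by apply: measurableT_comp => //; exact: mZ.
have mf0 : measurable_fun setT f0 by apply: measurable_funM => //; exact: measurable_indic.
have [mf1 mf2 mf3 mf4] : [/\ measurable_fun setT f1, measurable_fun setT f2,
    measurable_fun setT f3 & measurable_fun setT f4].
  by split; apply: measurable_funM.
have I (c s' lam' : R) : 0 <= lam' -> (\int[P]_t (expR c * expR (Z s' lam' t))%:E <=
    (expR (np * (expR s' * L lam' - 1) + c))%:E)%E.
  move=> lam'0; under eq_integral do rewrite EFinM.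
  rewrite ge0_integralZl ?lee_fin ?expR_ge0//; last exact/measurable_EFinP.
  by rewrite addrC expRD EFinM lee_wpmul2l ?lee_fin ?expR_ge0// mgf_le.
(* The relation [e^s L(lam) = 1] makes the density integrate to exactly 1. *)
have total : (\int[P]_t (expR (Z s lam t))%:E = 1)%E.
  rewrite mgf_exceedances_excess// es mulVf ?gt_eqF// subrr mulr0 addr0.
  by rewrite expr1n.
have : (1 <= \int[P]_t (f0 t + (f1 t + (f2 t + (f3 t + f4 t))))%:E)%E.
  rewrite -total; apply: ge0_le_integral => //.
  - exact/measurable_EFinP.
  - by apply/measurable_EFinP; do 4?apply: measurable_funD.
  - by move=> t _; rewrite lee_fin.
have D (f g : T -> R) (bf bg : R) : measurable_fun setT f -> measurable_fun setT g ->
    (forall t, 0 <= f t) -> (forall t, 0 <= g t) ->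
    (\int[P]_t (f t)%:E <= bf%:E)%E -> (\int[P]_t (g t)%:E <= bg%:E)%E ->
    (\int[P]_t (f t + g t)%:E <= (bf + bg)%:E)%E.
  move=> mf mg f0' g0' hf hg; under eq_integral do rewrite EFinD.
  rewrite ge0_integralD//; first by rewrite EFinD leeD.
  - by move=> t _; rewrite lee_fin.
  - exact/measurable_EFinP.
  - by move=> t _; rewrite lee_fin.
  - exact/measurable_EFinP.
rewrite -lee_fin => /le_trans; apply; apply: (D _ _ _ _) => //.
- by do 3?apply: measurable_funD.
- by move=> t; rewrite mulr_ge0 ?expR_ge0// indicE.
- by move=> t; rewrite !addr_ge0// mulr_ge0 ?expR_ge0.
- under eq_integral do rewrite EFinM.
  rewrite ge0_integralZl ?lee_fin ?expR_ge0//; last first.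
    by apply/measurable_EFinP; exact: measurable_indic.
  rewrite integral_indic// setIT EFinM /pr fineK ?fin_num_measure//.
apply: (D _ _ _ _) => //.
- by do 2?apply: measurable_funD.
- by move=> t; rewrite mulr_ge0 ?expR_ge0.
- by move=> t; rewrite !addr_ge0// mulr_ge0 ?expR_ge0.
- apply: le_trans (I _ _ _ _) _; first by rewrite subr_ge0.
  by rewrite es [(L lam)^-1 * _]mulrC.
apply: (D _ _ _ _) => //.
- by apply: measurable_funD.
- by move=> t; rewrite mulr_ge0 ?expR_ge0.
- by move=> t; rewrite !addr_ge0// mulr_ge0 ?expR_ge0.
- apply: le_trans (I _ _ _ _) _; first by rewrite addr_ge0.
  by rewrite es [(L lam)^-1 * _]mulrC.
apply: (D _ _ _ _) => //.
- by move=> t; rewrite mulr_ge0 ?expR_ge0.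
- by move=> t; rewrite mulr_ge0 ?expR_ge0.
- apply: le_trans (I _ _ _ lam0) _.
  have -> // : expR (s - kap) * L lam = expR (- kap).
  by rewrite expRD es mulrAC mulVf ?gt_eqF// mul1r.
- apply: le_trans (I _ _ _ lam0) _.
  have -> // : expR (s + kap) * L lam = expR kap.
  by rewrite expRD es mulrAC mulVf ?gt_eqF// mul1r.
Qed.

End chernoff.

(** * Second-order limits along a sequence of thresholds *)

Section second_order_limits.
Context {R : realType}.
Variable tau : nat -> R.
Hypothesis tau_gt0 : \forall n \near \oo, 0 < tau n.
Hypothesis tau_cvg0 : tau n @[n --> \oo] --> (0 : R).

Lemma cvg_remainder (f : R -> R) (z : nat -> R) (r C D : R) : 0 < D ->
  (forall x, `|x| <= D -> `|f x| <= C * `|x| ^+ 3) ->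
  z n / tau n @[n --> \oo] --> r ->
  f (z n) / tau n ^+ 2 @[n --> \oo] --> (0 : R).
Proof.
move=> D0 fC zr.
have z0 : z n @[n --> \oo] --> (0 : R).
  have : z n / tau n * tau n @[n --> \oo] --> r * 0 by exact: cvgM.
  rewrite mulr0; apply: cvg_trans; apply: near_eq_cvg.
  by near=> n; rewrite divfK// gt_eqF//; near: n.
apply/norm_cvg0P.
apply: (@squeeze_cvgr _ _ _ _ (fun=> 0) (fun n => C * `|z n / tau n| ^+ 2 * `|z n|)); last 2 first.
- exact: cvg_cst.
- rewrite [X in _ --> X](_ : 0 = C * `|r| ^+ 2 * `|0 : R|); last by rewrite normr0 mulr0.
  apply: cvgM; last exact: cvg_norm.
  apply: cvgMl_tmp; rewrite expr2; under eq_fun do rewrite expr2.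
  by apply: cvgM; apply: cvg_norm.
near=> n; rewrite normr_ge0/=.
have t0 : 0 < tau n by near: n.
rewrite !normf_div (gtr0_norm t0) [`|tau n ^+ 2|]gtr0_norm ?exprn_gt0//.
have -> : C * (`|z n| / tau n) ^+ 2 * `|z n| = C * `|z n| ^+ 3 / tau n ^+ 2.
  by field; rewrite gt_eqF.
rewrite ler_pM2r ?invr_gt0 ?exprn_gt0// fC//.
by near: n; move/cvgr0_norm_le : z0; apply.
Unshelve. all: end_near. Qed.

Lemma cvg_expR_order2 (z : nat -> R) (r : R) : z n / tau n @[n --> \oo] --> r ->
  (expR (z n) - 1 - z n) / tau n ^+ 2 @[n --> \oo] --> r ^+ 2 / 2.
Proof.
move=> zr.
have h : 0 < (2^-1 : R) by [].
have H := cvg_remainder h (@expR_taylor2 R) zr.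
have : (expR (z n) - 1 - z n - z n ^+ 2 / 2) / tau n ^+ 2 + (z n / tau n) * (z n / tau n) / 2
    @[n --> \oo] --> 0 + r * r / 2.
  by apply: cvgD => //; apply: cvgMr_tmp; exact: cvgM.
rewrite add0r expr2; apply: cvg_trans; apply: near_eq_cvg.
near=> n; have t0 : 0 < tau n by near: n.
by field; rewrite gt_eqF.
Unshelve. all: end_near. Qed.

Lemma cvg_ln_order2 (z : nat -> R) (r : R) : z n / tau n @[n --> \oo] --> r ->
  (ln (1 + z n) - z n) / tau n ^+ 2 @[n --> \oo] --> - (r ^+ 2 / 2).
Proof.
move=> zr.
have h : 0 < (4^-1 : R) by [].
have H := cvg_remainder h (@ln_taylor2 R) zr.
have : (ln (1 + z n) - z n + z n ^+ 2 / 2) / tau n ^+ 2 - (z n / tau n) * (z n / tau n) / 2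
    @[n --> \oo] --> 0 - r * r / 2.
  by apply: cvgB => //; apply: cvgMr_tmp; exact: cvgM.
rewrite sub0r expr2; apply: cvg_trans; apply: near_eq_cvg.
near=> n; have t0 : 0 < tau n by near: n.
by field; rewrite gt_eqF.
Unshelve. all: end_near. Qed.

Lemma cvg_expR_order1 (z : nat -> R) (r : R) : z n / tau n @[n --> \oo] --> r ->
  (expR (z n) - 1) / tau n @[n --> \oo] --> r.
Proof.
move=> zr; have H := cvg_expR_order2 zr.
have : (expR (z n) - 1 - z n) / tau n ^+ 2 * tau n + z n / tau n
    @[n --> \oo] --> r ^+ 2 / 2 * 0 + r.
  by apply: cvgD => //; exact: cvgM.
rewrite mulr0 add0r; apply: cvg_trans; apply: near_eq_cvg.
near=> n; have t0 : 0 < tau n by near: n.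
by field; rewrite gt_eqF.
Unshelve. all: end_near. Qed.

Variables (V : R -> R) (alpha rho c0 : R).
Let b s := V s - s / alpha - c0.
Hypothesis alpha_gt0 : 0 < alpha.
Hypothesis rho_lt0 : rho < 0.
Hypothesis mV : measurable_fun setT V.
Hypothesis V_nd : forall s e, 0 < s -> s <= e -> V s <= V e.
Hypothesis b_rv : forall y, b (s + y) / b s @[s --> +oo] --> expR (rho * y).
Hypothesis b_lc : forall s, 0 < s -> b y @[y --> s^'-] --> b s.
Variables (s : nat -> R) (C : R).
Hypothesis s_pinfty : s n @[n --> \oo] --> +oo.
Hypothesis b_le_tau : \forall n \near \oo, `|b (s n)| <= C * tau n.

(** The displacement eventually enters the uniform window because [tau] tends to 0, so the relative
    change of [b] is small; multiplied by [b (s n)], which is [O (tau n)], it is [o (tau n)]. *)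
Lemma cvg_shift_b (w : nat -> R) (K : R) :
  (\forall n \near \oo, `|w n - s n| <= K * tau n) ->
  (b (w n) - b (s n)) / tau n @[n --> \oo] --> (0 : R).
Proof.
move=> wK; apply/cvgr0Pnorm_le => e e0.
pose C' := Num.max C 1.
have C'0 : 0 < C' by rewrite lt_max ltr01 orbT.
pose e' := Num.min 1 (e / C').
have e'01 : 0 < e' <= 1 by rewrite lt_min ltr01 divr_gt0//= ge_min lexx.
have [del [N [del0 N0 H]]] := regularly_varying_uniform e'01 b_lc b_rv.
have Kt0 : K * tau n @[n --> \oo] --> (0 : R).
  by rewrite -(mulr0 K); exact: cvgMl_tmp.
near=> n; have t0 : 0 < tau n by near: n.
have sN : N <= s n by near: n; move/cvgryPge : s_pinfty; apply.
have wsd : `|w n - s n| <= del.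
  have h1 : `|w n - s n| <= K * tau n by near: n.
  have h2 : `|K * tau n| <= del by near: n; move/cvgr0_norm_le : Kt0; apply.
  by rewrite (le_trans h1)// (le_trans (ler_norm _)).
have [bs] := H _ _ sN wsd; rewrite (_ : s n + (w n - s n) = w n); last ring.
move=> Hb.
have bst : `|b (s n)| <= C * tau n by near: n.
rewrite normf_div (gtr0_norm t0) ler_pdivrMr//.
have -> : b (w n) - b (s n) = (b (w n) / b (s n) - 1) * b (s n) by field.
rewrite normrM (le_trans (ler_pM _ _ Hb bst))//.
have CC' : C <= C' by rewrite le_max lexx.
have e'C : e' * C' <= e by rewrite -ler_pdivlMr// ge_min lexx orbT.
have e'0 : 0 <= e' by case/andP: e'01 => /ltW.
rewrite mulrA ler_pM2r//; apply: le_trans e'C.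
by rewrite ler_wpM2l.
Unshelve. all: end_near. Qed.

(** To first order, [alpha] times the mean log-excess above [s n]: the linear part of [V]
    contributes 1, and the mean increment of [b] is about [b (s n) * rho / (1 - rho)]. Since
    [rho * b (s n)] is equivalent to [A (n / k)], this stands for the constant [m] of the
    overview. *)
Definition centering n := 1 + alpha * (rho * b (s n)) / (1 - rho).

Lemma cvg_centering : centering n @[n --> \oo] --> (1 : R).
Proof.
have H : b (s n) @[n --> \oo] --> (0 : R).
  apply/norm_cvg0P.
  apply: (@squeeze_cvgr _ _ _ _ (fun=> 0) (fun n => C * tau n)); last 2 first.
  - exact: cvg_cst.
  - by rewrite -(mulr0 C); exact: cvgMl_tmp.
  by near=> n; rewrite normr_ge0/=; near: n.
rewrite /centering -[X in _ --> X](_ : 1 + alpha * (rho * 0) / (1 - rho) = 1); last by rewrite !mulr0 mul0r addr0.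
apply: cvgD; first exact: cvg_cst.
by apply: cvgMr_tmp; apply: cvgMl_tmp; exact: cvgMl_tmp.
Unshelve. all: end_near. Qed.

(** The logarithm turns the quadratic coefficient [l ^+ 2] into [l ^+ 2 - l ^+ 2 / 2]. The bias at
    [w n] is replaced by that at [s n], so the limit is common to all nearby thresholds. *)
Lemma cvg_ln_laplace (w : nat -> R) (K l : R) : 0 <= l ->
  (\forall n \near \oo, `|w n - s n| <= K * tau n) ->
  (ln (laplace V (w n) (alpha * tau n * l)) + l * tau n * centering n) / tau n ^+ 2
    @[n --> \oo] --> l ^+ 2 / 2.
Proof.
move=> l0 wK.
have [N N0 bbd] := regularly_varying_bounded rho_lt0 b_lc b_rv.
have bws := cvg_shift_b wK.
have w_pinfty : w n @[n --> \oo] --> +oo.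
  apply/cvgryPge => M; near=> n.
  have h1 : `|w n - s n| <= K * tau n by near: n.
  have h2 : `|K * tau n| <= 1.
    near: n; have Kt0 : K * tau n @[n --> \oo] --> (0 : R).
      by rewrite -(mulr0 K); exact: cvgMl_tmp.
    by move/cvgr0_norm_le : Kt0; apply.
  have h3 : M + 1 <= s n by near: n; move/cvgryPge : s_pinfty; apply.
  have := le_trans h1 (le_trans (ler_norm _) h2).
  by rewrite ler_norml => /andP[? ?]; lra.
have bw_le : \forall n \near \oo, `|b (w n)| <= (`|C| + 1) * tau n.
  have /cvgr0_norm_le /(_ _ ltr01) := bws => H.
  near=> n; have t0 : 0 < tau n by near: n.
  have : `|(b (w n) - b (s n)) / tau n| <= 1 by near: n.
  rewrite normf_div (gtr0_norm t0) ler_pdivrMr// mul1r => h1.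
  have h2 : `|b (s n)| <= C * tau n by near: n.
  have h3 : C * tau n <= `|C| * tau n by rewrite ler_pM2r// ler_norm.
  have := ler_normD (b (w n) - b (s n)) (b (s n)); rewrite subrK; lra.
pose C' := `|C| + 1.
have C'0 : 0 <= C' by rewrite addr_ge0.
(* The expansion asks for its bounds at every [n], while they hold eventually; hence the shift of
   the index by [M]. *)
have [M _ HM] : \forall n \near \oo, [/\ N <= w n, 0 < tau n, `|b (w n)| <= C' * tau n
    & 3 * alpha * l * C' * tau n ^+ 2 <= 2^-1].
  near=> n; split; [near: n|near: n; exact: tau_gt0|near: n; exact: bw_le|near: n].
    by move/cvgryPge : w_pinfty; apply.
  have : 3 * alpha * l * C' * tau n ^+ 2 @[n --> \oo] --> (0 : R).
    rewrite [X in _ --> X](_ : 0 = 3 * alpha * l * C' * (0 * 0)); last by rewrite !mulr0.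
    by apply: cvgMl_tmp; under eq_fun do rewrite expr2; exact: cvgM.
  move/cvgr0_norm_le => /(_ 2^-1) H; near=> n.
  by rewrite (le_trans (ler_norm _))//; near: n; apply: H.
have shiftM (f : nat -> R) (F : set_system R) :
    f n @[n --> \oo] --> F -> f (n + M)%N @[n --> \oo] --> F.
  by rewrite -(cvg_shiftn M f).
have HM' n : [/\ N <= w (n + M)%N, 0 < tau (n + M)%N, `|b (w (n + M)%N)| <= C' * tau (n + M)%N
    & 3 * alpha * l * C' * tau (n + M)%N ^+ 2 <= 2^-1] by apply: HM; exact: leq_addl.
have E : (laplace V (w n) (alpha * tau n * l) -
     (1 - l * tau n + l ^+ 2 * tau n ^+ 2
        - l * tau n * alpha * b (w n) * (rho / (1 - rho)))) / tau n ^+ 2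
   @[n --> \oo] --> (0 : R).
  rewrite -(cvg_shiftn M).
  apply: (@laplace_expansion _ V alpha rho c0 (fun n => w (n + M)%N)
    (fun n => tau (n + M)%N) l C' N) => //.
  - by move=> n e e0; have [h1 _ _ _] := HM' n; rewrite V_nd ?lerDl// (lt_le_trans N0).
  - exact: shiftM.
  - exact: shiftM.
  - by move=> n; have [] := HM' n.
  - by move=> n; have [] := HM' n.
  - by move=> n; have [] := HM' n.
  - by move=> n; have [] := HM' n.
pose q n := laplace V (w n) (alpha * tau n * l) - 1.
have mc := cvg_centering.
have E2 : (q n + l * tau n * centering n) / tau n ^+ 2 @[n --> \oo] --> l ^+ 2.
  have : (laplace V (w n) (alpha * tau n * l) -
     (1 - l * tau n + l ^+ 2 * tau n ^+ 2
        - l * tau n * alpha * b (w n) * (rho / (1 - rho)))) / tau n ^+ 2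
     + l ^+ 2 - l * alpha * (rho / (1 - rho)) * ((b (w n) - b (s n)) / tau n)
    @[n --> \oo] --> 0 + l ^+ 2 - l * alpha * (rho / (1 - rho)) * 0.
    apply: cvgB; first by apply: cvgD => //; exact: cvg_cst.
    exact: cvgMl_tmp.
  rewrite mulr0 subr0 add0r; apply: cvg_trans; apply: near_eq_cvg.
  near=> n; have t0 : 0 < tau n by near: n.
  have r1 : 1 - rho != 0 by rewrite subr_eq0 gt_eqF// (lt_trans rho_lt0 ltr01).
  by rewrite /q /centering; field; rewrite r1 gt_eqF.
have E3 : q n / tau n @[n --> \oo] --> - l.
  have : (q n + l * tau n * centering n) / tau n ^+ 2 * tau n - l * centering n
      @[n --> \oo] --> l ^+ 2 * 0 - l * 1.
    by apply: cvgB; [exact: cvgM|exact: cvgMl_tmp].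
  rewrite mulr0 sub0r mulr1; apply: cvg_trans; apply: near_eq_cvg.
  near=> n; have t0 : 0 < tau n by near: n.
  by field; rewrite gt_eqF.
have E4 := cvg_ln_order2 E3.
have : (ln (1 + q n) - q n) / tau n ^+ 2 + (q n + l * tau n * centering n) / tau n ^+ 2
   @[n --> \oo] --> - ((- l) ^+ 2 / 2) + l ^+ 2 by exact: cvgD.
rewrite [X in _ --> X](_ : _ = l ^+ 2 / 2); last by field.
apply: cvg_trans; apply: near_eq_cvg.
near=> n; have t0 : 0 < tau n by near: n.
have -> : 1 + q n = laplace V (w n) (alpha * tau n * l) by rewrite /q; ring.
by rewrite -mulrDl; congr (_ / _); rewrite addrA subrK.
Unshelve. all: end_near. Qed.

End second_order_limits.

(** * Moderate deviations of the Hill statistic *)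

Lemma near_choice (R : realType) (Q : nat -> R -> Prop) :
  (\forall n \near \oo, exists w, Q n w) ->
  exists w : nat -> R, \forall n \near \oo, Q n (w n).
Proof.
move=> H.
have /choice[w Hw] : forall n, exists w, (exists w', Q n w') -> Q n w.
  move=> n; have [[w Qw]|nQ] := pselect (exists w', Q n w'); first by exists w.
  by exists 0 => /nQ.
by exists w; near=> n; apply: Hw; near: n.
Unshelve. all: end_near. Qed.

Lemma ge_half_of_small_errors (R : realType) (y1 y2 x1 x2 x3 x4 del : R) :
  1 <= y1 + (x1 + (x2 + (x3 + x4))) ->
  x1 <= del -> x2 <= del -> x3 <= del -> x4 <= del -> del <= 8^-1 -> y1 <= y2 ->
  2^-1 <= y2.
Proof. by move=> *; lra. Qed.

Lemma divr_expR_ln (R : realType) (x y : R) : 0 < x -> 0 < y ->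
  y / x = expR (ln y - ln x).
Proof. by move=> x0 y0; rewrite expRB !lnK. Qed.

Section moderate_deviations.
Context {R : realType} {d : measure_display} {T : measurableType d}.
Variables (P : probability T R) (U : R -> R) (X : nat -> {RV P >-> R}).
Hypothesis U_gt0 : forall x, 1 < x -> 0 < U x.
Hypothesis U_nd : forall x y, 1 < x -> x <= y -> U x <= U y.
Hypothesis X_iid : iid_RV U X.
Variables (alpha rho c0 : R).
Let V := log_quantile U.
Let b s := V s - s / alpha - c0.
Hypothesis alpha_gt0 : 0 < alpha.
Hypothesis rho_lt0 : rho < 0.
Hypothesis V_lc : forall s, 0 < s -> V y @[y --> s^'-] --> V s.
Hypothesis b_rv : forall y, b (s + y) / b s @[s --> +oo] --> expR (rho * y).
Variables (k : nat -> nat) (tau c : nat -> R) (C : R).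
Let s n : R := ln (n%:R / (k n)%:R).
Let kt2 n := (k n)%:R * tau n ^+ 2.
Hypothesis k_gt0 : \forall n \near \oo, (0 < k n)%N.
Hypothesis k_le : \forall n \near \oo, (k n <= n)%N.
Hypothesis s_pinfty : s n @[n --> \oo] --> +oo.
Hypothesis tau_gt0 : \forall n \near \oo, 0 < tau n.
Hypothesis tau_cvg0 : tau n @[n --> \oo] --> (0 : R).
Hypothesis kt2_pinfty : kt2 n @[n --> \oo] --> +oo.
Hypothesis b_le_tau : \forall n \near \oo, `|b (s n)| <= C * tau n.
Let m := centering V alpha rho c0 s.
Hypothesis c_cvg : (m n - alpha * c n) / tau n @[n --> \oo] --> (1 : R).

Let mV : measurable_fun setT V.
Proof. exact: measurable_log_quantile. Qed.

Let V_nd y e : 0 < y -> y <= e -> V y <= V e.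
Proof. exact: log_quantile_le. Qed.

Let b_lc z : 0 < z -> b y @[y --> z^'-] --> b z.
Proof.
move=> z0; apply: cvgB; last exact: cvg_cst.
apply: cvgB; first exact: V_lc.
by apply: cvg_at_left_filter; apply: cvgMr_tmp; exact: cvg_id.
Qed.

Let tau_le (e : R) : 0 < e -> \forall n \near \oo, tau n <= e.
Proof.
move=> e0; have /cvgr0_norm_le /(_ _ e0) := tau_cvg0 => H; near=> n.
by rewrite (le_trans (ler_norm _))//; near: n.
Unshelve. all: end_near. Qed.

Let nE : \forall n \near \oo, forall w : R,
  n%:R * expR (- w) = (k n)%:R * expR (s n - w).
Proof.
near=> n => w.
have k0 : (0 < k n)%N by near: n.
have n0 : (0 < n)%N by rewrite (leq_trans k0)//; near: n.
rewrite expRD /s lnK ?posrE ?divr_gt0 ?ltr0n// mulrA; congr (_ * _).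
by field; rewrite pnatr_eq0 -lt0n.
Unshelve. all: end_near. Qed.

(** Over a window of length [eta * tau] the drift [eta * tau / alpha] beats the [o (tau)] variation
    of [b], so [V] increases strictly. The supremum of the points where [V] does not exceed its
    value at the left end then lies in the window, and left continuity keeps [V] at that value
    there. *)
Lemma increase_point_near (x eta : R) : 0 < eta ->
  \forall n \near \oo, exists w, increase_point U w /\
    s n + x * tau n <= w <= s n + (x + eta) * tau n.
Proof.
move=> eta0.
have near_s y : \forall n \near \oo, `|s n + y * tau n - s n| <= `|y| * tau n.
  near=> n; have t0 : 0 < tau n by near: n.
  by rewrite addrC addKr normrM (gtr0_norm t0).
have d1 := cvg_shift_b tau_gt0 tau_cvg0 b_rv b_lc s_pinfty b_le_tau (near_s x).
have d2 := cvg_shift_b tau_gt0 tau_cvg0 b_rv b_lc s_pinfty b_le_tau (near_s (x + eta)).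
have e4 : 0 < eta / alpha / 4 by rewrite !divr_gt0.
have x0 : x * tau n @[n --> \oo] --> (0 : R).
  by rewrite -(mulr0 x); exact: cvgMl_tmp.
near=> n; have t0 : 0 < tau n by near: n.
have G1 : `|(b (s n + x * tau n) - b (s n)) / tau n| <= eta / alpha / 4.
  by near: n; move/cvgr0_norm_le : d1; apply.
have G2 : `|(b (s n + (x + eta) * tau n) - b (s n)) / tau n| <= eta / alpha / 4.
  by near: n; move/cvgr0_norm_le : d2; apply.
set t := s n + x * tau n; set t' := s n + (x + eta) * tau n.
have tt' : t' = t + eta * tau n by rewrite /t /t'; ring.
have et0 : 0 < eta * tau n by exact: mulr_gt0.
have t_gt0 : 0 < t.
  have h1 : `|x * tau n| <= 1 by near: n; move/cvgr0_norm_le : x0; apply.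
  have h2 : 2 <= s n by near: n; move/cvgryPge : s_pinfty; apply.
  by move: h1; rewrite ler_norml /t => /andP[? ?]; lra.
have H1 : `|b t - b (s n)| <= eta / alpha / 4 * tau n.
  by move: G1; rewrite normf_div (gtr0_norm t0) ler_pdivrMr.
have H2 : `|b t' - b (s n)| <= eta / alpha / 4 * tau n.
  by move: G2; rewrite normf_div (gtr0_norm t0) ler_pdivrMr.
have VV : V t < V t'.
  have : V t' - V t = eta * tau n / alpha + (b t' - b (s n)) - (b t - b (s n)).
    have -> : eta * tau n = t' - t by rewrite tt'; ring.
    by rewrite /b; field; rewrite gt_eqF.
  have : 0 < eta / alpha * tau n by rewrite mulr_gt0// divr_gt0.
  move: H1 H2; rewrite !ler_norml => /andP[? ?] /andP[? ?].
  lra.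
pose A := [set y | 0 < y /\ V y <= V t].
have At : A t by split.
have A_ub : ubound A t'.
  move=> y [y0 Vy]; rewrite leNgt; apply/negP => ty.
  have : V t' <= V y by rewrite V_nd// ?ltW// tt' addr_gt0.
  lra.
have supA : has_sup A by split; [exists t|exists t'].
pose w := sup A.
have tw : t <= w by apply: sup_upper_bound.
have wt' : w <= t' by apply: ge_sup => //; exists t.
have w0 : 0 < w by exact: lt_le_trans tw.
have Vw : V w <= V t.
  apply: (closed_cvg (fun y => y <= V t)) (V_lc w0); first exact: closed_le.
  have : \forall y \near w^'-, 0 < y by exact: nbhs_left_gt.
  move=> H0; near=> y.
  have y0 : 0 < y by near: y.
  have yw : y < w by near: y; exact: nbhs_left_lt.
  have [z [z0 Vz] yz] : exists2 z, A z & y < z.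
    have wy : 0 < w - y by rewrite subr_gt0.
    have [z Az] := sup_adherent wy supA.
    by rewrite -/w opprB addrC subrK => yz; exists z.
  by rewrite (le_trans _ Vz)// V_nd// ltW.
exists w; split; last by rewrite tw wt'.
split=> // e we; have e0 := lt_trans w0 we.
have : V t < V e.
  rewrite ltNge; apply/negP => Ve.
  have : e <= w by apply: sup_upper_bound.
  by rewrite leNgt we.
move=> /(le_lt_trans Vw); by rewrite /V !log_quantileE// ltr_ln ?posrE ?U_gt0 ?expR_gt1.
Unshelve. all: end_near. Qed.

Let pr (A : set T) : R := fine (P A).
Let N (w : R) n (t : T) : R := exceedances (U (expR w)) (fun j => X j t) n.
Let S (w : R) n (t : T) : R := excess (U (expR w)) (fun j => X j t) n.
Let H n t := hill_H (fun j => X j t) (k n) n.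

Let mH n : (k n <= n)%N -> measurable [set t | H n t < c n].
Proof.
move=> kn; rewrite (_ : [set _ | _] = H n @^-1` `]-oo, c n[).
  by rewrite -[_ @^-1` _]setTI; apply: measurable_hill_H.
by apply/seteqP; split=> t /=; rewrite in_itv/=.
Qed.

(** At least [k * (1 + 4 * tau)] exceedances are expected. The Chernoff parameter [tau] gives the
    exponent [- 2 * tau ^+ 2] up to cubic terms; the resulting rate 1 exceeds the target [1 / 2],
    which is why the distance 4 was taken. *)
Lemma prob_too_few (w : nat -> R) :
  (\forall n \near \oo, increase_point U (w n) /\ w n <= s n - 4 * tau n) ->
  \forall n \near \oo, pr [set t | N (w n) n t < (k n)%:R] <= expR (- kt2 n).
Proof.
move=> wi; near=> n.
have t0 : 0 < tau n by near: n.
have t8 : tau n <= 8^-1 by near: n; apply: tau_le.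
have [winc ws] : increase_point U (w n) /\ w n <= s n - 4 * tau n by near: n.
apply: le_trans (prob_exceed_lt U_gt0 U_nd X_iid (k n)%:R n winc (ltW t0)) _.
have -> : n%:R * expR (- w n) = (k n)%:R * expR (s n - w n) by near: n; apply: filterS nE => n; apply.
rewrite ler_expR /kt2.
have h1 : 1 + 4 * tau n <= expR (s n - w n).
  by apply: le_trans (expR_ge1Dx _); rewrite lerD2l; lra.
have h2 : expR (- tau n) - 1 <= - tau n + 2 * tau n ^+ 2.
  have := @expR_taylor1 R (- tau n); rewrite normrN gtr0_norm// => /(_ _).
  by rewrite ler_norml sqrrN => /(_ _)/andP[]; lra.
have h3 : expR (- tau n) - 1 <= 0 by rewrite subr_le0 -expR0 ler_expR oppr_le0 ltW.
have k0 : 0 <= (k n)%:R :> R by [].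
suff : expR (s n - w n) * (expR (- tau n) - 1) + tau n <= - tau n ^+ 2.
  move=> /(ler_wpM2l k0); rewrite mulrDr mulrA mulrN; lra.
have h4 : expR (s n - w n) * (expR (- tau n) - 1) <= (1 + 4 * tau n) * (expR (- tau n) - 1).
  by rewrite -subr_ge0 -mulrBl mulr_le0// subr_le0.
have h5 : (1 + 4 * tau n) * (expR (- tau n) - 1) <= (1 + 4 * tau n) * (- tau n + 2 * tau n ^+ 2).
  by rewrite ler_pM2l//; lra.
have h6 : tau n ^+ 2 * tau n <= tau n ^+ 2 * 8^-1 by rewrite ler_pM2l ?exprn_gt0.
lra.
Unshelve. all: end_near. Qed.

Lemma prob_too_many (w : nat -> R) :
  (\forall n \near \oo, increase_point U (w n) /\ s n + 4 * tau n <= w n) ->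
  \forall n \near \oo, pr [set t | (k n)%:R <= N (w n) n t] <= expR (- kt2 n).
Proof.
move=> wi; near=> n.
have t0 : 0 < tau n by near: n.
have t8 : tau n <= 32^-1 by near: n; apply: tau_le.
have [winc ws] : increase_point U (w n) /\ s n + 4 * tau n <= w n by near: n.
apply: le_trans (prob_exceed_ge U_gt0 U_nd X_iid (k n)%:R n winc (ltW t0)) _.
have -> : n%:R * expR (- w n) = (k n)%:R * expR (s n - w n) by near: n; apply: filterS nE => n; apply.
rewrite ler_expR /kt2.
have h0 : expR (s n - w n) <= expR (- (4 * tau n)) by rewrite ler_expR; lra.
have h1 : expR (- (4 * tau n)) <= 1 - 4 * tau n + 32 * tau n ^+ 2.
  have := @expR_taylor1 R (- (4 * tau n)).
  rewrite normrN gtr0_norm ?mulr_gt0// => /(_ _).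
  by rewrite ler_norml sqrrN => /(_ _)/andP[]; lra.
have h2 : expR (tau n) - 1 <= tau n + 2 * tau n ^+ 2.
  have := @expR_taylor1 R (tau n); rewrite gtr0_norm// => /(_ _).
  by rewrite ler_norml => /(_ _)/andP[]; lra.
have h3 : 0 <= expR (tau n) - 1 by rewrite subr_ge0 -expR0 ler_expR ltW.
have k0 : 0 <= (k n)%:R :> R by [].
suff : expR (s n - w n) * (expR (tau n) - 1) - tau n <= - tau n ^+ 2.
  move=> /(ler_wpM2l k0); rewrite mulrBr mulrA mulrN; lra.
have h4 : expR (s n - w n) * (expR (tau n) - 1) <=
   (1 - 4 * tau n + 32 * tau n ^+ 2) * (tau n + 2 * tau n ^+ 2).
  by rewrite ler_pM ?expR_ge0// (le_trans h0).
have h6 : tau n ^+ 2 * tau n <= tau n ^+ 2 * 32^-1 by rewrite ler_pM2l ?exprn_gt0.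
have h7 : tau n ^+ 2 * tau n ^+ 2 <= tau n ^+ 2 * 1024^-1.
  rewrite ler_pM2l ?exprn_gt0//; have := ler_pM (ltW t0) (ltW t0) t8 t8.
  by rewrite -expr2; lra.
have h8 : 0 <= tau n ^+ 2 by rewrite exprn_ge0 ?ltW.
lra.
Unshelve. all: end_near. Qed.

Let prob_leU (A B C' : set T) : measurable A -> measurable B -> measurable C' ->
  A `<=` B `|` C' -> pr A <= pr B + pr C'.
Proof.
move=> mA mB mC ABC; rewrite /pr -lee_fin EFinD !fineK ?fin_num_measure//.
apply: (@le_trans _ _ (P (B `|` C'))).
  by apply: le_measure => //; rewrite inE//; exact: measurableU.
exact: measureU2.
Qed.

Lemma near_exp_small (del a : R) : 0 < del -> 0 < a ->
  \forall n \near \oo, expR (- (del * kt2 n)) <= a.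
Proof.
move=> d0 a0; near=> n.
have : - ln a / del <= kt2 n by near: n; move/cvgryPge : kt2_pinfty; apply.
rewrite ler_pdivrMr// => h; rewrite -[leRHS]lnK// ler_expR; lra.
Unshelve. all: end_near. Qed.

(** * Laplace transforms around the tilting parameter *)

Section laplace_ratio.
Variables (w : nat -> R) (K : R).
Hypothesis wK : \forall n \near \oo, `|w n - s n| <= K * tau n.
Let L l n := laplace V (w n) (alpha * tau n * l).
Let Lam l n := (ln (L l n) + l * tau n * m n) / tau n ^+ 2.

Let cvg_Lam l : 0 <= l -> Lam l n @[n --> \oo] --> l ^+ 2 / 2.
Proof.
move=> l0; exact: (cvg_ln_laplace tau_gt0 tau_cvg0 alpha_gt0 rho_lt0 mV V_nd b_rv b_lc s_pinfty b_le_tau l0 wK).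
Qed.

Let m_cvg : m n @[n --> \oo] --> (1 : R).
Proof. exact: (cvg_centering tau_cvg0 rho b_le_tau). Qed.

Let lnLE l : \forall n \near \oo, ln (L l n) = tau n ^+ 2 * Lam l n - l * tau n * m n.
Proof.
near=> n; have t0 : 0 < tau n by near: n.
by rewrite /Lam; field; rewrite gt_eqF.
Unshelve. all: end_near. Qed.

(** A zero value would give [ln 0 = 0] by convention, whereas the expansion makes the logarithm
    equivalent to [- l * tau]. *)
Lemma near_laplace_gt0 l : 0 < l -> \forall n \near \oo, 0 < L l n.
Proof.
move=> l0.
have H1 : tau n * Lam l n - l * m n @[n --> \oo] --> 0 * (l ^+ 2 / 2) - l * 1.
  by apply: cvgB; [apply: cvgM => //; apply: cvg_Lam; exact: ltW|exact: cvgMl_tmp].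
rewrite mul0r sub0r mulr1 in H1.
near=> n; have t0 : 0 < tau n by near: n.
rewrite lt_neqAle laplace_ge0 andbT; apply/eqP => L0.
have : ln (L l n) = tau n ^+ 2 * Lam l n - l * tau n * m n by near: n; exact: lnLE.
rewrite -L0 ln0//.
have -> : tau n ^+ 2 * Lam l n - l * tau n * m n = tau n * (tau n * Lam l n - l * m n) by ring.
move/esym/eqP; rewrite mulf_eq0 gt_eqF//= => /eqP h.
have : tau n * Lam l n - l * m n < 0.
  by near: n; move/cvgr_lt : H1; apply; rewrite oppr_lt0.
by rewrite h ltxx.
Unshelve. all: end_near. Qed.

(** The ratio is a Laplace transform under the tilted law, and its expansion evaluates the Chernoff
    errors of the change of measure. The coefficient collects [r ^+ 2 / 2] from the exponential and
    [(l + r) ^+ 2 / 2 - l ^+ 2 / 2]. *)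
Lemma cvg_laplace_ratio l r : 0 < l -> 0 < l + r ->
  (L (l + r) n / L l n - 1) / tau n @[n --> \oo] --> - r /\
  (L (l + r) n / L l n - 1 + r * tau n * m n) / tau n ^+ 2 @[n --> \oo]
    --> r ^+ 2 + l * r.
Proof.
move=> l0 lr0.
pose z n := ln (L (l + r) n) - ln (L l n).
have zE : \forall n \near \oo, z n = tau n ^+ 2 * (Lam (l + r) n - Lam l n) - r * tau n * m n.
  near=> n; have h1 : ln (L l n) = tau n ^+ 2 * Lam l n - l * tau n * m n by near: n; exact: lnLE.
  have h2 : ln (L (l + r) n) = tau n ^+ 2 * Lam (l + r) n - (l + r) * tau n * m n.
    by near: n; exact: lnLE.
  by rewrite /z h1 h2; ring.
have RE : \forall n \near \oo, L (l + r) n / L l n = expR (z n).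
  near=> n; apply: divr_expR_ln; near: n.
    exact: (near_laplace_gt0 l0).
  exact: (near_laplace_gt0 lr0).
have dLam : Lam (l + r) n - Lam l n @[n --> \oo] --> (l + r) ^+ 2 / 2 - l ^+ 2 / 2.
  by apply: cvgB; apply: cvg_Lam; exact: ltW.
have zr : z n / tau n @[n --> \oo] --> - r.
  have : tau n * (Lam (l + r) n - Lam l n) - r * m n @[n --> \oo] -->
      0 * ((l + r) ^+ 2 / 2 - l ^+ 2 / 2) - r * 1.
    by apply: cvgB; [exact: cvgM|exact: cvgMl_tmp].
  rewrite mul0r sub0r mulr1; apply: cvg_trans; apply: near_eq_cvg.
  near=> n; have t0 : 0 < tau n by near: n.
  have -> : z n = tau n ^+ 2 * (Lam (l + r) n - Lam l n) - r * tau n * m n by near: n.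
  by field; rewrite gt_eqF.
split.
  apply: cvg_trans (cvg_expR_order1 tau_gt0 tau_cvg0 zr); apply: near_eq_cvg.
  by near=> n; have -> : L (l + r) n / L l n = expR (z n) by near: n.
have : (expR (z n) - 1 - z n) / tau n ^+ 2 + (Lam (l + r) n - Lam l n) @[n --> \oo] -->
    (- r) ^+ 2 / 2 + ((l + r) ^+ 2 / 2 - l ^+ 2 / 2).
  by apply: cvgD => //; exact: cvg_expR_order2.
rewrite [X in _ --> X](_ : _ = r ^+ 2 + l * r); last by field.
apply: cvg_trans; apply: near_eq_cvg.
near=> n; have t0 : 0 < tau n by near: n.
have -> : L (l + r) n / L l n = expR (z n) by near: n.
have zn : z n = tau n ^+ 2 * (Lam (l + r) n - Lam l n) - r * tau n * m n by near: n.
have -> : r * tau n * m n = tau n ^+ 2 * (Lam (l + r) n - Lam l n) - z n by rewrite zn; ring.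
by field; rewrite gt_eqF.
Unshelve. all: end_near. Qed.

(** The Chernoff exponent, in units of [k * tau ^+ 2], for an excess below [k * c] with
    [k * (1 + a * tau)] exceedances. For [a = 0] it is minimal at [l = 1], with value [- 1 / 2]. *)
Lemma cvg_ln_laplace_centered l a : 0 <= l ->
  (l * tau n * (alpha * c n) + (1 + a * tau n) * ln (L l n)) / tau n ^+ 2 @[n --> \oo]
    --> - l + l ^+ 2 / 2 - a * l.
Proof.
move=> l0.
have : - l * ((m n - alpha * c n) / tau n) + Lam l n * (1 + a * tau n) - a * l * m n
   @[n --> \oo] --> - l * 1 + l ^+ 2 / 2 * (1 + a * 0) - a * l * 1.
  apply: cvgB; last exact: cvgMl_tmp.
  apply: cvgD; first exact: cvgMl_tmp.
  apply: cvgM; first exact: cvg_Lam.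
  by apply: cvgD; [exact: cvg_cst|exact: cvgMl_tmp].
rewrite mulr0 addr0 !mulr1; apply: cvg_trans; apply: near_eq_cvg.
near=> n; have t0 : 0 < tau n by near: n.
have -> : ln (L l n) = tau n ^+ 2 * Lam l n - l * tau n * m n by near: n; exact: lnLE.
by field; rewrite gt_eqF.
Unshelve. all: end_near. Qed.

End laplace_ratio.

(** At most [4 * eta * tau * k] observations are expected between the thresholds. Having
    [16 * eta * tau * k] of them costs an exponent [- 4 * eta * tau * k], of larger order than
    [k * tau ^+ 2]. Otherwise [w2] has at least [m0] exceedances and the Hill statistic dominates
    their excess, so [l = 1] and [a = - (16 * eta)] give [- 1 / 2 + 16 * eta]; one more [eta] covers
    the convergence error. *)
Lemma prob_cell (w1 w2 : nat -> R) (K eta : R) : 0 < eta ->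
  (\forall n \near \oo, [/\ increase_point U (w1 n), increase_point U (w2 n),
     w1 n < w2 n <= w1 n + 2 * eta * tau n, `|w1 n - s n| <= K * tau n
     & `|w2 n - s n| <= K * tau n]) ->
  \forall n \near \oo,
    pr ([set t | (k n)%:R <= N (w1 n) n t] `&` [set t | N (w2 n) n t < (k n)%:R]
        `&` [set t | H n t < c n])
      <= 2 * expR (- (kt2 n * (2^-1 - 17 * eta))).
Proof.
move=> eta0 Hw.
have w2K : \forall n \near \oo, `|w2 n - s n| <= K * tau n by apply: filterS Hw => n [].
have Kt0 : K * tau n @[n --> \oo] --> (0 : R) by rewrite -(mulr0 K); exact: cvgMl_tmp.
have lim := cvg_ln_laplace_centered w2K (a := - (16 * eta)) ler01.
near=> n.
have t0 : 0 < tau n by near: n.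
have [wi1 wi2 /andP[w12 w12'] w1K _] : [/\ increase_point U (w1 n), increase_point U (w2 n),
     w1 n < w2 n <= w1 n + 2 * eta * tau n, `|w1 n - s n| <= K * tau n
     & `|w2 n - s n| <= K * tau n] by near: n.
have k0 : (0 < k n)%N by near: n.
have kn : (k n <= n)%N by near: n.
have kR : 0 < (k n)%:R :> R by rewrite ltr0n.
have L0 : 0 < laplace V (w2 n) (alpha * tau n * 1).
  by near: n; apply: (near_laplace_gt0 w2K).
have lam0 : 0 <= alpha * tau n * 1 by rewrite mulr1 mulr_ge0// ltW.
pose B1 := [set t | 16 * eta * tau n * (k n)%:R <= N (w1 n) n t - N (w2 n) n t].
pose m0 := (k n)%:R * (1 - 16 * eta * tau n).
pose B2 := [set t | m0 <= N (w2 n) n t] `&` [set t | S (w2 n) n t < (k n)%:R * c n].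
have mB1 : measurable B1.
  have mD : measurable_fun setT (fun t => N (w1 n) n t - N (w2 n) n t).
    by apply: measurable_funB; exact: measurable_exceedances.
  rewrite (_ : B1 = (fun t => N (w1 n) n t - N (w2 n) n t) @^-1` `[16 * eta * tau n * (k n)%:R, +oo[).
    by rewrite -[_ @^-1` _]setTI; apply: mD.
  by apply/seteqP; split=> t /=; rewrite in_itv/= andbT.
have mB2 : measurable B2.
  by apply: measurableI; [exact: measurable_exceedances_ge|exact: measurable_excess_lt].
have sub : [set t | (k n)%:R <= N (w1 n) n t] `&` [set t | N (w2 n) n t < (k n)%:R]
        `&` [set t | H n t < c n] `<=` B1 `|` B2.
  move=> t [[/= h1 h2] h3]; have [b1|b1] := leP (16 * eta * tau n * (k n)%:R) (N (w1 n) n t - N (w2 n) n t).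
    by left.
  right; split => /=; first by rewrite /m0; lra.
  have u1 : 0 < U (expR (w1 n)) by case: wi1 => w10 _; rewrite U_gt0// expR_gt1.
  rewrite -(lt_order_stat _ _ k0 kn) in h1.
  have {}h2 : order_stat (fun j => X j t) (k n) n <= U (expR (w2 n)).
    by rewrite leNgt (lt_order_stat _ _ k0 kn) -ltNge.
  apply: le_lt_trans (excess_le_hill k0 kn _) _; first by rewrite (lt_trans u1 h1) h2.
  by rewrite ltr_pM2l.
have mcell : measurable ([set t | (k n)%:R <= N (w1 n) n t] `&` [set t | N (w2 n) n t < (k n)%:R]
        `&` [set t | H n t < c n]).
  apply: measurableI; last exact: mH.
  by apply: measurableI; [exact: measurable_exceedances_ge|exact: measurable_exceedances_lt].
apply: le_trans (prob_leU mcell mB1 mB2 sub) _.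
rewrite [2 * _]mulr_natl mulr2n lerD//.
  apply: le_trans (prob_increment_ge U_gt0 U_nd X_iid _ n wi1 wi2 w12) _.
  rewrite ler_expR.
  have e4 : expR 1 <= 4 :> R.
    have := expR_ge1Dx (- 2^-1 : R); rewrite expRN => h.
    have -> : (1 : R) = 2^-1 + 2^-1 by field.
    rewrite expRD; have h0 := expR_gt0 (2^-1 : R).
    have h2 : expR (2^-1) <= 2 :> R.
      rewrite -[leLHS]invrK -[leRHS]invrK lef_pV2 ?posrE ?invr_gt0//; lra.
    have := ler_pM (ltW h0) (ltW h0) h2 h2; lra.
  have D1 : expR (- w1 n) - expR (- w2 n) <= expR (- w1 n) * (2 * eta * tau n).
    have -> : expR (- w2 n) = expR (- w1 n) * expR (- (w2 n - w1 n)).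
      by rewrite -expRD; congr expR; ring.
    rewrite -{1}[expR (- w1 n)]mulr1 -mulrBr ler_pM2l ?expR_gt0//.
    have := expR_ge1Dx (- (w2 n - w1 n)); lra.
  have D2 : n%:R * expR (- w1 n) <= 2 * (k n)%:R.
    have -> : n%:R * expR (- w1 n) = (k n)%:R * expR (s n - w1 n) by near: n; apply: filterS nE => n; apply.
    rewrite mulrC ler_pM2r//.
    have : `|K * tau n| <= 2^-1 by near: n; move/cvgr0_norm_le : Kt0; apply.
    move=> /(le_trans (ler_norm _)) hK; have := le_trans w1K hK => hs.
    have hs' : `|s n - w1 n| <= 2^-1 by rewrite distrC.
    have := expR_taylor1 hs'.
    have hx : (s n - w1 n) ^+ 2 <= 4^-1.
      rewrite -[_ ^+ 2]real_normK ?num_real//.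
      by have := ler_pM (normr_ge0 _) (normr_ge0 _) hs' hs'; rewrite -expr2; lra.
    move: hs'; rewrite !ler_norml => /andP[? ?] /andP[? ?]; lra.
  have D3 : n%:R * (expR (- w1 n) - expR (- w2 n)) <= 4 * eta * tau n * (k n)%:R.
    apply: le_trans (ler_wpM2l (ler0n _ n) D1) _.
    have et0 : 0 <= 2 * eta * tau n by rewrite !mulr_ge0// ltW.
    by rewrite mulrA; have := ler_wpM2r et0 D2; lra.
  have e3 : 0 <= expR 1 - 1 :> R by have := expR_ge1Dx (1 : R); lra.
  have D4 : n%:R * (expR (- w1 n) - expR (- w2 n)) * (expR 1 - 1) <= 4 * eta * tau n * (k n)%:R * 3.
    have et0 : 0 <= 4 * eta * tau n * (k n)%:R by rewrite !mulr_ge0// ltW.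
    apply: le_trans (ler_wpM2r e3 D3) _; rewrite ler_wpM2l//; lra.
  have D5 : kt2 n <= eta * tau n * (k n)%:R.
    have : tau n <= eta by near: n; apply: tau_le.
    move=> /(ler_wpM2r (ltW (mulr_gt0 t0 kR))); rewrite /kt2 expr2; lra.
  have D6 : 0 <= kt2 n by rewrite /kt2 mulr_ge0// exprn_ge0 ?ltW.
  have D7 : 0 <= eta * kt2 n by apply: mulr_ge0 => //; exact: ltW.
  lra.
apply: le_trans (prob_exceed_and_small_excess U_gt0 U_nd X_iid _ _ n wi2 lam0 L0) _.
rewrite ler_expR.
have -> : alpha * tau n * 1 * ((k n)%:R * c n) + m0 * ln (laplace V (w2 n) (alpha * tau n * 1))
  = kt2 n * ((1 * tau n * (alpha * c n) + (1 + - (16 * eta) * tau n) *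
      ln (laplace V (w2 n) (alpha * tau n * 1))) / tau n ^+ 2).
  by rewrite /kt2 /m0; field; rewrite gt_eqF.
rewrite -[leRHS]mulrN ler_wpM2l//; first by rewrite /kt2 mulr_ge0// exprn_ge0 ?ltW.
near: n.
have lt17 : - 1 + 1 ^+ 2 / 2 - - (16 * eta) * 1 < - (2^-1 - 17 * eta) :> R.
  by rewrite expr1n; lra.
exact: (cvgr_le _ lim _ lt17).
Unshelve. all: end_near. Qed.


Let A (w : R) n := [set t | (k n)%:R <= N w n t] `&` [set t | H n t < c n].
Let cell (w1 w2 : R) n := [set t | (k n)%:R <= N w1 n t]
  `&` [set t | N w2 n t < (k n)%:R] `&` [set t | H n t < c n].

Let mA w n : (k n <= n)%N -> measurable (A w n).
Proof.
by move=> kn; apply: measurableI; [exact: measurable_exceedances_ge|exact: mH].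
Qed.

Let mcell w1 w2 n : (k n <= n)%N -> measurable (cell w1 w2 n).
Proof.
move=> kn; apply: measurableI; last exact: mH.
by apply: measurableI; [exact: measurable_exceedances_ge|exact: measurable_exceedances_lt].
Qed.

Let prob_cells (w : nat -> R) n J : (k n <= n)%N ->
  pr (A (w 0%N) n) <= pr [set t | (k n)%:R <= N (w J) n t]
     + \sum_(j < J) pr (cell (w j) (w j.+1) n).
Proof.
move=> kn.
suff : pr (A (w 0%N) n) <= pr (A (w J) n) + \sum_(j < J) pr (cell (w j) (w j.+1) n).
  move=> /le_trans; apply; rewrite lerD2r; apply: fine_prob_le; first exact: mA.
    exact: measurable_exceedances_ge.
  by move=> t [].
elim: J => [|J IH]; first by rewrite big_ord0 addr0.
rewrite big_ord_recr/= [X in _ + X]addrC addrA (le_trans IH)// lerD2r.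
apply: prob_leU; [exact: mA|exact: mA|exact: mcell|].
move=> t [h1 h2]; have [h3|h3] := leP (k n)%:R (N (w J.+1) n t); first by left.
by right.
Qed.

Lemma hill_lower_tail_le (e : R) : 0 < e ->
  \forall n \near \oo, pr [set t | H n t < c n] <= expR (- (kt2 n * (2^-1 - e))).
Proof.
move=> e0.
(* [J] depends on [e] alone. The nodes span 9 units of [tau]; the entry 9 ensures [eta <= 1], and
   [9 * 18 / e] ensures [18 * eta <= e], of which 17 go to the cells and 1 to their number. *)
pose J := (Num.truncn (Num.max 9 (9 * 18 / e))).+1.
pose eta : R := 9 / J%:R.
have J0 : 0 < J%:R :> R by rewrite ltr0n.
have JM : Num.max 9 (9 * 18 / e) <= J%:R by apply: ltW; exact: truncnS_gt.
have J9 : 9 <= J%:R :> R by apply: le_trans JM; rewrite le_max lexx.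
have Je : 9 * 18 / e <= J%:R by apply: le_trans JM; rewrite le_max lexx orbT.
have eta0 : 0 < eta by rewrite divr_gt0.
have eta1 : eta <= 1 by rewrite ler_pdivrMr// mul1r.
have etae : 18 * eta <= e.
  by move: Je; rewrite /eta mulrA !ler_pdivrMr// mulrC; lra.
have J_eta : eta * J%:R = 9 by rewrite /eta divfK// gt_eqF.
(* Nodes from [- 5] to 4. Thresholds are taken within [eta / 2] above them: consecutive ones are
   ordered and less than [2 * eta * tau] apart, the first is below [s n - 4 * tau n] and the last
   above [s n + 4 * tau n]. *)
pose x (j : nat) : R := -5 + eta * j%:R.
have eta2 : 0 < eta / 2 by rewrite divr_gt0.
have /choice[w Hw] : forall j, exists w : nat -> R, \forall n \near \oo,
    increase_point U (w n) /\ s n + x j * tau n <= w n <= s n + (x j + eta / 2) * tau n.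
  by move=> j; exact: (near_choice (increase_point_near (x j) eta2)).
have xb j : (j <= J)%N -> -5 <= x j <= 4.
  move=> jJ; rewrite /x; have : eta * j%:R <= eta * J%:R by rewrite ler_pM2l// ler_nat.
  have : 0 <= eta * j%:R by rewrite mulr_ge0// ltW.
  by rewrite J_eta => ? ?; apply/andP; split; lra.
have wK j : (j <= J)%N -> \forall n \near \oo, `|w j n - s n| <= 5 * tau n.
  move=> jJ; near=> n; have t0 : 0 < tau n by near: n.
  have [_ /andP[h1 h2]] : increase_point U (w j n) /\
    s n + x j * tau n <= w j n <= s n + (x j + eta / 2) * tau n by near: n; exact: Hw.
  have /andP[x1 x2] := xb _ jJ.
  have := ler_wpM2r (ltW t0) x1.
  have x3 : x j + eta / 2 <= 5 by lra.
  have := ler_wpM2r (ltW t0) x3.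
  by rewrite ler_norml => ? ?; apply/andP; split; lra.
have few := @prob_too_few (w 0%N).
have many := @prob_too_many (w J).
have cells : forall j : 'I_J, \forall n \near \oo,
    pr (cell (w j n) (w j.+1 n) n) <= 2 * expR (- (kt2 n * (2^-1 - 17 * eta))).
  move=> j; apply: (@prob_cell (w j) (w j.+1) 5) => //.
  have jJ := ltn_ord j.
  near=> n; have t0 : 0 < tau n by near: n.
  have [i1 /andP[h1 h2]] : increase_point U (w j n) /\
    s n + x j * tau n <= w j n <= s n + (x j + eta / 2) * tau n by near: n; exact: Hw.
  have [i2 /andP[h3 h4]] : increase_point U (w j.+1 n) /\
    s n + x j.+1 * tau n <= w j.+1 n <= s n + (x j.+1 + eta / 2) * tau n by near: n; exact: Hw.
  have xS : x j.+1 = x j + eta by rewrite /x -[j.+1%:R]natr1; ring.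
  have et0 : 0 < eta * tau n by exact: mulr_gt0.
  split => //.
  - by rewrite xS in h3 h4; apply/andP; split; lra.
  - by near: n; apply: wK; exact: ltnW.
  - by near: n; exact: wK.
have cells' : \forall n \near \oo, forall j : 'I_J,
    pr (cell (w j n) (w j.+1 n) n) <= 2 * expR (- (kt2 n * (2^-1 - 17 * eta))).
  exact: (@filter_forall nat 'I_J (fun j : 'I_J => [set n : nat |
    pr (cell (w j n) (w j.+1 n) n) <= 2 * expR (- (kt2 n * (2^-1 - 17 * eta)))]) \oo _ cells).
(* The prefactor counts the two outer events and twice the [J] cells. *)
have small : \forall n \near \oo, expR (- (eta * kt2 n)) <= (2 + 2 * J%:R)^-1.
  by apply: near_exp_small => //; rewrite invr_gt0; lra.
near=> n; have t0 : 0 < tau n by near: n.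
have kn : (k n <= n)%N by near: n.
have T0 : 0 <= kt2 n by rewrite /kt2 mulr_ge0// exprn_ge0// ltW.
have hcells : forall j : 'I_J,
    pr (cell (w j n) (w j.+1 n) n) <= 2 * expR (- (kt2 n * (2^-1 - 17 * eta))).
  by near: n.
set E := expR (- (kt2 n * (2^-1 - 17 * eta))).
have E1 : expR (- kt2 n) <= E.
  rewrite /E ler_expR lerN2 ler_piMr//; lra.
have h1 : pr [set t | H n t < c n] <= pr [set t | N (w 0%N n) n t < (k n)%:R] + pr (A (w 0%N n) n).
  apply: prob_leU; [exact: mH|exact: measurable_exceedances_lt|exact: mA|].
  by move=> t h; have [h'|h'] := ltP (N (w 0%N n) n t) (k n)%:R; [left|right].
have h2 : pr [set t | N (w 0%N n) n t < (k n)%:R] <= expR (- kt2 n).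
  near: n; apply: few; near=> n; have t0' : 0 < tau n by near: n.
  have [i /andP[_ h]] : increase_point U (w 0%N n) /\
    s n + x 0%N * tau n <= w 0%N n <= s n + (x 0%N + eta / 2) * tau n by near: n; exact: Hw.
  split => //; rewrite (le_trans h)// lerD2l -mulNr ler_pM2r// /x mulr0; lra.
have h3 : pr [set t | (k n)%:R <= N (w J n) n t] <= expR (- kt2 n).
  near: n; apply: many; near=> n; have t0' : 0 < tau n by near: n.
  have [i /andP[h _]] : increase_point U (w J n) /\
    s n + x J * tau n <= w J n <= s n + (x J + eta / 2) * tau n by near: n; exact: Hw.
  split => //; rewrite (le_trans _ h)// lerD2l ler_pM2r// /x J_eta; lra.
have h4 : pr (A (w 0%N n) n) <= pr [set t | (k n)%:R <= N (w J n) n t]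
     + \sum_(j < J) pr (cell (w j n) (w j.+1 n) n) by exact: (@prob_cells (fun j => w j n)).
have h5 : \sum_(j < J) pr (cell (w j n) (w j.+1 n) n) <= 2 * J%:R * E.
  apply: (@le_trans _ _ (\sum_(j < J) 2 * E)).
    by apply: ler_sum => j _; exact: hcells.
  by rewrite sumr_const card_ord -[leLHS]mulr_natl mulrA [J%:R * 2]mulrC.
have h6 : pr [set t | H n t < c n] <= (2 + 2 * J%:R) * E.
  have -> : (2 + 2 * J%:R) * E = E + (E + 2 * J%:R * E) by ring.
  apply: (le_trans h1); apply: lerD; first exact: le_trans E1.
  by apply: (le_trans h4); apply: lerD => //; exact: le_trans E1.
have J2 : 0 < 2 + 2 * J%:R :> R by rewrite addr_gt0// mulr_gt0.
apply: (le_trans h6); rewrite mulrC -ler_pdivlMr//.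
have h7 : expR (- (eta * kt2 n)) <= (2 + 2 * J%:R)^-1 by near: n.
apply: le_trans (ler_wpM2l (expR_ge0 _) h7).
rewrite /E -expRD ler_expR.
have -> : - (kt2 n * (2^-1 - e)) + - (eta * kt2 n) = - (kt2 n * (2^-1 - e + eta)) by ring.
rewrite lerN2 ler_wpM2l// -subr_ge0 (_ : _ - _ = e - 18 * eta) ?subr_ge0//.
by ring.
Unshelve. all: end_near. Qed.

(** The threshold is taken slightly below [s n] and the tilt slightly above the optimal 1, so that
    under the tilted law the count is typically above [k] and the excess below [k * c]. These
    margins cost a multiple of [e] in the exponent. *)
Lemma hill_lower_tail_ge (e : R) : 0 < e <= 1 ->
  \forall n \near \oo, expR (- (kt2 n * (2^-1 + 7 * e))) <= pr [set t | H n t < c n].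
Proof.
move=> /andP[e0 e1].
(* With a mean count [k * (1 + y * tau)], where [eta <= y <= 7 / 4 * eta], the tilted mean of
   [alpha] times the excess is about [k * (alpha * c - (e - y) * tau)]. It is below [k * alpha * c]
   because [7 / 4 * eta < e], and above [k * (alpha * c - zeta * tau)] because [zeta > e]. *)
pose eta := e / 4; pose zeta := 2 * e; pose l := 1 + e.
(* The shift of the tilting parameters: its quadratic costs [r ^+ 2] and [(alpha * r) ^+ 2] must
   stay below the linear gains, of order [r * e] and [alpha * r * e]. *)
pose r := Num.min (e / 16) (e / 16 / alpha).
have r0 : 0 < r by rewrite lt_min !divr_gt0.
have re : r <= e / 16 by rewrite ge_min lexx.
have are : alpha * r <= e / 16.
  by rewrite mulrC -ler_pdivlMr// ge_min lexx orbT.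
have ar0 : 0 < alpha * r by exact: mulr_gt0.
have eta0 : 0 < eta by rewrite divr_gt0.
have l0 : 0 < l by rewrite /l; lra.
have lr0 : 0 < l - r by rewrite /l; lra.
have lr0' : 0 < l + r by rewrite /l; lra.
have eta2 : 0 < eta / 2 by rewrite divr_gt0.
have [w Hw] := near_choice (increase_point_near (- (3 / 2) * eta) eta2).
have wK : \forall n \near \oo, `|w n - s n| <= 2 * eta * tau n.
  near=> n; have t0 : 0 < tau n by near: n.
  have [_ /andP[h1 h2]] : increase_point U (w n) /\ s n + - (3 / 2) * eta * tau n
      <= w n <= s n + (- (3 / 2) * eta + eta / 2) * tau n by near: n.
  have et0 : 0 < eta * tau n by exact: mulr_gt0.
  by rewrite ler_norml; apply/andP; split; lra.
(* The relative surplus over [k] of the mean count, in units of [tau]. Tilting does not change this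
   mean, since [e^s L = 1]. *)
pose y n := (expR (s n - w n) - 1) / tau n.
have yb : \forall n \near \oo, eta <= y n <= 7 / 4 * eta.
  have t18 : 0 < (18 * eta)^-1 by rewrite invr_gt0 mulr_gt0.
  have t1 : 0 < (4 * eta)^-1 by rewrite invr_gt0 mulr_gt0.
  near=> n; have t0 : 0 < tau n by near: n.
  have [_ /andP[h1 h2]] : increase_point U (w n) /\ s n + - (3 / 2) * eta * tau n
      <= w n <= s n + (- (3 / 2) * eta + eta / 2) * tau n by near: n.
  have et0 : 0 < eta * tau n by exact: mulr_gt0.
  have ht : tau n <= (18 * eta)^-1 by near: n; exact: tau_le.
  rewrite -[_^-1]mul1r ler_pdivlMr ?mulr_gt0// in ht.
  rewrite /y ler_pdivlMr// ler_pdivrMr//; apply/andP; split.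
    have := expR_ge1Dx (s n - w n); lra.
  set u := s n - w n.
  have u1 : 0 <= u <= 3 / 2 * (eta * tau n) by rewrite /u; apply/andP; split; lra.
  case/andP: u1 => u0 u1.
  have u2 : `|u| <= 2^-1 by rewrite ger0_norm//; lra.
  have := expR_taylor1 u2; rewrite ler_norml => /andP[_ h3].
  have h4 := ler_pM u0 u0 u1 u1.
  have h5 := ler_wpM2r (ltW et0) ht.
  rewrite expr2 in h3; lra.
have [Ra1 Ra2] := cvg_laplace_ratio wK l0 lr0.
have [Rb1 Rb2] := cvg_laplace_ratio wK l0 lr0'.
have main_lim := cvg_ln_laplace_centered wK (a := 2 * eta) (ltW l0).
pose K1 n := alpha * tau n * r.
have K1r : K1 n / tau n @[n --> \oo] --> alpha * r.
  apply: (@cvg_trans _ (alpha * r @[n --> \oo])); last exact: cvg_cst.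
  apply: near_eq_cvg; near=> n; have t0 : 0 < tau n by near: n.
  by rewrite /K1; field; rewrite gt_eqF.
have K1rN : - K1 n / tau n @[n --> \oo] --> - (alpha * r).
  by under eq_fun do rewrite mulNr; exact: cvgN.
pose del := Num.min (r * e / 4) (alpha * r * e / 64).
have del0 : 0 < del by rewrite lt_min !divr_gt0 ?mulr_gt0.
have del1 : del <= r * e / 4 by rewrite ge_min lexx.
have del2 : del <= alpha * r * e / 64 by rewrite ge_min lexx orbT.
have rre : r * r <= r * (e / 16) by rewrite ler_pM2l.
have are2 : (alpha * r) * (alpha * r) <= alpha * r * (e / 16) by rewrite ler_pM2l.
have re0 : 0 < r * e by exact: mulr_gt0.
have are0 : 0 < alpha * r * e by exact: mulr_gt0.
have e2e : e * e <= e by rewrite ler_piMr// ltW.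
pose L x n := laplace V (w n) (alpha * tau n * x).
pose Da n := L (l - r) n / L l n - 1.
pose Db n := L (l + r) n / L l n - 1.
have g1 : (Da n + - r * tau n * m n) / tau n ^+ 2 + r * ((m n - alpha * c n) / tau n)
    + 7 / 4 * eta * (Da n / tau n) @[n --> \oo] -->
    (- r) ^+ 2 + l * - r + r * 1 + 7 / 4 * eta * - - r.
  by apply: cvgD; [apply: cvgD => //|]; exact: cvgMl_tmp.
have g2 : (Db n + r * tau n * m n) / tau n ^+ 2 - r * ((m n - alpha * c n) / tau n) - r * zeta
   @[n --> \oo] --> r ^+ 2 + l * r - r * 1 - r * zeta.
  by apply: cvgB; [apply: cvgB => //; exact: cvgMl_tmp|exact: cvg_cst].
have g3 : (expR (- K1 n) - 1 - - K1 n) / tau n ^+ 2 + eta * ((expR (- K1 n) - 1) / tau n)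
   @[n --> \oo] --> (- (alpha * r)) ^+ 2 / 2 + eta * - (alpha * r).
  apply: cvgD; first exact: cvg_expR_order2.
  by apply: cvgMl_tmp; exact: cvg_expR_order1.
have g4 : (expR (K1 n) - 1 - K1 n) / tau n ^+ 2 + 7 / 4 * eta * ((expR (K1 n) - 1) / tau n)
    - 2 * eta * (alpha * r)
   @[n --> \oo] --> (alpha * r) ^+ 2 / 2 + 7 / 4 * eta * (alpha * r) - 2 * eta * (alpha * r).
  apply: cvgB; last exact: cvg_cst.
  apply: cvgD; first exact: cvg_expR_order2.
  by apply: cvgMl_tmp; exact: cvg_expR_order1.
(* The limits in [l1] to [l4] are the exponents of the error terms: excess too large, excess too
   small, count too small, count too large. In the last one the gain is at least
   [alpha * r * e / 32], whence the 64 in [del]. *)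
have l1 : (- r) ^+ 2 + l * - r + r * 1 + 7 / 4 * eta * - - r < - del.
  by rewrite /l /eta; lra.
have l2 : r ^+ 2 + l * r - r * 1 - r * zeta < - del.
  by rewrite /l /zeta; lra.
have l3 : (- (alpha * r)) ^+ 2 / 2 + eta * - (alpha * r) < - del.
  by rewrite /eta sqrrN expr2; lra.
have l4 : (alpha * r) ^+ 2 / 2 + 7 / 4 * eta * (alpha * r) - 2 * eta * (alpha * r) < - del.
  by rewrite /eta [(alpha * r) ^+ 2]expr2; lra.
(* The right-hand side equals [- 1 / 2 - e / 2], and the slack [zeta] in the excess costs
   [l * zeta <= 4 * e]; the total stays within [6 * e]. *)
have lm : - (2^-1 + 6 * e) + l * zeta < - l + l ^+ 2 / 2 - 2 * eta * l.
  by rewrite /eta /l /zeta expr2; lra.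
have G1 := cvgr_lt _ g1 _ l1; have G2 := cvgr_lt _ g2 _ l2.
have G3 := cvgr_lt _ g3 _ l3; have G4 := cvgr_lt _ g4 _ l4.
have GM := cvgr_gt _ main_lim _ lm.
have Dapos : \forall n \near \oo, 0 < Da n / tau n.
  by apply: (cvgr_gt _ Ra1); rewrite opprK.
have Dbneg : \forall n \near \oo, Db n / tau n < 0.
  by apply: (cvgr_lt _ Rb1); rewrite oppr_lt0.
have small8 : \forall n \near \oo, expR (- (del * kt2 n)) <= 8^-1 by exact: near_exp_small.
have small2 : \forall n \near \oo, expR (- (e * kt2 n)) <= 2^-1 by exact: near_exp_small.
near=> n.
have t0 : 0 < tau n by near: n.
have t20 : 0 < tau n ^+ 2 by rewrite exprn_gt0.
have k0 : (0 < k n)%N by near: n.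
have kn : (k n <= n)%N by near: n.
have kR : 0 < (k n)%:R :> R by rewrite ltr0n.
have T0 : 0 < kt2 n by rewrite /kt2 mulr_gt0.
have [winc _] : increase_point U (w n) /\ s n + - (3 / 2) * eta * tau n
      <= w n <= s n + (- (3 / 2) * eta + eta / 2) * tau n by near: n.
have /andP[y1 y2] : eta <= y n <= 7 / 4 * eta by near: n.
have np : n%:R * expR (- w n) = (k n)%:R * (1 + y n * tau n).
  have -> : n%:R * expR (- w n) = (k n)%:R * expR (s n - w n) by near: n; apply: filterS nE => n; apply.
  by rewrite /y divfK ?gt_eqF//; ring.
have L0 : 0 < laplace V (w n) (alpha * tau n * l).
  by near: n; apply: (near_laplace_gt0 wK).
have kk : 0 <= alpha * tau n * r <= alpha * tau n * l.
  have at0 : 0 < alpha * tau n by exact: mulr_gt0.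
  have rl : r <= l by rewrite -subr_ge0 ltW.
  by apply/andP; split; [exact: ltW (mulr_gt0 at0 r0)|rewrite ler_pM2l].
have := tilting_lower_bound U_gt0 U_nd X_iid ((k n)%:R * (c n - zeta * tau n / alpha))
  ((k n)%:R * c n) (k n)%:R ((k n)%:R * (1 + 2 * eta * tau n)) n winc kk L0.
cbv zeta; rewrite np -/V -mulrBr -mulrDr -/(L l n) -/(L (l - r) n) -/(L (l + r) n) -/(Da n) -/(Db n).
rewrite -/(K1 n).
have tne : tau n != 0 by rewrite gt_eqF.
have ane : alpha != 0 by rewrite gt_eqF.
have expo (z f : R) : z / kt2 n <= f -> f < - del -> expR z <= expR (- (del * kt2 n)).
  rewrite ler_pdivrMr// => h1 h2; rewrite ler_expR (le_trans h1)//.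
  by rewrite -mulNr ler_pM2r// ltW.
have X1 : expR ((k n)%:R * (1 + y n * tau n) * Da n - K1 n * ((k n)%:R * c n)) <=
    expR (- (del * kt2 n)).
  have h1 : (Da n + - r * tau n * m n) / tau n ^+ 2 + r * ((m n - alpha * c n) / tau n)
    + 7 / 4 * eta * (Da n / tau n) < - del.
    by near: n; exact: G1.
  apply: (expo _ _ _ h1).
  have -> : ((k n)%:R * (1 + y n * tau n) * Da n - K1 n * ((k n)%:R * c n)) / kt2 n =
    (Da n + - r * tau n * m n) / tau n ^+ 2 + r * ((m n - alpha * c n) / tau n)
    + y n * (Da n / tau n).
    by rewrite /kt2 /K1; field; rewrite tne gt_eqF.
  by rewrite lerD2l ler_wpM2r// ltW//; near: n.
have X2 : expR ((k n)%:R * (1 + y n * tau n) * Db n +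
    K1 n * ((k n)%:R * (c n - zeta * tau n / alpha))) <= expR (- (del * kt2 n)).
  have h2 : (Db n + r * tau n * m n) / tau n ^+ 2 - r * ((m n - alpha * c n) / tau n) - r * zeta < - del.
    by near: n; exact: G2.
  apply: (expo _ _ _ h2).
  have -> : ((k n)%:R * (1 + y n * tau n) * Db n +
    K1 n * ((k n)%:R * (c n - zeta * tau n / alpha))) / kt2 n =
    (Db n + r * tau n * m n) / tau n ^+ 2 - r * ((m n - alpha * c n) / tau n) - r * zeta
    + y n * (Db n / tau n).
    by rewrite /kt2 /K1; field; rewrite tne ane gt_eqF.
  rewrite gerDl mulr_ge0_le0//; first by rewrite (le_trans _ y1)// ltW.
  by rewrite ltW//; near: n.
have X3 : expR ((k n)%:R * (1 + y n * tau n) * (expR (- K1 n) - 1) + K1 n * (k n)%:R)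
   <= expR (- (del * kt2 n)).
  have h3 : (expR (- K1 n) - 1 - - K1 n) / tau n ^+ 2 + eta * ((expR (- K1 n) - 1) / tau n) < - del.
    by near: n; exact: G3.
  apply: (expo _ _ _ h3).
  have -> : ((k n)%:R * (1 + y n * tau n) * (expR (- K1 n) - 1) + K1 n * (k n)%:R) / kt2 n =
    (expR (- K1 n) - 1 - - K1 n) / tau n ^+ 2 + y n * ((expR (- K1 n) - 1) / tau n).
    by rewrite /kt2; field; rewrite tne gt_eqF.
  rewrite lerD2l -subr_ge0 -mulrBl mulr_le0//; first by rewrite subr_le0.
  rewrite pmulr_lle0 ?invr_gt0// subr_le0 -expR0 ler_expR oppr_le0.
  by case/andP: kk.
have X4 : expR ((k n)%:R * (1 + y n * tau n) * (expR (K1 n) - 1)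
    - K1 n * ((k n)%:R * (1 + 2 * eta * tau n))) <= expR (- (del * kt2 n)).
  have h4 : (expR (K1 n) - 1 - K1 n) / tau n ^+ 2 + 7 / 4 * eta * ((expR (K1 n) - 1) / tau n)
    - 2 * eta * (alpha * r) < - del.
    by near: n; exact: G4.
  apply: (expo _ _ _ h4).
  have -> : ((k n)%:R * (1 + y n * tau n) * (expR (K1 n) - 1)
    - K1 n * ((k n)%:R * (1 + 2 * eta * tau n))) / kt2 n =
    (expR (K1 n) - 1 - K1 n) / tau n ^+ 2 + y n * ((expR (K1 n) - 1) / tau n)
    - 2 * eta * (alpha * r).
    by rewrite /kt2 /K1; field; rewrite tne gt_eqF.
  rewrite lerD2r lerD2l ler_wpM2r// pmulr_lge0 ?invr_gt0// subr_ge0 -expR0 ler_expR.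
  by case/andP: kk.
set B := [set t | _] `&` [set t | _].
have mB : measurable B.
  by apply: measurableI; [exact: measurable_exceedances_ge|exact: measurable_excess_lt].
have BH : pr B <= pr [set t | H n t < c n].
  apply: fine_prob_le => //; first exact: mH.
  move=> t [/= h1 h2]; have w0 : 0 < w n by case: winc.
  rewrite -(ltr_pM2l kR); apply: le_lt_trans h2; apply: hill_le_excess => //.
    by rewrite U_gt0// expR_gt1.
  by rewrite lt_order_stat.
have XM : expR (- ln (L l n) * ((k n)%:R * (1 + 2 * eta * tau n)) -
    alpha * tau n * l * ((k n)%:R * (c n - zeta * tau n / alpha))) <=
    expR (kt2 n * (2^-1 + 6 * e)).
  rewrite ler_expR.
  have -> : - ln (L l n) * ((k n)%:R * (1 + 2 * eta * tau n)) -
    alpha * tau n * l * ((k n)%:R * (c n - zeta * tau n / alpha)) =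
    kt2 n * (l * zeta - (l * tau n * (alpha * c n) +
     (1 + 2 * eta * tau n) * ln (L l n)) / tau n ^+ 2).
    by rewrite /kt2; field; rewrite ane tne.
  rewrite ler_pM2l//.
  have : - (2^-1 + 6 * e) + l * zeta < (l * tau n * (alpha * c n) +
     (1 + 2 * eta * tau n) * ln (L l n)) / tau n ^+ 2 by near: n; exact: GM.
  by move=> h; rewrite lerBlDr -lerBlDl [leLHS]addrC ltW.
move=> tilt.
have s8 : expR (- (del * kt2 n)) <= 8^-1 by near: n.
have s2 : expR (- (e * kt2 n)) <= 2^-1 by near: n.
have prB0 : 0 <= pr B by rewrite fine_ge0.
have half : 2^-1 <= expR (kt2 n * (2^-1 + 6 * e)) * pr B.
  exact: (ge_half_of_small_errors tilt X1 X2 X3 X4 s8 (ler_wpM2r prB0 XM)).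
apply: le_trans BH.
have E0 := expR_gt0 (kt2 n * (2^-1 + 6 * e)).
rewrite -(ler_pM2l E0); apply: le_trans half.
have -> : kt2 n * (2^-1 + 6 * e) = kt2 n * (2^-1 + 7 * e) - e * kt2 n by ring.
by rewrite expRD mulrAC -expRD subrr expR0 mul1r.
Unshelve. all: end_near. Qed.

Theorem hill_lower_tail_asymp :
  asymp_equiv (fun n => - ln (pr [set t | H n t < c n]))
    (fun n => (k n)%:R / 2 * tau n ^+ 2).
Proof.
apply/cvgrPdist_le => eps eps0.
(* The deviation [7 * e] of the exponent is divided by [1 / 2]. *)
pose e := Num.min 1 (eps / 14).
have e01 : 0 < e <= 1 by rewrite lt_min ltr01 divr_gt0//= ge_min lexx.
have [e0 e1] := andP e01.
have ee : e <= eps / 14 by rewrite ge_min lexx orbT.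
have lo := hill_lower_tail_ge e01; have hi := hill_lower_tail_le e0.
near=> n.
have t0 : 0 < tau n by near: n.
have k0 : (0 < k n)%N by near: n.
have kR : 0 < (k n)%:R :> R by rewrite ltr0n.
have T0 : 0 < kt2 n by rewrite /kt2 mulr_gt0// exprn_gt0.
have h1 : expR (- (kt2 n * (2^-1 + 7 * e))) <= pr [set t | H n t < c n] by near: n.
have h2 : pr [set t | H n t < c n] <= expR (- (kt2 n * (2^-1 - e))) by near: n.
set q := pr _ in h1 h2 *.
have q0 : 0 < q by apply: lt_le_trans h1; exact: expR_gt0.
have g1 : - (kt2 n * (2^-1 + 7 * e)) <= ln q by rewrite -ler_expR lnK.
have g2 : ln q <= - (kt2 n * (2^-1 - e)) by rewrite -ler_expR lnK.
have -> : (k n)%:R / 2 * tau n ^+ 2 = kt2 n / 2 by rewrite /kt2 mulrAC.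
have f1 : - ln q / (kt2 n / 2) <= 1 + 14 * e by rewrite ler_pdivrMr ?divr_gt0//; lra.
have f2 : 1 - 2 * e <= - ln q / (kt2 n / 2) by rewrite ler_pdivlMr ?divr_gt0//; lra.
by rewrite ler_norml; apply/andP; split; lra.
Unshelve. all: end_near. Qed.

End moderate_deviations.

(** * From the second-order condition to log-quantiles *)

Section tail_quantile.
Context {R : realType}.
Variables (alpha rho : R) (U A : R -> R).
Hypothesis alpha_gt0 : 0 < alpha.
Hypothesis rho_lt0 : rho < 0.
Hypothesis U_RV : RV' alpha^-1 U.
Hypothesis UA : second_order alpha rho U A.
Let V := log_quantile U.

Let U_gt0 x : 1 < x -> 0 < U x. Proof. by case: U_RV => H _ _ _; exact: H. Qed.
Let U_nd x y : 1 < x -> x <= y -> U x <= U y.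
Proof. by case: U_RV => _ H _ _; exact: H. Qed.

Lemma left_continuous_log_quantile s : 0 < s -> V y @[y --> s^'-] --> V s.
Proof.
move=> s0; case: U_RV => _ _ lc _.
have x1 : 1 < expR s by rewrite expR_gt1.
have H : U (expR y) @[y --> s^'-] --> U (expR s).
  apply/cvgrPdist_le => e e0.
  have /cvgrPdist_le /(_ e e0) := lc _ x1.
  rewrite -nbhs_nearE => -[del /= del0 Hdel].
  have ce : expR y @[y --> s^'-] --> expR s.
    by apply: cvg_at_left_filter; exact: continuous_expR.
  have ce' : \forall y \near s^'-, `|expR s - expR y| < del by move/cvgrPdist_lt : ce; apply.
  near=> y; apply: Hdel; first by rewrite /ball/=; near: y.
  by rewrite ltr_expR; near: y; exact: nbhs_left_lt.
have H2 : ln (U (expR y)) @[y --> s^'-] --> ln (U (expR s)).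
  by apply: continuous_cvg => //; apply: continuous_ln; exact: U_gt0.
rewrite /V log_quantileE//; apply: cvg_trans H2; apply: near_eq_cvg.
near=> y; rewrite log_quantileE//; near: y; exact: nbhs_left_gt.
Unshelve. all: end_near. Qed.

Let near_pos (y : R) : \forall s \near +oo, 0 < s /\ 0 < s + y.
Proof.
near=> s; split; near: s; first by apply: nbhs_pinfty_gt; rewrite num_real.
have : \forall s \near +oo, - y < s by apply: nbhs_pinfty_gt; rewrite num_real.
by apply: filterS => s; rewrite -subr_gt0 opprK.
Unshelve. all: end_near. Qed.

Let quotE (y : R) : \forall s \near +oo,
  expR (V (s + y) - V s) = U (expR s * expR y) / U (expR s) /\ 0 < U (expR s).
Proof.
near=> s; have [s0 sy0] : 0 < s /\ 0 < s + y by near: s; exact: near_pos.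
have h0 := U_gt0 (_ : 1 < expR s); have h1 := U_gt0 (_ : 1 < expR (s + y)).
rewrite !expR_gt1 in h0 h1.
by rewrite /V !log_quantileE// expRB !lnK ?posrE ?h0 ?h1// expRD.
Unshelve. all: end_near. Qed.

Lemma log_quantile_increment (y : R) :
  (V (s + y) - (s + y) / alpha) - (V s - s / alpha) @[s --> +oo] --> (0 : R).
Proof.
case: U_RV => _ _ _ rv.
have H : U (expR s * expR y) / U (expR s) @[s --> +oo] --> expR (y / alpha).
  rewrite expRM; exact: (cvg_comp _ _ (@cvg_expRy R) (rv _ (expR_gt0 y))).
have H2 : ln (U (expR s * expR y) / U (expR s)) @[s --> +oo] --> y / alpha.
  rewrite -[X in _ --> X]expRK; apply: continuous_cvg => //.
  by apply: continuous_ln; exact: expR_gt0.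
have : ln (U (expR s * expR y) / U (expR s)) - y / alpha @[s --> +oo] --> y / alpha - y / alpha.
  by apply: cvgB => //; exact: cvg_cst.
rewrite subrr; apply: cvg_trans; apply: near_eq_cvg; near=> s.
have [<- _] : expR (V (s + y) - V s) = U (expR s * expR y) / U (expR s) /\ 0 < U (expR s).
  by near: s; exact: quotE.
by rewrite expRK; field; rewrite gt_eqF.
Unshelve. all: end_near. Qed.

Lemma oriented_integral_powR (x : R) : 1 < x ->
  oriented_integral 1 x (fun u => u `^ (rho - 1)) = (x `^ rho - 1) / rho.
Proof.
move=> x1; rewrite /oriented_integral (ltW x1) /Rintegral.
have dpow (a u : R) : 0 < u -> derivable (@powR R ^~ a) u (1 : R).
  by move=> u0; apply: ex_derive; exact: is_derive1_powR.
have dF (u : R) : 0 < u -> is_derive u (1 : R) (fun u => u `^ rho / rho) (u `^ (rho - 1)).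
  move=> u0; have H := is_derive1_powR rho u0.
  apply: is_derive_eq.
  by rewrite /GRing.scale/= mulr0 add0r mulrA mulVf ?mul1r// lt_eqF.
have cF (u : R) : 0 < u -> {for u, continuous (fun u => u `^ rho / rho)}.
  move=> u0; apply: differentiable_continuous; apply/derivable1_diffP.
  by have [] := dF _ u0.
rewrite (@continuous_FTC2 _ _ (fun u => u `^ rho / rho)) //; last 3 first.
- apply: derivable_within_continuous => u; rewrite in_itv/= => /andP[u1 _].
  by apply: dpow; exact: lt_le_trans u1.
- split.
  + move=> u; rewrite in_itv/= => /andP[u1 _].
    by have [] := dF u (lt_trans ltr01 u1).
  + by apply: cvg_at_right_filter; exact: cF.
  + by apply: cvg_at_left_filter; apply: cF; exact: lt_trans x1.
- move=> u; rewrite in_itv/= => /andP[u1 _].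
  rewrite derive1E; have H := dF u (lt_trans ltr01 u1).
  exact: derive_val.
by rewrite powR1 -EFinB /= mul1r mulrBl mul1r.
Qed.

(** The point [x = e] of the second-order condition is a unit step on the log scale, the step of the
    telescoping. The logarithm keeps the limit: the relative error [q] is [O (A)], so
    [ln (1 + q) - q] is [o (A)]. *)
Lemma log_quantile_second_order :
  ((V (s + 1) - (s + 1) / alpha) - (V s - s / alpha)) / A (expR s) @[s --> +oo]
    --> (expR (rho * 1) - 1) / rho.
Proof.
have [_ _ A0 AN0 H] := UA.
have e1 : 1 < expR 1 :> R by rewrite expR_gt1.
have := H _ (expR_gt0 1); rewrite oriented_integral_powR// -!expRM => H1.
pose a s := A (expR s); pose pe : R := expR (1 * alpha^-1).
pose q s := U (expR s * expR 1) / U (expR s) / pe - 1.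
have pe0 : 0 < pe by exact: expR_gt0.
have a0 : a s @[s --> +oo] --> (0 : R) by exact: (cvg_comp _ _ (@cvg_expRy R) A0).
have aN0 : \forall s \near +oo, a s != 0 by exact: (@cvg_expRy R _ AN0).
have qa : q s / a s @[s --> +oo] --> (expR (1 * rho) - 1) / rho.
  have := cvg_comp _ _ (@cvg_expRy R) H1.
  move=> /(cvgMl_tmp (a := pe^-1)).
  rewrite [X in _ --> X](_ : _ = (expR (1 * rho) - 1) / rho); last by rewrite -/pe mulKf ?gt_eqF.
  apply: cvg_trans; apply: near_eq_cvg; near=> s.
  have as0 : a s != 0 by near: s.
  have [_ Us] : expR (V (s + 1) - V s) = U (expR s * expR 1) / U (expR s) /\ 0 < U (expR s).
    by near: s; exact: quotE.
  by rewrite /q /= -/pe -/(a s); field; rewrite as0 !gt_eqF.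
have q0 : q s @[s --> +oo] --> (0 : R).
  have : q s / a s * a s @[s --> +oo] --> (expR (1 * rho) - 1) / rho * 0 by exact: cvgM.
  rewrite mulr0; apply: cvg_trans; apply: near_eq_cvg; near=> s.
  by rewrite divfK//; near: s.
have rem : (ln (1 + q s) - q s) / a s @[s --> +oo] --> (0 : R).
  apply/norm_cvg0P.
  (* For [q] at most [1 / 4] in absolute value, [ln_taylor2] gives [28 / 4 + 1 / 2], which is below
     8. *)
  apply: (@squeeze_cvgr _ _ _ _ (fun=> 0) (fun s => 8 * `|q s| * `|q s / a s|)); last 2 first.
  - exact: cvg_cst.
  - rewrite [X in _ --> X](_ : 0 = 8 * `|0 : R| * `|(expR (1 * rho) - 1) / rho|).
      by apply: cvgM; [apply: cvgMl_tmp|]; exact: cvg_norm.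
    by rewrite normr0 mulr0 mul0r.
  near=> s; rewrite normr_ge0/=.
  rewrite !normf_div mulrA ler_wpM2r ?invr_ge0//.
  have q4 : `|q s| <= 4^-1 by near: s; move/cvgr0_norm_le : q0; apply.
  have h := ln_taylor2 q4.
  have -> : ln (1 + q s) - q s = (ln (1 + q s) - q s + q s ^+ 2 / 2) - q s ^+ 2 / 2 by ring.
  rewrite (le_trans (ler_normB _ _))//.
  have -> : `|q s ^+ 2 / 2| = `|q s| ^+ 2 / 2 by rewrite normf_div normrX (ger0_norm (ler0n _ 2)).
  have h2 : `|q s| ^+ 3 <= `|q s| ^+ 2 / 4 by rewrite exprSr ler_wpM2l ?exprn_ge0.
  have h3 : 0 <= `|q s| ^+ 2 by rewrite exprn_ge0.
  by rewrite -mulrA -expr2; lra.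
have : (ln (1 + q s) - q s) / a s + q s / a s @[s --> +oo] --> 0 + (expR (1 * rho) - 1) / rho.
  exact: cvgD.
rewrite add0r mul1r mulr1.
apply: cvg_trans; apply: near_eq_cvg; near=> s.
have as0 : a s != 0 by near: s.
have [Vs Us] : expR (V (s + 1) - V s) = U (expR s * expR 1) / U (expR s) /\ 0 < U (expR s).
  by near: s; exact: quotE.
have -> : 1 + q s = expR (V (s + 1) - V s - alpha^-1).
  by rewrite [RHS]expRD expRN Vs /q /pe mul1r; ring.
by rewrite expRK -/(a s); field; rewrite as0 gt_eqF.
Unshelve. all: end_near. Qed.

(** The ratio of [b] to the rate has a nonzero limit, so [b] inherits its regular variation, while
    its left continuity comes from [U]. *)
Lemma regular_log_quantile : exists c0 : R, let b s := V s - s / alpha - c0 in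
  b s / A (expR s) @[s --> +oo] --> rho^-1 /\
  forall y, b (s + y) / b s @[s --> +oo] --> expR (rho * y).
Proof.
have [_ Arv A0 AN0 _] := UA.
pose a s := A (expR s).
have a0 : a s @[s --> +oo] --> (0 : R) by exact: (cvg_comp _ _ (@cvg_expRy R) A0).
have aN0 : \forall s \near +oo, a s != 0 by exact: (@cvg_expRy R _ AN0).
have arv y : a (s + y) / a s @[s --> +oo] --> expR (rho * y).
  rewrite mulrC expRM; under eq_fun do rewrite /a expRD.
  exact: (cvg_comp _ _ (@cvg_expRy R) (Arv _ (expR_gt0 y))).
have [c0 bc] := second_order_primitive rho_lt0 ltr01 log_quantile_increment arv a0 aN0
  log_quantile_second_order.
pose b s := V s - s / alpha - c0; exists c0; split => // y; rewrite -/b.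
have rV0 : rho^-1 != 0 by rewrite invr_eq0 lt_eqF.
have H1 : b (s + y) / a (s + y) @[s --> +oo] --> rho^-1.
  exact: (cvg_comp _ _ (cvg_addry y) bc).
have H2 : (b s / a s)^-1 @[s --> +oo] --> rho^-1^-1 by exact: cvgV.
have : (b (s + y) / a (s + y)) * (a (s + y) / a s) * (b s / a s)^-1 @[s --> +oo] -->
   rho^-1 * expR (rho * y) * rho^-1^-1 by apply: cvgM => //; exact: cvgM.
rewrite mulrAC mulfV// mul1r; apply: cvg_trans; apply: near_eq_cvg; near=> s.
have as0 : a s != 0 by near: s.
have asy0 : a (s + y) != 0.
  by near: s; exact: (@cvg_addry _ y _ aN0).
have bs0 : b s != 0.
  have : b s / a s != 0.
    near: s; have := bc => /cvgrPdist_lt /(_ `|rho^-1|); rewrite normr_gt0 => /(_ rV0).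
    by apply: filterS => s; apply: contraTneq => ->; rewrite subr0 ltxx.
  by apply: contra_neq => ->; rewrite mul0r.
rewrite -/(b (s + y)) -/(b s); by field; rewrite as0 asy0 bs0.
Unshelve. all: end_near. Qed.

End tail_quantile.

(** A move of length at most [del] keeps the ratio of the values of [b] at least [1 / 2]; finitely
    many moves reach any larger point. *)
Lemma sgr_near_constant (R : realType) (b : R -> R) (rho : R) :
  (forall s, 0 < s -> b y @[y --> s^'-] --> b s) ->
  (forall y, b (s + y) / b s @[s --> +oo] --> expR (rho * y)) ->
  exists2 N, b N != 0 & forall s, N <= s -> Num.sg (b s) = Num.sg (b N).
Proof.
move=> blc brv.
have h : 0 < (2^-1 : R) <= 1 by apply/andP; split; lra.
have [del [N [d0 N0 H]]] := regularly_varying_uniform h blc brv.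
have step s u : N <= s -> `|u| <= del -> Num.sg (b (s + u)) = Num.sg (b s).
  move=> Ns ud; have [bs Hb] := H _ _ Ns ud.
  have : 0 < b (s + u) / b s by move: Hb; rewrite ler_norml => /andP[? ?]; lra.
  have [b0|b0|b0] := ltgtP (b s) 0; last by rewrite b0 eqxx in bs.
    by rewrite nmulr_lgt0 ?invr_lt0// => b1; rewrite !ltr0_sg.
  by rewrite pmulr_lgt0 ?invr_gt0// => b1; rewrite !gtr0_sg.
have del0 : `|0 : R| <= del by rewrite normr0 ltW.
have [bN _] := H N 0 (lexx _) del0; exists N => //.
move=> s Ns.
have stepn j : Num.sg (b (N + del *+ j)) = Num.sg (b N).
  elim: j => [|j IH]; first by rewrite mulr0n addr0.
  rewrite mulrSr addrA step ?IH//; first by rewrite lerDl mulrn_wge0// ltW.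
  by rewrite gtr0_norm.
pose j := Num.truncn ((s - N) / del).
have je : j%:R <= (s - N) / del < j.+1%:R.
  by apply: truncn_itv; rewrite divr_ge0 ?(ltW d0)// subr_ge0.
rewrite -(stepn j) (_ : s = N + del *+ j + (s - N - del *+ j)); last by ring.
apply: step; first by rewrite lerDl mulrn_wge0// ltW.
case/andP: je; rewrite ler_pdivlMr// ltr_pdivrMr// -[j.+1%:R]natr1 mulrDl mul1r -mulr_natl => h1 h2.
by rewrite ger0_norm; lra.
Qed.

(** * Decay of the Hill statistic under the second-order condition *)

Section hill_decay.
Context {R : realType} {d : measure_display} {T : measurableType d}.
Variables (P : probability T R) (alpha rho : R) (U A : R -> R).
Variables (X : nat -> {RV P >-> R}) (k : nat -> nat).
Hypothesis alpha_gt0 : 0 < alpha.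
Hypothesis U_RV : RV' alpha^-1 U.
Hypothesis UA : second_order alpha rho U A.
Hypothesis rho_lt0 : rho < 0.
Hypothesis X_iid : iid_RV U X.
Hypothesis k_int : intermediate R k.
Let An n := A (n%:R / (k n)%:R).

Lemma intermediate_gt0 : \forall n \near \oo, (0 < k n <= n)%N.
Proof.
have [koo kn0] := k_int.
have k0 : \forall n \near \oo, (0 < k n)%N.
  exact: (koo _ (nbhs_infty_gt 0)).
have kn1 : \forall n \near \oo, `|(k n)%:R / n%:R| <= 1 :> R.
  by move/cvgr0_norm_le : kn0; apply.
near=> n; have -> : (0 < k n)%N by near: n.
have n0 : (0 < n)%N by near: n; exact: nbhs_infty_gt.
have : `|(k n)%:R / n%:R| <= 1 :> R by near: n.
by rewrite ger0_norm ?divr_ge0// ler_pdivrMr ?ltr0n// mul1r ler_nat.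
Unshelve. all: end_near. Qed.

Lemma intermediate_ratio : (n%:R / (k n)%:R : R) @[n --> \oo] --> +oo.
Proof.
have [_ kn0] := k_int; apply/cvgryPge => M.
pose M' := Num.max M 1; have M'0 : 0 < M' by rewrite lt_max ltr01 orbT.
have iM : 0 < M'^-1 by rewrite invr_gt0.
have H : \forall n \near \oo, `|(k n)%:R / n%:R| <= M'^-1 :> R.
  by move/cvgr0_norm_le : kn0; apply.
near=> n.
have /andP[k0 kn] : (0 < k n <= n)%N by near: n; exact: intermediate_gt0.
have n0 : (0 < n)%N by exact: leq_trans kn.
have : `|(k n)%:R / n%:R| <= M'^-1 :> R by near: n.
rewrite ger0_norm ?divr_ge0// -[X in X <= _]invf_div lef_pV2 ?posrE ?divr_gt0 ?ltr0n//.
by apply: le_trans; rewrite le_max lexx.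
Unshelve. all: end_near. Qed.

Let s n : R := ln (n%:R / (k n)%:R).

Let s_pinfty : s n @[n --> \oo] --> +oo.
Proof.
apply/cvgryPge => M; near=> n.
have h : expR M <= n%:R / (k n)%:R by near: n; move/cvgryPge : intermediate_ratio; apply.
by rewrite -ler_expR lnK// posrE (lt_le_trans _ h)// expR_gt0.
Unshelve. all: end_near. Qed.

Let As : \forall n \near \oo, A (expR (s n)) = An n.
Proof.
near=> n; have h : 0 < n%:R / (k n)%:R :> R.
  near: n; have /cvgryPgt := intermediate_ratio; exact.
by rewrite /s lnK.
Unshelve. all: end_near. Qed.

Let An_neq0 : \forall n \near \oo, An n != 0.
Proof. by have [_ _ _ AN0 _] := UA; exact: (intermediate_ratio AN0). Qed.

(** The common form of the three claims. Replacing [rho * b (s n)] by [An n] in [centering] makes an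
    error [o (An n)], hence [o (tau n)] since [An] is at most [C * tau] in absolute value; the
    identity prescribed for [c] thus yields a gap equivalent to [tau]. *)
Lemma hill_decay (tau c : nat -> R) (C : R) :
  (\forall n \near \oo, 0 < tau n) ->
  tau n @[n --> \oo] --> (0 : R) ->
  (k n)%:R * tau n ^+ 2 @[n --> \oo] --> +oo ->
  (\forall n \near \oo, `|An n| <= C * tau n) ->
  (\forall n \near \oo, alpha * c n = 1 + alpha / (1 - rho) * An n - tau n) ->
  asymp_equiv
    (fun n => - ln (fine (P [set t | hill_H (fun j => X j t) (k n) n < c n])))
    (fun n => (k n)%:R / 2 * tau n ^+ 2).
Proof.
move=> tau0 tau_cvg ktau AC ce.
have [U0 Und _ _] := U_RV.
have [c0 [bA brv]] := regular_log_quantile alpha_gt0 rho_lt0 U_RV UA.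
pose b s := log_quantile U s - s / alpha - c0.
have bs : b (s n) / An n @[n --> \oo] --> rho^-1.
  apply: cvg_trans (cvg_comp _ _ s_pinfty bA); apply: near_eq_cvg; near=> n.
  by rewrite /=; have -> : A (expR (s n)) = An n by near: n.
have rho0 : rho != 0 by rewrite lt_eqF.
have r1 : 0 < 1 - rho by rewrite subr_gt0 (lt_trans rho_lt0).
have b_le : \forall n \near \oo, `|b (s n)| <= (`|rho^-1| + 1) * C * tau n.
  have H : \forall n \near \oo, `|rho^-1 - b (s n) / An n| <= 1.
    by move/cvgrPdist_le : bs; apply.
  near=> n; have A0 : An n != 0 by near: n.
  have h1 : `|rho^-1 - b (s n) / An n| <= 1 by near: n.
  have h2 : `|An n| <= C * tau n by near: n.
  have h3 : `|b (s n) / An n| <= `|rho^-1| + 1.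
    have := ler_normB rho^-1 (rho^-1 - b (s n) / An n).
    by rewrite opprB addrC subrK; lra.
  rewrite -[b (s n)](divfK A0) normrM -mulrA.
  exact: ler_pM.
apply: (hill_lower_tail_asymp U0 Und X_iid alpha_gt0 rho_lt0
  (left_continuous_log_quantile U_RV) brv _ _ s_pinfty tau0 tau_cvg ktau b_le).
- by apply: filterS intermediate_gt0 => n /andP[].
- by apply: filterS intermediate_gt0 => n /andP[].
have rb : (rho * (b (s n) / An n) - 1) @[n --> \oo] --> (0 : R).
  rewrite [X in _ --> X](_ : 0 = rho * rho^-1 - 1); last by rewrite mulfV// subrr.
  by apply: cvgB; [exact: cvgMl_tmp|exact: cvg_cst].
pose C' := Num.max C 1; have C'0 : 0 < C' by rewrite lt_max ltr01 orbT.
have D0 : (rho * (b (s n) / An n) - 1) * (An n / tau n) @[n --> \oo] --> (0 : R).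
  apply/norm_cvg0P.
  apply: (@squeeze_cvgr _ _ _ _ (fun=> 0) (fun n => `|rho * (b (s n) / An n) - 1| * C')); last 2 first.
  - exact: cvg_cst.
  - rewrite [X in _ --> X](_ : 0 = `|0 : R| * C'); last by rewrite normr0 mul0r.
    by apply: cvgMr_tmp; exact: cvg_norm.
  near=> n; have t0 : 0 < tau n by near: n.
  rewrite normr_ge0/= normrM ler_wpM2l// normf_div (gtr0_norm t0) ler_pdivrMr//.
  have h2 : `|An n| <= C * tau n by near: n.
  by rewrite (le_trans h2)// ler_pM2r// le_max lexx.
have : 1 + alpha / (1 - rho) * ((rho * (b (s n) / An n) - 1) * (An n / tau n))
    @[n --> \oo] --> 1 + alpha / (1 - rho) * 0.
  by apply: cvgD; [exact: cvg_cst|exact: cvgMl_tmp].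
rewrite mulr0 addr0; apply: cvg_trans; apply: near_eq_cvg; near=> n.
have t0 : 0 < tau n by near: n.
have A0 : An n != 0 by near: n.
have -> : alpha * c n = 1 + alpha / (1 - rho) * An n - tau n by near: n.
by rewrite /centering -/(b (s n)); field; rewrite A0 !gt_eqF.
Unshelve. all: end_near. Qed.

(** The sign is read off [b]: as [b / A] tends to [1 / rho < 0], [A] eventually has the sign
    opposite to that of [b], which is constant. *)
Lemma sgr_An : exists e : R, [/\ e = 1 \/ e = -1, sgn_infty A = e &
  \forall n \near \oo, Num.sg (An n) = e].
Proof.
have [c0 [bA brv]] := regular_log_quantile alpha_gt0 rho_lt0 U_RV UA.
pose b s := log_quantile U s - s / alpha - c0.
have blc z : 0 < z -> b y @[y --> z^'-] --> b z.
  move=> z0; apply: cvgB; last exact: cvg_cst.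
  apply: cvgB; first exact: (left_continuous_log_quantile U_RV).
  by apply: cvg_at_left_filter; apply: cvgMr_tmp; exact: cvg_id.
have [N bN HN] := sgr_near_constant blc brv.
pose e := - Num.sg (b N).
have sgA : \forall t \near +oo, Num.sg (A t) = e.
  have iv : rho^-1 < 0 by rewrite invr_lt0.
  have [M HM] : exists M, forall s, M <= s -> b s / A (expR s) < 0.
    have r2 : 0 < - rho^-1 / 2 by lra.
    have /cvgyP/(_ _ r2)[M HM] := bA; exists M => s' Ms.
    by have := HM _ Ms; rewrite ler_norml -/(b s') => /andP[? ?]; lra.
  near=> t; have t0 : 0 < t by near: t; apply: nbhs_pinfty_gt; rewrite num_real.
  have tM : expR (Num.max M N) <= t by near: t; apply: nbhs_pinfty_ge; rewrite num_real.
  have : Num.max M N <= ln t by rewrite -ler_expR lnK.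
  rewrite ge_max => /andP[Mt Nt].
  have := HM _ Mt; rewrite lnK// /e -(HN _ Nt).
  have [b0|b0|->] := ltgtP (b (ln t)) 0; last by rewrite mul0r ltxx.
    by rewrite nmulr_rlt0 // invr_gt0 => a0; rewrite gtr0_sg// ltr0_sg// opprK.
  by rewrite pmulr_rlt0 // invr_lt0 => a0; rewrite ltr0_sg// gtr0_sg.
exists e; split.
- by rewrite /e; have [b0|b0|b0] := sgrP (b N); rewrite ?b0 ?eqxx in bN *; [by []|right|left; rewrite opprK].
- rewrite /sgn_infty; apply/cvg_lim => //.
  by apply: (@cvg_trans _ (e @[t --> +oo])); [apply: near_eq_cvg; apply: filterS sgA|exact: cvg_cst].
- exact: (intermediate_ratio sgA).
Unshelve. all: end_near. Qed.

End hill_decay.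

(** The value [+oo] for [t <= 0] is consistent: such a [t] lies below the positive level
    [a / alpha]. *)
Lemma lt_reciprocal (R : realType) (alpha a t : R) : 0 < alpha -> 0 < a ->
  (alpha%:E < reciprocal a t)%E = (t < a / alpha).
Proof.
move=> alpha0 a0; rewrite /reciprocal; have [t0|t0] := leP t 0.
  by rewrite ltry; apply/esym; rewrite (le_lt_trans t0)// divr_gt0.
by rewrite lte_fin !ltr_pdivlMr// mulrC.
Qed.

Lemma lt_limn_einf (R : realType) (a : R) (u : nat -> R) :
  (a%:E < limn_einf (fun n => (u n)%:E))%E ->
  exists2 M, a < M & \forall n \near \oo, M <= u n.
Proof.
move=> au.
have [M aM Mu] : exists2 M : R, a < M & (M%:E < limn_einf (fun n => (u n)%:E))%E.
  move: au; case: (limn_einf _) => [r| |//].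
    by rewrite lte_fin => ar; exists ((a + r) / 2); rewrite ?lte_fin; lra.
  by move=> _; exists (a + 1); rewrite ?ltry//; lra.
exists M => //.
move: Mu; rewrite limn_einf_lim => Mu.
have := lte_lim (@nondecreasing_einfs _ _) (@is_cvg_einfs _ _) Mu.
apply: filterS => n Mn; rewrite -lee_fin; apply: (le_trans Mn).
by apply: ereal_inf_lbound; exists n => //=.
Qed.

Unset Implicit Arguments.

Theorem corollary7 (R : realType) (d : measure_display) (T : measurableType d)
    (P : probability T R) (alpha rho : R) (U A : R -> R)
    (X : nat -> {RV P >-> R}) (k : nat -> nat)
    (alpha_gt0 : 0 < alpha)
    (U_RV : RV' alpha^-1 U)
    (UA : second_order alpha rho U A)
    (rho_lt0 : rho < 0)
    (X_iid : iid_RV U X)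
    (k_int : intermediate R k) :
  [/\ (* 1 *)
      forall theta : nat -> R, (forall j, 0 <= theta j) ->
        much_less (fun n => (Num.sqrt (k n)%:R)^-1) (fun n => theta (k n)) ->
        much_less (fun n => theta (k n)) (fun=> 1) ->
        (fun n => `|A (n%:R / (k n)%:R)|) =O_\oo (fun n => theta (k n)) ->
        conservative_with_decay_rate P alpha
          (fun n w =>
             alpha_hat_bc A rho (theta (k n)) (fun j => X j w) (k n) n)
          (fun n => (k n)%:R / 2 * theta (k n) ^+ 2),
      (* 2 *)
      forall theta : nat -> R, (forall j, 0 <= theta j) ->
        theta (k n) @[n --> \oo] --> (0 : R) ->
        Num.sqrt (k n)%:R * `|A (n%:R / (k n)%:R)| @[n --> \oo] --> +oo ->
        ((- (alpha / (1 - rho)) * sgn_infty A)%:E <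
           limn_einf (fun n => (theta (k n) / `|A (n%:R / (k n)%:R)|)%:E))%E ->
        conservative_with_decay_rate P alpha
          (fun n w => alpha_hat (theta (k n)) (fun j => X j w) (k n) n)
          (fun n => (k n)%:R / 2 *
             (theta (k n) + alpha / (1 - rho) * A (n%:R / (k n)%:R)) ^+ 2)
    & (* 3 *)
      Num.sqrt (k n)%:R * A (n%:R / (k n)%:R) @[n --> \oo] --> +oo ->
      conservative_with_decay_rate P alpha
        (fun n w => hill_estimator (fun j => X j w) (k n) n)
        (fun n => (k n)%:R * alpha ^+ 2 / (2 * (1 - rho) ^+ 2) *
           A (n%:R / (k n)%:R) ^+ 2)].
Proof.
pose An n := A (n%:R / (k n)%:R).
have r1 : 0 < 1 - rho by rewrite subr_gt0 (lt_trans rho_lt0).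
have rpos : \forall n \near \oo, (0 < k n)%N.
  by apply: filterS (intermediate_gt0 k_int) => n /andP[].
have A0 : An n @[n --> \oo] --> (0 : R).
  by have [_ _ A0 _ _] := UA; exact: (cvg_comp _ _ (intermediate_ratio k_int) A0).
have An_neq0 : \forall n \near \oo, An n != 0.
  by have [_ _ _ AN0 _] := UA; exact: (intermediate_ratio k_int AN0).
have part2 : forall theta : nat -> R, (forall j, 0 <= theta j) ->
    theta (k n) @[n --> \oo] --> (0 : R) ->
    Num.sqrt (k n)%:R * `|An n| @[n --> \oo] --> +oo ->
    ((- (alpha / (1 - rho)) * sgn_infty A)%:E <
       limn_einf (fun n => (theta (k n) / `|An n|)%:E))%E ->
    conservative_with_decay_rate P alpha
      (fun n w => alpha_hat (theta (k n)) (fun j => X j w) (k n) n)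
      (fun n => (k n)%:R / 2 * (theta (k n) + alpha / (1 - rho) * An n) ^+ 2).
  move=> theta theta0 theta_cvg kA /lt_limn_einf[M aM HM].
  have [e [_ sgAe sgA]] := sgr_An alpha_gt0 U_RV UA rho_lt0 k_int.
  rewrite sgAe in aM.
  pose tau n := theta (k n) + alpha / (1 - rho) * An n.
  (* The strict lower limit makes [del] positive. As [An n] is [e] times its absolute value, [tau]
     is at least [del] times that absolute value, which gives its positivity and the divergence of
     [k * tau ^+ 2]. *)
  pose del := M + alpha / (1 - rho) * e.
  have del0 : 0 < del by rewrite /del; lra.
  have tau_ge : \forall n \near \oo, del * `|An n| <= tau n.
    near=> n; have h1 : M <= theta (k n) / `|An n| by near: n.
    have An0 : An n != 0 by near: n.
    rewrite ler_pdivlMr ?normr_gt0// in h1.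
    have h2 : An n = e * `|An n|.
      by have <- : Num.sg (An n) = e by [near: n]; rewrite -numEsg.
    have h3 : alpha / (1 - rho) * An n = alpha / (1 - rho) * (e * `|An n|) by rewrite -h2.
    rewrite /tau /del h3; lra.
  pose c n := (1 - theta (k n)) / alpha.
  have dec : asymp_equiv
    (fun n => - ln (fine (P [set t | hill_H (fun j => X j t) (k n) n < c n])))
    (fun n => (k n)%:R / 2 * tau n ^+ 2).
    apply: (@hill_decay _ _ _ P alpha rho U A X k alpha_gt0 U_RV UA rho_lt0 X_iid k_int
      tau c del^-1).
    - near=> n; apply: (@lt_le_trans _ _ (del * `|An n|)); last by near: n.
      by rewrite mulr_gt0// normr_gt0; near: n.
    - rewrite -[X in _ --> X](_ : 0 + alpha / (1 - rho) * 0 = 0); last by rewrite mulr0 addr0.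
      by apply: cvgD => //; exact: cvgMl_tmp.
    - apply/cvgryPge => B; near=> n.
      have h1 : del * `|An n| <= tau n by near: n.
      have h2 : (Num.max 1 B) / del ^+ 2 <= Num.sqrt (k n)%:R * `|An n|.
        by near: n; move/cvgryPge : kA; apply.
      have h3 : 1 <= Num.sqrt (k n)%:R * `|An n| by near: n; move/cvgryPge : kA; apply.
      have h0 : 0 <= del * `|An n| by rewrite mulr_ge0// ltW.
      have h4 := ler_pM h0 h0 h1 h1.
      have h5 : (k n)%:R = Num.sqrt (k n)%:R ^+ 2 :> R by rewrite sqr_sqrtr.
      rewrite ler_pdivrMr ?exprn_gt0// in h2.
      have h6 : B <= Num.max 1 B by rewrite le_max lexx orbT.
      apply: (le_trans h6); apply: (le_trans h2).
      apply: (@le_trans _ _ ((k n)%:R * (del * `|An n| * (del * `|An n|)))).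
        have -> : (k n)%:R * (del * `|An n| * (del * `|An n|)) =
          (Num.sqrt (k n)%:R * `|An n|) * (Num.sqrt (k n)%:R * `|An n|) * del ^+ 2.
          by rewrite {1}h5; ring.
        by rewrite ler_pM2r ?exprn_gt0// ler_peMl// (le_trans _ h3).
      by rewrite ler_wpM2l// expr2.
    - near=> n; have h1 : del * `|An n| <= tau n by near: n.
      by rewrite ler_pdivlMl.
    - by apply: nearW => n; rewrite /c /tau -/(An n); field; rewrite !gt_eqF.
  rewrite /conservative_with_decay_rate /asymp_equiv; apply: cvg_trans dec.
  apply: near_eq_cvg; near=> n.
  (* Positivity of the numerator holds eventually, because [theta] tends to 0. *)
  have t1 : 0 < 1 - theta (k n).
    rewrite subr_gt0; near: n; move/cvgr_lt : theta_cvg; apply; exact: ltr01.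
  congr (- ln (fine (P _)) / _); apply/seteqP.
  by split=> t /=; rewrite /alpha_hat lt_reciprocal.
split => //.
- move=> theta theta0 [theta_neq0 ktheta] [_ theta_cvg] AO.
  have theta_cvg0 : theta (k n) @[n --> \oo] --> (0 : R).
    by move: theta_cvg; under eq_fun do rewrite divr1.
  move/eqO_exP : AO => [C C0 HC].
  (* The bias correction moves the level by exactly the bias of the centering, so the gap is [theta]
     itself. *)
  pose c n := (1 - theta (k n)) / alpha + An n / (1 - rho).
  have dec : asymp_equiv
    (fun n => - ln (fine (P [set t | hill_H (fun j => X j t) (k n) n < c n])))
    (fun n => (k n)%:R / 2 * theta (k n) ^+ 2).
    apply: (@hill_decay _ _ _ P alpha rho U A X k alpha_gt0 U_RV UA rho_lt0 X_iid k_int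
      (fun n => theta (k n)) c C) => //.
    - by near=> n; rewrite lt_neqAle theta0 andbT eq_sym; near: n.
    - apply/cvgryPge => B; near=> n.
      pose B' := Num.max 1 B; have B'0 : 0 < B' by rewrite lt_max ltr01.
      have tn0 : theta (k n) != 0 by near: n.
      have t0 : 0 < theta (k n) by rewrite lt_neqAle theta0 andbT eq_sym.
      have k0 : (0 < k n)%N by near: n.
      have s0 : 0 < Num.sqrt (k n)%:R :> R by rewrite sqrtr_gt0 ltr0n.
      have iB : 0 < B'^-1 by rewrite invr_gt0.
      have : `|(Num.sqrt (k n)%:R)^-1 / theta (k n)| <= B'^-1.
        by near: n; move/cvgr0_norm_le : ktheta; apply; rewrite invr_gt0 lt_max ltr01.
      rewrite ger0_norm; last by rewrite divr_ge0// invr_ge0 sqrtr_ge0.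
      rewrite -invfM lef_pV2 ?posrE ?mulr_gt0// => h.
      have hB : 1 <= B' by rewrite le_max lexx.
      have hB' : B <= B' by rewrite le_max lexx orbT.
      have h2 := ler_pM (ltW B'0) (ltW B'0) h h.
      have h5 : (k n)%:R = Num.sqrt (k n)%:R ^+ 2 :> R by rewrite sqr_sqrtr.
      apply: (le_trans hB'); apply: (@le_trans _ _ (B' * B')); first by rewrite ler_peMl// ltW.
      by apply: (le_trans h2); rewrite {3}h5 le_eqVlt; apply/orP; left; apply/eqP; ring.
    - near=> n; have h : `|(`|An n|)| <= C * `|theta (k n)| by near: n.
      by rewrite normr_id (ger0_norm (theta0 _)) in h.
    - by apply: nearW => n; rewrite /c -/(An n); field; rewrite !gt_eqF.
  rewrite /conservative_with_decay_rate /asymp_equiv; apply: cvg_trans dec.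
  apply: near_eq_cvg; near=> n.
  have t1 : 0 < 1 - theta (k n).
    rewrite subr_gt0; near: n; move/cvgr_lt : theta_cvg0; apply; exact: ltr01.
  congr (- ln (fine (P _)) / _); apply/seteqP.
  by split=> t /=; rewrite /alpha_hat_bc lt_reciprocal// /bc_H ltrBlDr.
- move=> kA.
  have A_gt0 : \forall n \near \oo, 0 < An n.
    near=> n; have k0 : (0 < k n)%N by near: n.
    have s0 : 0 < Num.sqrt (k n)%:R :> R by rewrite sqrtr_gt0 ltr0n.
    have : 0 < Num.sqrt (k n)%:R * An n by near: n; move/cvgryPgt : kA; apply.
    by rewrite pmulr_rgt0.
  have [e [_ sgAe sgA]] := sgr_An alpha_gt0 U_RV UA rho_lt0 k_int.
  have e1 : e = 1.
    have [n [h1 h2]] : exists n, 0 < An n /\ Num.sg (An n) = e.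
      apply: (@filter_ex _ \oo); near=> n; split; near: n => //.
    by rewrite -h2 gtr0_sg.
  have kA' : Num.sqrt (k n)%:R * `|An n| @[n --> \oo] --> +oo.
    apply: cvg_trans kA; apply: near_eq_cvg; near=> n.
    by rewrite gtr0_norm//; near: n.
  have z0 : (fun _ : nat => 0 : R) (k n) @[n --> \oo] --> (0 : R) by exact: cvg_cst.
  (* For [theta = 0] the lower limit is 0, above [- alpha / (1 - rho)], since [A] is eventually
     positive along the sequence and its limiting sign is 1. *)
  have := part2 (fun=> 0) (fun=> lexx _) z0 kA'.
  rewrite sgAe e1 mulr1.
  have -> : (fun n => (0 / `|An n|)%:E) = (fun=> 0%:E) by apply/funext => n; rewrite mul0r.
  have [-> _] := @cvg_limn_einf_sup R (fun=> 0%:E) 0%:E (cvg_cst _).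
  rewrite lte_fin oppr_lt0 divr_gt0// => /(_ isT).
  rewrite /conservative_with_decay_rate /alpha_hat /hill_estimator subr0.
  congr (asymp_equiv _ _); apply/funext => n.
  by rewrite add0r -/(An n); field; rewrite gt_eqF.
Unshelve. all: end_near. Qed.
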